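(* Let $K$ be a quartic extension of $\mathbb{Q}$ and let $\lambda\in K$ be an element generating $K$ over $\mathbb{Q}$. Let $P(x)=x^4+px^3+qx^2+rx+s\in\mathbb{Q}[x]$ be the (monic) minimal polynomial of $\lambda$ over $\mathbb{Q}$. If the genus $1$ curve $$v^2=P(u)=u^4+pu^3+qu^2+ru+s$$ is an elliptic curve of positive rank over $\mathbb{Q}$, then the elliptic curve $E\colon y^2=x(x-1)(x-\lambda)$ has infinite rank over $K\mathbb{Q}^{\mathrm{ab}}$.
   Context: $\mathbb{Q}^{\mathrm{ab}}$ denotes the maximal abelian extension of $\mathbb{Q}$ inside a fixed algebraic closure $\overline{\mathbb{Q}}$, $K\subset\overline{\mathbb{Q}}$, and $K\mathbb{Q}^{\mathrm{ab}}$ is the compositum of $K$ and $\mathbb{Q}^{\mathrm{ab}}$ in $\overline{\mathbb{Q}}$. The genus $1$ curve $v^2=P(u)$ refers to the smooth projective curve over $\mathbb{Q}$ with this affine equation; it is regarded as an elliptic curve by choosing a rational point as origin, and its rank over $\mathbb{Q}$ is that of its group of $\mathbb{Q}$-points. An elliptic curve $E$ has infinite rank over a field $F$ if $E(F)\otimes_{\mathbb{Z}}\mathbb{Q}$ is infinite-dimensional over $\mathbb{Q}$. *)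

(* Defs.v *)
From HB Require Import structures.
From mathcomp Require Import all_boot all_order all_fingroup all_algebra all_field.
From mathcomp Require Import boolp.
From mathcomp.multinomials Require Import monalg.

Set Implicit Arguments.
Unset Strict Implicit.
Unset Printing Implicit Defensive.

Import GRing.Theory.
Local Open Scope ring_scope.

(* * The field K Q^ab; algC plays the role of the algebraic closure of Q. *)

(* The smallest subfield of algC containing T. *)
Definition subfield_gen (T : algC -> Prop) : {pred algC} :=
  [pred x | `[< forall S : {pred algC}, divring_closed S ->
                  (forall y, T y -> y \in S) -> x \in S >]].

Lemma mem_subfield_gen (T : algC -> Prop) (x : algC) :
  T x -> x \in subfield_gen T.
Proof. by move=> Tx; apply/asboolP => S _; apply. Qed.

Lemma subfield_gen_divring_closed (T : algC -> Prop) :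
  divring_closed (subfield_gen T).
Proof.
split=> [|x y /asboolP xT /asboolP yT|x y /asboolP xT /asboolP yT];
  apply/asboolP => S cS TS; have [S1 SB SV] := cS => //.
- by apply: SB; [apply: xT | apply: yT].
- by apply: SV; [apply: xT | apply: yT].
Qed.

HB.instance Definition _ (T : algC -> Prop) :=
  GRing.isDivringClosed.Build algC (subfield_gen T)
    (subfield_gen_divring_closed T).

Record subfield_gen_type (T : algC -> Prop) := SubfieldGen {
  subfield_gen_val :> algC;
  _ : subfield_gen_val \in subfield_gen T }.
HB.instance Definition _ T := [isSub for @subfield_gen_val T].
HB.instance Definition _ T := [Choice of subfield_gen_type T by <:].
HB.instance Definition _ T :=
  [SubChoice_isSubIntegralDomain of subfield_gen_type T by <:].
HB.instance Definition _ T :=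
  [SubIntegralDomain_isSubField of subfield_gen_type T by <:].

(* x lies in some finite abelian (Galois) extension of Q inside algC. *)
Definition in_abelian_ext (x : algC) : Prop :=
  exists (L : splittingFieldType rat) (f : {rmorphism L -> algC}) (a : L),
    [/\ galois 1%AS {:L}%AS, abelian 'Gal({:L}%AS / 1%AS) & x = f a].

Definition Qab : {pred algC} := subfield_gen in_abelian_ext.

Section Compositum.
Variables (K : fieldExtType rat) (iota : {rmorphism K -> algC}).

Definition in_K_or_Qab (x : algC) : Prop :=
  (exists a : K, x = iota a) \/ x \in Qab.

Definition KQab : fieldType := subfield_gen_type in_K_or_Qab.

Definition KQab_inj (a : K) : KQab :=
  SubfieldGen (mem_subfield_gen (or_introl (ex_intro _ a (erefl (iota a))))).

End Compositum.

(* * The rank of an abelian group A, i.e. the dimension of A (x) Q.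
   The group law is given by its graph: law P Q R means P + Q = R.
   A (x)_Z Q is presented as the quotient of the Q-vector space {malg rat[A]}
   with basis A by the span of the vectors [P + Q] - [P] - [Q]. *)

Section Rank.
Variables (A : choiceType) (law : A -> A -> A -> Prop).

Definition tensorQ_rel (x : {malg rat[A]}) : Prop :=
  exists (n : nat) (c : 'I_n -> rat) (P Q R : 'I_n -> A),
    (forall i, law (P i) (Q i) (R i)) /\
    x = \sum_(i < n) c i *: (mkmalgU (R i) 1 - mkmalgU (P i) 1 - mkmalgU (Q i) 1).

(* dim_Q (A (x) Q) >= n: there are n vectors of A (x) Q which are linearly
   independent. *)
Definition rank_ge (n : nat) : Prop :=
  exists x : 'I_n -> {malg rat[A]},
    forall c : 'I_n -> rat,
      tensorQ_rel (\sum_(i < n) c i *: x i) -> forall i, c i = 0.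

Definition positive_rank : Prop := rank_ge 1.
Definition infinite_rank : Prop := forall n, rank_ge n.

End Rank.

(* * The elliptic curve y^2 = x (x - 1) (x - l).
   None is the point at infinity, which is the origin. *)

Section Legendre.
Variables (F : fieldType) (l : F).

Definition on_legendre (P : option (F * F)) : bool :=
  if P is Some (x, y) then y ^+ 2 == x * (x - 1) * (x - l) else true.

Record legendre := Legendre {
  legendre_pt :> option (F * F);
  _ : on_legendre legendre_pt }.
HB.instance Definition _ := [isSub for legendre_pt].
HB.instance Definition _ := [Choice of legendre by <:].

(* The chord and tangent law; m is the slope of the line through P and Q. *)
Definition legendre_add (P Q : option (F * F)) : option (F * F) :=
  match P, Q with
  | None, _ => Q
  | _, None => P
  | Some (x1, y1), Some (x2, y2) =>
      if (x1 == x2) && (y1 == - y2) then None else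
      let m := if x1 == x2
               then (3 * x1 ^+ 2 - 2 * (1 + l) * x1 + l) / (2 * y1)
               else (y2 - y1) / (x2 - x1) in
      let x3 := m ^+ 2 + 1 + l - x1 - x2 in
      Some (x3, m * (x1 - x3) - y1)
  end.

Definition legendre_law (P Q R : legendre) : Prop := legendre_add P Q = R.

End Legendre.
Arguments legendre_law {F} l P Q R.

(* * The genus 1 curve v^2 = u^4 + p u^3 + q u^2 + r u + s (for a separable
   right-hand side, in characteristic different from 2).
   Its smooth projective model has, besides the affine points, two points
   oo+ and oo-, both rational, at which v / u^2 takes the value 1 and -1;
   they are encoded as inl true and inl false. *)

Section Quartic.
Variables (F : fieldType) (p q r s : F).

Definition on_quartic (A : bool + F * F) : bool :=
  if A is inr (u, v)
  then v ^+ 2 == u ^+ 4 + p * u ^+ 3 + q * u ^+ 2 + r * u + s else true.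

Record quartic := Quartic {
  quartic_pt :> bool + F * F;
  _ : on_quartic quartic_pt }.
HB.instance Definition _ := [isSub for quartic_pt].
HB.instance Definition _ := [Choice of quartic by <:].

(* The group law with origin oo+. Generically, let v = - u^2 + b u + c be the
   parabola through oo-, A and B (with multiplicities). The function
   v + u^2 - b u - c has polar divisor 2 (oo+) + 2 (oo-), so the parabola meets
   the curve in a fourth point T; with S the image of T under v |-> - v, so that
   S + T ~ (oo+) + (oo-), one finds A + B ~ S + (oo+), i.e. the sum is S.
   The u-coordinates of the affine intersection points are the roots of
     (u^2 - b u - c)^2 - (u^4 + p u^3 + q u^2 + r u + s)
       = - (2 b + p) u^3 + (b^2 - 2 c - q) u^2 - (r - 2 b c) u + (c^2 - s),
   whose degree drops by one each time oo- is repeated; T = oo- (hence S = oo+)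
   if it drops once more than forced by A and B. *)
Definition quartic_add (A B : bool + F * F) : bool + F * F :=
  let parabola b c u := inr (u, u ^+ 2 - b * u - c) in
  match A, B with
  | inl true, _ => B
  | _, inl true => A
  | inl false, inl false =>
      let b := - p / 2 in
      let c := (b ^+ 2 - q) / 2 in
      let d := r - 2 * b * c in
      if d == 0 then inl true else parabola b c ((c ^+ 2 - s) / d)
  | inl false, inr (u1, v1) | inr (u1, v1), inl false =>
      let b := - p / 2 in
      let c := v1 + u1 ^+ 2 - b * u1 in
      let d := b ^+ 2 - 2 * c - q in
      if d == 0 then inl true else parabola b c ((r - 2 * b * c) / d - u1)
  | inr (u1, v1), inr (u2, v2) =>
      if (u1 == u2) && (v1 == - v2) then inl false else
      let b := if u1 == u2
               then (4 * u1 ^+ 3 + 3 * p * u1 ^+ 2 + 2 * q * u1 + r) / (2 * v1)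
                    + 2 * u1
               else (v2 - v1) / (u2 - u1) + u1 + u2 in
      let c := v1 + u1 ^+ 2 - b * u1 in
      let d := 2 * b + p in
      if d == 0 then inl true
      else parabola b c ((b ^+ 2 - 2 * c - q) / d - u1 - u2)
  end.

(* The group law with origin O: R is the sum of A and B iff the divisors
   A + B and R + O are linearly equivalent, which amounts to an equality of
   sums for the law with origin oo+. *)
Definition quartic_law (O A B R : quartic) : Prop :=
  quartic_add A B = quartic_add R O.

End Quartic.

(* Main.v *)
Require Import Defs.
From HB Require Import structures.
From mathcomp Require Import all_boot all_order all_fingroup all_algebra all_field.
From mathcomp Require Import boolp ring.
From mathcomp.multinomials Require Import monalg.

Set Implicit Arguments.
Unset Strict Implicit.
Unset Printing Implicit Defensive.

Import Order.TTheory GRing.Theory Num.Theory.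
Local Open Scope ring_scope.

(* The quartic C: v^2 = P(u) is the cubic curve E' through x = 2 v + 2 u^2 + p u + 2 g,
   where P - (u^2 + p u / 2 + g)^2 is linear,
   and a Weierstrass addition is associative because (x, y) |-> [(X - x, Y - y)] embeds the
   points into the ideal classes of the coordinate ring. For a large prime l, pigeonhole
   on residues puts a nonzero rational point T of E' in the formal group at l, and
   multiplication by l makes the valuation k of its parameter odd and at least 3.
   The parabola through oo- tangent to C at the point (a, v) of T meets C again above u,
   the abscissa of 2 T, and for a root L of P this says
     (L^2 - b L - c)^2 = - d (L - a)^2 (L - u).
   So y^2 = x (x - 1) (x - L) has a point with abscissa u and ordinate in
   sqrt(delta) K, where delta = u (u - 1) d. It has infinite order, being in the formal
   group at l, while delta has the odd valuation - 3 k at l. As l varies one gets points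
   over K(sqrt delta_1, sqrt delta_2, ...), a subfield of K Q^ab. For l large with
   respect to the number field B generated by K and the previous points, sqrt(delta) is
   not in B; then a multiple of the new point that is defined over B has ordinate 0 or
   is the origin, so the new point is independent of the previous ones. *)

(** * Ideal classes of the coordinate ring and associativity *)

(** The tangent parabola gives u - L = d t^2 with t in K, so that u (u - 1) (u - L) is the rational
    number delta times a square of K: the new ordinate needs only the square root of a rational
    number, and such roots lie in Q^ab. The valuations at l of u, u - 1 and d are all - k, so for
    odd k the prime l ramifies in Q(sqrt delta), while almost all primes are unramified in B. The
    bound k >= 3 comes from the parameter z of the new point, whose square has valuation k.
    Multiplication by l multiplies z by l and a unit as soon as z^2 is divisible by l^2, and this
    rules out torsion; for odd k it means k >= 3. No place of algC above l is chosen. All estimates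
    take place in the ring of algebraic numbers integral at every place above l, and valuation k
    means l^k times a unit. Since z is only the square root of a number of odd valuation, the formal
    group is filtered by elements pi of which only the square need be a multiple of l. *)

Section IdealClasses.
Variable R : comNzRingType.
Implicit Types (I L G H : R -> Prop) (x y z a b : R).

Definition is_ideal L :=
  [/\ L 0, forall x y, L x -> L y -> L (x + y) & forall r x, L x -> L (r * x)].

(** Being an intersection of ideals, it comes with an induction principle: a property of all its
    elements is proved by checking that it defines an ideal containing [G]. No linear combinations
    appear. *)
Definition idgen G x := forall L, is_ideal L -> (forall g, G g -> L g) -> L x.

Definition setmul G H x := exists2 g, G g & exists2 h, H h & x = g * h.

Definition single a : R -> Prop := fun x => x = a.

Lemma idgen_ideal G : is_ideal (idgen G).
Proof.
split=> [L [] //|x y Gx Gy L hL GL|r x Gx L hL GL]; have [L0 LD LM] := hL.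
  by apply: LD; [apply: Gx | apply: Gy].
by apply: LM; apply: Gx.
Qed.

Lemma mem_idgen G x : G x -> idgen G x.
Proof. by move=> Gx L _; apply. Qed.

Lemma idealB L x y : is_ideal L -> L x -> L y -> L (x - y).
Proof. by case=> _ LD LM Lx Ly; apply: LD => //; rewrite -mulN1r; apply: LM. Qed.

Lemma ideal_colon L y : is_ideal L -> is_ideal (fun t => L (t * y)).
Proof.
case=> L0 LD LM; split=> [|u v Lu Lv|r u Lu]; first by rewrite mul0r.
  by rewrite mulrDl; apply: LD.
by rewrite -mulrA; apply: LM.
Qed.

(** Subsets stand for the ideals that they generate, so that a product of ideals is just the set of
    products of generators. *)
Definition idle G H := forall x, G x -> idgen H x.
Definition ideq G H := idle G H /\ idle H G.

Lemma idle_idgen G H x : idle G H -> idgen G x -> idgen H x.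
Proof. by move=> sGH Gx; apply: Gx; [apply: idgen_ideal | apply: sGH]. Qed.

Lemma idle_refl G : idle G G. Proof. by move=> x; apply: mem_idgen. Qed.

Lemma idle_trans G H I : idle G H -> idle H I -> idle G I.
Proof. by move=> sGH sHI x /sGH; apply: idle_idgen. Qed.

Lemma setmul_idle G G' H : idle G G' -> idle (setmul G H) (setmul G' H).
Proof.
move=> sG x [g Gg [h Hh ->]].
apply: (sG _ Gg (fun t => idgen (setmul G' H) (t * h))).
  by apply: ideal_colon; apply: idgen_ideal.
by move=> g' Gg'; apply: mem_idgen; exists g' => //; exists h.
Qed.

Lemma setmulC G H : setmul G H = setmul H G.
Proof.
by apply: funext => x; apply: propext; split=> -[g Gg [h Hh ->]];
   exists h => //; exists g => //; rewrite mulrC.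
Qed.

Lemma setmulA G H I : setmul G (setmul H I) = setmul (setmul G H) I.
Proof.
apply: funext => x; apply: propext; split.
  case=> g Gg [_ [h Hh [i Ii ->]] ->].
  by exists (g * h); [exists g => //; exists h | exists i => //; rewrite mulrA].
case=> _ [g Gg [h Hh ->]] [i Ii ->].
by exists g => //; exists (h * i); [exists h => //; exists i | rewrite mulrA].
Qed.

Lemma setmulCA G H I : setmul G (setmul H I) = setmul H (setmul G I).
Proof. by rewrite !setmulA (setmulC G). Qed.

Lemma setmul1 G : setmul (single 1) G = G.
Proof.
apply: funext => x; apply: propext; split=> [[_ -> [h Hh ->]]|Gx].
  by rewrite mul1r.
by exists 1 => //; exists x => //; rewrite mul1r.
Qed.

Lemma single_mul a b : setmul (single a) (single b) = single (a * b).
Proof.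
apply: funext => x; apply: propext; split=> [[_ -> [_ -> ->]]//|->].
by exists a => //; exists b.
Qed.

Lemma ideq_setmul G G' H : ideq G G' -> ideq (setmul G H) (setmul G' H).
Proof. by case=> sG sG'; split; apply: setmul_idle. Qed.

Lemma ideq_setmulr G H H' : ideq H H' -> ideq (setmul G H) (setmul G H').
Proof. by rewrite !(setmulC G); apply: ideq_setmul. Qed.

Lemma ideq_trans G H I : ideq G H -> ideq H I -> ideq G I.
Proof.
by case=> GH HG [HI IH]; split; [apply: idle_trans HI | apply: idle_trans HG].
Qed.

Lemma ideq_sym G H : ideq G H -> ideq H G. Proof. by case. Qed.

End IdealClasses.

Arguments single {R} a.

Section IdealClassEquivalence.
Variable R : comNzRingType.
Hypothesis intR : forall x y : R, x * y = 0 -> x = 0 \/ y = 0.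
Implicit Types (G H I : R -> Prop).

(** Equality of ideal classes, with denominators cleared to avoid fractional ideals. *)
Definition idcls G H :=
  exists a b : R, [/\ a <> 0, b <> 0 & ideq (setmul (single a) G) (setmul (single b) H)].

Lemma idcls_refl G : idcls G G.
Proof. by exists 1, 1; split; try exact/eqP/oner_neq0; split; apply: idle_refl. Qed.

Lemma idcls_sym G H : idcls G H -> idcls H G.
Proof. by case=> a [b [a0 b0 e]]; exists b, a; split=> //; apply: ideq_sym. Qed.

Lemma idcls_trans G H I : idcls G H -> idcls H I -> idcls G I.
Proof.
case=> a [b [a0 b0 eGH]] [c [d [c0 d0 eHI]]].
exists (c * a), (b * d); split; try by case/intR.
rewrite -!single_mul -!setmulA; apply: (ideq_trans (ideq_setmulr _ eGH)).
by rewrite setmulCA; apply: ideq_setmulr.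
Qed.

Lemma idcls_mul G G' H : idcls G G' -> idcls (setmul G H) (setmul G' H).
Proof.
case=> a [b [a0 b0 e]]; exists a, b; split=> //.
by rewrite !setmulA; apply: ideq_setmul.
Qed.

Lemma idcls_mul2 G G' H H' :
  idcls G G' -> idcls H H' -> idcls (setmul G H) (setmul G' H').
Proof.
move=> eG eH; apply: (@idcls_trans _ (setmul G' H)); first exact: idcls_mul.
by rewrite !(setmulC G'); apply: idcls_mul.
Qed.

Lemma idcls_single G a : a <> 0 -> ideq G (single a) -> idcls G (single 1).
Proof.
move=> a0 e; exists 1, a; split=> //; first exact/eqP/oner_neq0.
by rewrite setmul1 single_mul mulr1.
Qed.

(** If a G and b generate the same ideal, then b = a c with c in the ideal of [G], and every a g is
    a multiple of a c; cancelling a shows that c is a generator. *)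
Lemma idcls1_principal G :
  idcls G (single 1) -> exists2 c : R, idgen G c & forall g, G g -> exists r, g = r * c.
Proof.
case=> a [b [a0 b0]]; rewrite single_mul mulr1 => -[sab sba].
have [c Gc def_b] : exists2 c, idgen G c & b = a * c.
  apply: (sba b erefl (fun t => exists2 c, idgen G c & t = a * c)).
    have [G0 GD GM] := idgen_ideal G.
    split=> [|_ _ [x Gx ->] [y Gy ->]|r _ [x Gx ->]].
    - by exists 0; rewrite ?mulr0.
    - by exists (x + y); [apply: GD | rewrite mulrDr].
    - by exists (r * x); [apply: GM | rewrite mulrCA].
  by move=> _ [_ -> [g Gg ->]]; exists g => //; apply: mem_idgen.
exists c => // g Gg.
have /sab : setmul (single a) G (a * g) by exists a => //; exists g.
move=> /(_ (fun t => exists r, t = r * b))[].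
- split=> [|_ _ [r ->] [s ->]|r _ [s ->]]; first by exists 0; rewrite mul0r.
    by exists (r + s); rewrite mulrDl.
  by exists (r * s); rewrite mulrA.
- by move=> _ ->; exists 1; rewrite mul1r.
move=> r; rewrite def_b mulrCA => /eqP; rewrite -subr_eq0 -mulrBr => /eqP/intR[//|].
by move/eqP; rewrite subr_eq0 => /eqP->; exists r.
Qed.

End IdealClassEquivalence.

(* The pair (u, w) stands for u + w y in F[x][y] / (y^2 - f). *)
Definition wring (F : fieldType) (f : {poly F}) : Type := ({poly F} * {poly F})%type.

Section CoordinateRing.
Variables (F : fieldType) (f : {poly F}).
Local Notation wring := (wring f).
HB.instance Definition _ := GRing.Zmodule.on wring.

Definition wring_one : wring := (1, 0).
Definition wring_mul (g h : wring) : wring :=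
  (g.1 * h.1 + f * (g.2 * h.2), g.1 * h.2 + g.2 * h.1).

Fact wring_mulA : associative wring_mul.
Proof. by move=> [? ?] [? ?] [? ?]; congr pair => /=; ring. Qed.
Fact wring_mulC : commutative wring_mul.
Proof. by move=> [? ?] [? ?]; congr pair => /=; ring. Qed.
Fact wring_mul1 : left_id wring_one wring_mul.
Proof. by move=> [? ?]; congr pair => /=; ring. Qed.
Fact wring_mulD : left_distributive wring_mul +%R.
Proof. by move=> [? ?] [? ?] [? ?]; congr pair => /=; ring. Qed.
Fact wring_one_neq0 : wring_one != 0.
Proof. by rewrite xpair_eqE /= oner_eq0. Qed.
HB.instance Definition _ := GRing.Zmodule_isComNzRing.Build wring
  wring_mulA wring_mulC wring_mul1 wring_mulD wring_one_neq0.

Definition wpoly (u : {poly F}) : wring := (u, 0).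

Fact wpoly_zmod : zmod_morphism wpoly.
Proof. by move=> u v; congr pair => /=; ring. Qed.
Fact wpoly_monoid : monoid_morphism wpoly.
Proof. by split=> // u v; congr pair => /=; ring. Qed.
HB.instance Definition _ := GRing.isZmodMorphism.Build {poly F} wring wpoly wpoly_zmod.
HB.instance Definition _ := GRing.isMonoidMorphism.Build {poly F} wring wpoly wpoly_monoid.

Definition wconst (k : F) : wring := wpoly k%:P.

Fact wconst_zmod : zmod_morphism wconst.
Proof. by move=> u v; rewrite /wconst !rmorphB. Qed.
Fact wconst_monoid : monoid_morphism wconst.
Proof. by split=> [|u v]; rewrite /wconst ?rmorph1 ?rmorphM. Qed.
HB.instance Definition _ := GRing.isZmodMorphism.Build F wring wconst wconst_zmod.
HB.instance Definition _ := GRing.isMonoidMorphism.Build F wring wconst wconst_monoid.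

Definition wY : wring := (0, 1).

Lemma wY_sqr : wY * wY = wpoly f.
Proof. by congr pair => /=; ring. Qed.

Definition wnorm (g : wring) : {poly F} := g.1 ^+ 2 - f * g.2 ^+ 2.

Lemma wnormM g h : wnorm (g * h) = wnorm g * wnorm h.
Proof. by case: g h => [? ?] [? ?]; rewrite /wnorm /=; ring. Qed.

Hypothesis size_f : size f = 4%N.

(** Since f has odd degree, the degrees of u^2 and f w^2 have different parity, so the leading terms
    of the norm cannot cancel. *)
Lemma size_wnorm g :
  size (wnorm g) = maxn (size g.1).*2.-1 (if g.2 == 0 then 0%N else (size g.2).*2.+2).
Proof.
have f0 : f != 0 by rewrite -size_poly_eq0 size_f.
have sz2 (u : {poly F}) : size (u ^+ 2) = (size u).*2.-1.
  have [->|u0] := eqVneq u 0; first by rewrite expr0n size_poly0.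
  by rewrite expr2 size_mul // addnn.
case: g => u w; rewrite /wnorm /=.
have [->|w0] := eqVneq w 0; first by rewrite expr0n mulr0 subr0 maxn0 sz2.
have szfw : size (f * w ^+ 2) = (size w).*2.+2.
  rewrite size_mul ?expf_neq0 // size_f sz2.
  by case: (size w) (size_poly_eq0 w) => [|n] //; rewrite (negPf w0).
have [lt|lt|eq] := ltngtP (size (u ^+ 2)) (size (f * w ^+ 2)).
- by rewrite addrC size_polyDl ?size_polyN // szfw -sz2; apply/esym/maxn_idPr; rewrite -szfw ltnW.
- by rewrite size_polyDl ?size_polyN // -sz2; apply/esym/maxn_idPl; rewrite -szfw ltnW.
have := congr1 odd eq; rewrite szfw sz2 oddS oddS negbK odd_double.
have [/eqP/[!size_poly_eq0]/eqP u0|n] := posnP (size u).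
  by move: eq; rewrite szfw u0 expr0n size_poly0.
by case: (size u) n => // n _; rewrite doubleS -pred_Sn oddS odd_double.
Qed.

Lemma wnorm_eq0 g : wnorm g = 0 -> g = 0.
Proof.
move/eqP; rewrite -size_poly_eq0 size_wnorm; case: g => u w /=.
case: (eqVneq w 0) => [->|w0]; last by rewrite -leqn0 geq_max andbF.
rewrite maxn0 => szu; congr pair; apply/eqP; rewrite -size_poly_eq0.
by case: (size u) szu => //= n; rewrite doubleS.
Qed.

Lemma wring_integral (g h : wring) : g * h = 0 -> g = 0 \/ h = 0.
Proof.
move=> gh0; have /eqP : wnorm (g * h) = 0 by rewrite gh0 /wnorm /= !expr0n /= mulr0 subr0.
by rewrite wnormM mulf_eq0 => /orP[]/eqP/wnorm_eq0; [left | right].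
Qed.

(** The norm of x - x0 has degree 2 and no norm has degree 1. Hence one of the two factors has a
    constant norm, and such an element is itself constant. *)
Lemma wring_div_XsubC (g h : wring) (x0 : F) : h * g = wpoly ('X - x0%:P) ->
  exists2 k : F, k != 0 & g = wpoly k%:P \/ h = wpoly k%:P.
Proof.
move=> e; have /(congr1 (fun p : {poly F} => size p)) : wnorm (h * g) = ('X - x0%:P) ^+ 2.
  by rewrite e /wnorm /= expr0n mulr0 subr0.
rewrite wnormM size_exp_XsubC.
have sz1 (k : wring) : size (wnorm k) = 1%N -> exists2 l : F, l != 0 & k = wpoly l%:P.
  case: k => u w; rewrite size_wnorm /=; case: eqP => [->|_]; last first.
    by move=> em; have := leq_maxr (size u).*2.-1 (size w).*2.+2; rewrite em.
  rewrite maxn0 => szu; have /size_poly1P[l l0 ->] : size u == 1%N.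
    by case: (size u) szu => [|[|n]] //; rewrite !doubleS.
  by exists l.
have sz2 (k : wring) : size (wnorm k) <> 2%N.
  rewrite size_wnorm; have [_|k20] := eqVneq k.2 0.
    by rewrite maxn0; case: (size k.1) => [|[|n]] //; rewrite !doubleS.
  move=> em; have := leq_maxr (size k.1).*2.-1 (size k.2).*2.+2.
  by rewrite em !ltnS leqn0 double_eq0 size_poly_eq0 (negPf k20).
have [->|h0] := eqVneq (wnorm h) 0; first by rewrite mul0r size_poly0.
have [->|g0] := eqVneq (wnorm g) 0; first by rewrite mulr0 size_poly0.
rewrite size_mul //; move: (sz1 h) (sz1 g) (sz2 h) (sz2 g).
case: (size (wnorm h)) (size_poly_eq0 (wnorm h)) => [|[|[|[|n]]]]; rewrite ?(negPf h0) // => _.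
- by move=> /(_ erefl)[l l0 eh] *; exists l => //; right.
- move=> _; case: (size (wnorm g)) (size_poly_eq0 (wnorm g)) => [|[|[|m]]]; rewrite ?(negPf g0) //.
  by move=> _ /(_ erefl)[l l0 eg] *; exists l => //; left.
by move=> _; case: (size (wnorm g)) (size_poly_eq0 (wnorm g)); rewrite ?(negPf g0) //= => m; rewrite !addSn addnS.
Qed.

End CoordinateRing.

(** * The chord and tangent law on y^2 = x^3 + a x^2 + b x + c *)

Section WeierstrassAddition.
Variables (F : fieldType) (a b c : F).
Hypothesis nz2 : 2 != 0 :> F.

Definition wcubic (x : F) : F := x ^+ 3 + a * x ^+ 2 + b * x + c.
Definition wderiv (x : F) : F := 3 * x ^+ 2 + 2 * a * x + b.

Definition on_wcurve (P : option (F * F)) : bool :=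
  if P is Some (x, y) then y ^+ 2 == wcubic x else true.

Definition wopp (P : option (F * F)) : option (F * F) :=
  if P is Some (x, y) then Some (x, - y) else None.

Definition wadd (P Q : option (F * F)) : option (F * F) :=
  match P, Q with
  | None, _ => Q
  | _, None => P
  | Some (x1, y1), Some (x2, y2) =>
      if (x1 == x2) && (y1 == - y2) then None else
      let m := if x1 == x2 then wderiv x1 / (2 * y1) else (y2 - y1) / (x2 - x1) in
      let x3 := m ^+ 2 - a - x1 - x2 in
      Some (x3, m * (x1 - x3) - y1)
  end.

(* The line y = m x + k meets the cubic in the points of abscissas x1, x2, x3,
   counted with multiplicities. *)
Definition wline (m k x1 x2 x3 : F) : Prop :=
  [/\ x1 + x2 + x3 = m ^+ 2 - a,
      x1 * x2 + x1 * x3 + x2 * x3 = b - 2 * m * k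
    & x1 * x2 * x3 = k ^+ 2 - c].

Lemma wline_perm m k x1 x2 x3 : wline m k x1 x2 x3 -> wline m k x3 x1 x2.
Proof. by case=> e1 e2 e3; split; [rewrite -e1|rewrite -e2|rewrite -e3]; ring. Qed.

Lemma wline_on m k x1 x2 x3 : wline m k x1 x2 x3 ->
  (m * x1 + k) ^+ 2 = wcubic x1.
Proof.
case=> e1 e2 e3; rewrite /wcubic.
have -> : a = m ^+ 2 - (x1 + x2 + x3) by rewrite e1; ring.
have -> : b = x1 * x2 + x1 * x3 + x2 * x3 + 2 * m * k by rewrite e2; ring.
have -> : c = k ^+ 2 - x1 * x2 * x3 by rewrite e3; ring.
ring.
Qed.

(** Chord and tangent become a single case: later arguments use only the relations [wline], which
    express a, b and c through m, k and the abscissas. *)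
Lemma wadd_line x1 y1 x2 y2 :
  y1 ^+ 2 = wcubic x1 -> y2 ^+ 2 = wcubic x2 -> ~~ ((x1 == x2) && (y1 == - y2)) ->
  exists m k x3, [/\ wadd (Some (x1, y1)) (Some (x2, y2)) = Some (x3, - (m * x3 + k)),
    y1 = m * x1 + k, y2 = m * x2 + k & wline m k x1 x2 x3].
Proof.
rewrite /wadd /wcubic => on1 on2 nv; rewrite (negPf nv).
have ec : c = y1 ^+ 2 - x1 ^+ 3 - a * x1 ^+ 2 - b * x1 by rewrite on1; ring.
set m := if _ then _ else _.
exists m, (y1 - m * x1), (m ^+ 2 - a - x1 - x2).
have [e12|ne12] := eqVneq x1 x2; last first.
  have nz : x2 - x1 != 0 by rewrite subr_eq0 eq_sym.
  have em : m = (y2 - y1) / (x2 - x1) by rewrite /m (negPf ne12).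
  have eb : b = (y2 ^+ 2 - y1 ^+ 2) / (x2 - x1)
      - (x2 ^+ 2 + x1 * x2 + x1 ^+ 2) - a * (x1 + x2).
    apply: (mulIf nz); rewrite on1 on2; field; exact: nz.
  split.
  - by congr (Some (_, _)); ring.
  - by ring.
  - by rewrite em; field.
  - by split; rewrite ?ec ?eb em; field.
move: nv on2; rewrite -e12 eqxx /= => nv on2.
have /eqP : (y1 - y2) * (y1 + y2) = 0 by rewrite -subr_sqr on1 on2 subrr.
rewrite mulf_eq0 subr_eq0 addr_eq0 (negPf nv) orbF => /eqP ey; subst y2.
have y0 : y1 != 0.
  by apply: contraNneq nv => ->; rewrite oppr0.
have em : m = wderiv x1 / (2 * y1) by rewrite /m e12 eqxx.
split.
- by congr (Some (_, _)); ring.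
- by ring.
- by ring.
- by split; rewrite ?ec em /wderiv; field; apply/andP.
Qed.

Lemma wadd_opp_Some x y : wadd (Some (x, y)) (Some (x, - y)) = None.
Proof. by rewrite /wadd opprK !eqxx. Qed.

Lemma on_wopp P : on_wcurve (wopp P) = on_wcurve P.
Proof. by case: P => [[x y]|] //=; rewrite sqrrN. Qed.

Lemma on_wadd P Q : on_wcurve P -> on_wcurve Q -> on_wcurve (wadd P Q).
Proof.
case: P Q => [[x1 y1]|] [[x2 y2]|] // /eqP on1 /eqP on2.
have [v|nv] := boolP ((x1 == x2) && (y1 == - y2)); first by rewrite /wadd v.
have [m [k [x3 [-> _ _ /wline_perm/wline_on]]]] := wadd_line on1 on2 nv.
by rewrite /= sqrrN => ->.
Qed.

Lemma wadd_eq0 P Q : on_wcurve P -> on_wcurve Q -> wadd P (wopp Q) = None -> P = Q.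
Proof.
case: P Q => [[x1 y1]|] [[x2 y2]|] //= on1 on2.
by rewrite opprK; case: ifP => // /andP[/eqP-> /eqP->].
Qed.

(** Only singular points with coordinates in F are excluded, which are the only ones that the law on
    F-points can meet. *)
Definition wnonsing := forall x, wcubic x = 0 -> wderiv x != 0.
Hypothesis ns : wnonsing.

Definition wpol : {poly F} := 'X^3 + a *: 'X^2 + b *: 'X + c%:P.

Lemma size_wpol : size wpol = 4%N.
Proof.
rewrite /wpol -!addrA size_polyDl size_polyXn //.
rewrite (leq_ltn_trans (size_polyD _ _)) // gtn_max.
rewrite (leq_ltn_trans (size_scale_leq _ _)) ?size_polyXn //=.
rewrite (leq_ltn_trans (size_polyD _ _)) // gtn_max.
rewrite (leq_ltn_trans (size_scale_leq _ _)) ?size_polyX //=.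
by rewrite (leq_ltn_trans (size_polyC_leq1 _)).
Qed.

Let R : comNzRingType := wring wpol.
Let X : R := wpoly wpol 'X.
Let Y : R := wY wpol.
Local Notation C := (wconst wpol).

Let Y2 : Y * Y = X ^+ 3 + C a * X ^+ 2 + C b * X + C c.
Proof.
by rewrite /Y wY_sqr /X /wconst -!rmorphXn -!rmorphM -!rmorphD /= /wpol -!mul_polyC.
Qed.

(** Generators of the maximal ideal of an affine point; the origin is not on the affine curve and
    gets the unit ideal. *)
Definition wideal (P : option (F * F)) : R -> Prop :=
  if P is Some (x, y) then fun g => g = X - C x \/ g = Y - C y else single 1.

Let CV k : k != 0 -> C k^-1 * C k = 1.
Proof. by move=> k0; rewrite -rmorphM mulVf // rmorph1. Qed.

Lemma ideal_inv L k : is_ideal L -> k != 0 -> L (C k) -> L (1 : R).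
Proof. by move=> [_ _ LM] k0 Lk; rewrite -(CV k0); apply: (LM). Qed.

(** The product is the ideal of X - x. All products of generators are divisible by X - x, because
    Y^2 - y^2 = D (X - x), and the ideal of the quotients contains 2 y and, when y = 0, also the
    derivative of the cubic at x. One of them is invertible. *)
Lemma wideal_opp x y : y ^+ 2 = wcubic x ->
  idcls (setmul (wideal (Some (x, y))) (wideal (Some (x, - y)))) (single 1).
Proof.
move=> on; have eC : C c = C (y ^+ 2) - C x ^+ 3 - C a * C x ^+ 2 - C b * C x.
  rewrite on /wcubic; ring.
pose D : R := X ^+ 2 + X * C x + C x ^+ 2 + C a * (X + C x) + C b.
have eD : (Y - C y) * (Y - C (- y)) = D * (X - C x).
  rewrite mulrBl mulrBr Y2 eC /D; ring.
apply: (@idcls_single _ _ (X - C x)).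
  by move/(congr1 (fun g : R => g.1)) => /eqP; rewrite /= polyXsubC_eq0.
split=> [_ [g Gg [h Hh ->]]|_ ->].
  have L := idgen_ideal (single (X - C x)).
  have [_ LD LM] := L; have Lx : idgen (single (X - C x)) (X - C x) by apply: mem_idgen.
  case: Gg Hh => -> [] ->; first exact: LM; last by rewrite eD; apply: (LM).
    by rewrite mulrC; apply: (LM).
  exact: LM.
set L := idgen _; have iL : is_ideal L by apply: idgen_ideal.
pose L' t := L (t * (X - C x)); have iL' : is_ideal L' by apply: ideal_colon.
have [_ LD' LM'] := iL'.
suff : L' 1 by rewrite /L' mul1r.
have L1 : L' (X - C x).
  by apply: mem_idgen; exists (X - C x); [left | exists (X - C x) => //; left].
have L2 : L' (Y - C (- y)).
  by apply: mem_idgen; exists (X - C x); [left | exists (Y - C (- y)); [right | rewrite mulrC]].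
have L3 : L' (Y - C y).
  by apply: mem_idgen; exists (Y - C y); [right | exists (X - C x) => //; left].
have L4 : L' D.
  by rewrite /L' -eD; apply: mem_idgen; exists (Y - C y); [right | exists (Y - C (- y)) => //; right].
have [y0|y0] := eqVneq y 0; last first.
  apply: (ideal_inv iL' (mulf_neq0 nz2 y0)).
  have -> : C (2 * y) = (Y - C (- y)) - (Y - C y) by ring.
  exact: (idealB iL' L2 L3).
have /ns dx0 : wcubic x = 0 by rewrite -on y0 expr0n.
apply: (ideal_inv iL' dx0).
have -> : C (wderiv x) = D - (X + 2 * C x + C a) * (X - C x).
  rewrite /wderiv /D; ring.
exact: (idealB iL' L4 (LM' _ _ L1)).
Qed.

Let line (m k : F) : R := Y - C m * X - C k.

(** This gives the ideals of all points of one line the common generator [line m k]. *)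
Let wideal_line m k x : ideq (wideal (Some (x, m * x + k)))
  (fun g => g = X - C x \/ g = line m k).
Proof.
have aux (y' : R) G H : (forall g, G g <-> g = X - C x \/ g = y') ->
    (forall g, H g <-> g = X - C x \/ g = y' - C m * (X - C x)) -> ideq G H.
  move=> eG eH; split.
    move=> _ /eG[->|->]; first by apply: mem_idgen; apply/eH; left.
    have [_ LD LM] := idgen_ideal H.
    have -> : y' = (y' - C m * (X - C x)) + C m * (X - C x) by ring.
    by apply: (LD); [|apply: (LM)]; apply: mem_idgen; apply/eH; [right|left].
  move=> _ /eH[->|->]; first by apply: mem_idgen; apply/eG; left.
  have iG := idgen_ideal G; have [_ GD GM] := iG.
  by apply: (idealB iG); [|apply: (GM)]; apply: mem_idgen; apply/eG; [right|left].
apply: (aux (Y - C (m * x + k))) => g //=.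
suff -> : Y - C (m * x + k) - C m * (X - C x) = line m k by [].
by rewrite /line; ring.
Qed.

(* The conjugate line y + m x + k is in the ideal because its product with the
   line is (x - x1) (x - x2) (x - x3). *)
Let line_unit L (m k x1 x2 x3 : F) : is_ideal L -> wline m k x1 x2 x3 ->
  L ((X - C x1) * (X - C x2)) -> L ((X - C x1) * (X - C x3)) ->
  L ((X - C x2) * (X - C x3)) ->
  L (line m k * (X - C x1)) -> L (line m k * (X - C x2)) -> L (line m k * (X - C x3)) ->
  L (line m k * line m k) -> L (Y + C m * X + C k) -> L 1.
Proof.
move=> iL wl L12 L13 L23 L1 L2 L3 Ll Ll'; have [_ LD LM] := iL.
(* The line is tangent at abscissa [x]. The ordinate there is nonzero, as [x] would otherwise be a
   double root of the cubic; hence X - x lies in the ideal, and then so does 4 (m x + k)^2. *)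
have dbl x z : wline m k x x z -> L ((X - C x) * (X - C x)) ->
    L (line m k * (X - C x)) -> L 1.
  move=> wx Lxx Lx; have y0 : m * x + k != 0.
    apply/eqP => y0; have := wline_on wx; rewrite y0 expr0n => /esym /[dup] fx0 /ns/eqP[].
    case: wx => e1 e2 e3; rewrite /wderiv.
    have -> : a = m ^+ 2 - (x + x + z) by rewrite e1; ring.
    have -> : b = x * x + x * z + x * z + 2 * m * k by rewrite e2; ring.
    have -> : k = - (m * x) by apply/eqP; rewrite -addr_eq0 addrC y0.
    by ring.
  have LX : L (X - C x).
    rewrite -[_ - _]mul1r -(CV (mulf_neq0 nz2 y0)) -mulrA; apply: (LM).
    have -> : C (2 * (m * x + k)) * (X - C x) = (X - C x) * (Y + C m * X + C k)
        - (line m k * (X - C x) + 2 * C m * ((X - C x) * (X - C x))).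
      by rewrite /line; ring.
    by apply: (idealB iL); [apply: (LM) | apply: (LD) => //; apply: (LM)].
  apply: (ideal_inv iL (mulf_neq0 (mulf_neq0 nz2 nz2) (mulf_neq0 y0 y0))).
  have -> : C (2 * 2 * ((m * x + k) * (m * x + k))) = line m k * line m k
     - ((Y + C m * X + C k - 4 * (C m * X + C k)) * (Y + C m * X + C k)
        + (4 * C m * (C m * (X + C x) + 2 * C k)) * (X - C x)).
    by rewrite /line; ring.
  by apply: (idealB iL) => //; apply: (LD); apply: (LM).
have [e12|n12] := eqVneq x1 x2; first by subst x2; apply: (dbl x1 x3).
have [e13|n13] := eqVneq x1 x3.
  by subst x3; apply: (dbl x1 x2) => //; apply: wline_perm.
have [e23|n23] := eqVneq x2 x3.
  by subst x3; apply: (dbl x2 x1) => //; do 2!apply: wline_perm.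
have sub z x y : x != y -> L ((X - C x) * (X - C z)) -> L ((X - C y) * (X - C z)) ->
    L (X - C z).
  rewrite eq_sym -subr_eq0 => nxy Lx Ly; rewrite -[_ - _]mul1r -(CV nxy) -mulrA; apply: (LM).
  have -> : C (y - x) * (X - C z) = (X - C x) * (X - C z) - (X - C y) * (X - C z) by ring.
  exact: (idealB iL).
have LX1 : L (X - C x1) by apply: (sub x1 x2 x3); rewrite // mulrC.
have LX2 : L (X - C x2) by apply: (sub x2 x1 x3); rewrite // mulrC.
move: n12; rewrite eq_sym -subr_eq0 => n12; apply: (ideal_inv iL n12).
have -> : C (x2 - x1) = X - C x1 - (X - C x2) by ring.
exact: (idealB iL).
Qed.

(** The affine zeros of the function [line m k] are these three points, so the product of their
    ideals is generated by it. *)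
Lemma wideal_wline m k x1 x2 x3 : wline m k x1 x2 x3 ->
  idcls (setmul (wideal (Some (x1, m * x1 + k))) (setmul (wideal (Some (x2, m * x2 + k)))
    (wideal (Some (x3, m * x3 + k))))) (single 1).
Proof.
move=> wl; have prodE : (X - C x1) * ((X - C x2) * (X - C x3))
    = (Y + C m * X + C k) * line m k.
  have -> : (Y + C m * X + C k) * line m k = Y * Y - (C m * X + C k) * (C m * X + C k).
    by rewrite /line; ring.
  rewrite Y2; case: wl => e1 e2 e3.
  have -> : a = m ^+ 2 - (x1 + x2 + x3) by rewrite e1; ring.
  have -> : b = x1 * x2 + x1 * x3 + x2 * x3 + 2 * m * k by rewrite e2; ring.
  have -> : c = k ^+ 2 - x1 * x2 * x3 by rewrite e3; ring.
  ring.
pose G x g := g = X - C x \/ g = line m k.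
apply: (@idcls_single _ _ (line m k)).
  move/(congr1 (fun g : R => g.2)) => /= /eqP.
  by rewrite /line /= mulr0 mul0r addr0 !subr0 oner_eq0.
apply: (@ideq_trans _ _ (setmul (G x1) (setmul (G x2) (G x3)))).
  apply: (ideq_trans (ideq_setmul _ (wideal_line _ _ _))).
  apply: ideq_setmulr; apply: (ideq_trans (ideq_setmul _ (wideal_line _ _ _))).
  by apply: ideq_setmulr; apply: wideal_line.
set GG := setmul _ _.
have GGm u v w : G x1 u -> G x2 v -> G x3 w -> GG (u * (v * w)).
  by move=> *; exists u => //; exists (v * w) => //; exists v => //; exists w.
split.
  have [_ _ LM] := idgen_ideal (single (line m k)).
  have Ll : idgen (single (line m k)) (line m k) by apply: mem_idgen.
  have mult t : idgen (single (line m k)) (t * line m k) by apply: (LM).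
  move=> _ [g [->|->] [_ [h [->|->] [i [->|->] ->]] ->]]; first by rewrite prodE.
  - by rewrite mulrA.
  - by rewrite (mulrC (line m k)) mulrA.
  - by rewrite mulrA.
  1-4: by rewrite mulrC.
move=> _ ->; set L := idgen GG; have iL : is_ideal L by apply: idgen_ideal.
have iL' := ideal_colon (line m k) iL.
suff : L (1 * line m k) by rewrite mul1r.
have Gl x : G x (line m k) by right.
have GX x : G x (X - C x) by left.
apply: (line_unit iL' wl) => /=.
- by have := GGm _ _ _ (GX _) (GX _) (Gl _); rewrite mulrA; apply: mem_idgen.
- by have := GGm _ _ _ (GX _) (Gl _) (GX _); rewrite mulrCA mulrC; apply: mem_idgen.
- by have := GGm _ _ _ (Gl _) (GX _) (GX _); rewrite mulrC; apply: mem_idgen.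
- by have := GGm _ _ _ (GX _) (Gl _) (Gl _); rewrite mulrCA mulrA; apply: mem_idgen.
- by have := GGm _ _ _ (Gl _) (GX _) (Gl _); rewrite mulrA; apply: mem_idgen.
- have := GGm _ _ _ (Gl _) (Gl _) (GX _); rewrite mulrA mulrAC; apply: mem_idgen.
- by have := GGm _ _ _ (Gl _) (Gl _) (Gl _); rewrite mulrA; apply: mem_idgen.
by rewrite -prodE; apply: mem_idgen; apply: GGm.
Qed.

Let intR := wring_integral size_wpol.

(** If S' is the third point on the line and S = P + Q its opposite, then both P Q S' and S S' have
    trivial class. *)
Lemma wideal_add P Q : on_wcurve P -> on_wcurve Q ->
  idcls (setmul (wideal P) (wideal Q)) (wideal (wadd P Q)).
Proof.
move=> onP; case: Q => [[x2 y2]|] onQ; last first.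
  by rewrite setmulC setmul1; case: P onP => [[x y]|] onP; apply: idcls_refl.
case: P onP => [[x1 y1]|] onP; last by rewrite setmul1; apply: idcls_refl.
move/eqP: onP => on1; move/eqP: onQ => on2.
have [/andP[/eqP ex /eqP ey]|nv] := boolP ((x1 == x2) && (y1 == - y2)).
  have ey2 : y2 = - y1 by rewrite ey opprK.
  by subst x2 y2; rewrite wadd_opp_Some; apply: wideal_opp.
have [m [k [x3 [-> ey1 ey2 wl]]]] := wadd_line on1 on2 nv.
rewrite {on1 on2 nv}ey1 {y1 ey1}ey2 {y2}.
have clS := wideal_opp (wline_on (wline_perm wl)).
have cl3 := wideal_wline wl; set S := Some (x3, _).
apply: (@idcls_trans _ intR _ (setmul (single 1) (wideal S))); last first.
  by rewrite setmul1; apply: idcls_refl.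
apply: (idcls_trans intR _ (idcls_mul _ cl3)).
rewrite -!setmulA; apply: (idcls_mul2 intR); first exact: idcls_refl.
rewrite -[X in idcls X _]setmul1 (setmulC (single 1)).
by apply: (idcls_mul2 intR); [apply: idcls_refl | apply: idcls_sym].
Qed.

(** A generator g divides X - x, so g or its cofactor is a constant. A constant g does not vanish at
    the point. A constant cofactor makes X - x divide Y - y, which is impossible because the
    coefficient of Y would vanish at x. *)
Lemma wideal_principal P : on_wcurve P -> idcls (wideal P) (single 1) -> P = None.
Proof.
case: P => [[x y]|] // /eqP on /(idcls1_principal intR)[g Gg gen].
have [h eh] : exists r, X - C x = r * g by apply: gen; left.
have [l el] : exists r, Y - C y = r * g by apply: gen; right.
have e : h * g = wpoly wpol ('X - x%:P) by rewrite -eh /X rmorphB.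
have [k k0 [eg|eh']] := wring_div_XsubC size_wpol e.
  pose ev (t : R) := t.1.[x] + t.2.[x] * y.
  have ev0 : ev g = 0.
    apply: (Gg (fun t => ev t = 0)).
      have ec : c = y ^+ 2 - x ^+ 3 - a * x ^+ 2 - b * x by rewrite on /wcubic; ring.
      split; rewrite /ev; first by rewrite /= !horner0 mul0r addr0.
        move=> u v /= eu ew; rewrite !hornerD.
        have -> : u.1.[x] = - (u.2.[x] * y) by apply/eqP; rewrite -addr_eq0 eu.
        have -> : v.1.[x] = - (v.2.[x] * y) by apply/eqP; rewrite -addr_eq0 ew.
        by ring.
      move=> r u eu; rewrite /= !(hornerD, hornerM, hornerZ, hornerX, hornerC) ec.
      have -> : u.1.[x] = - (u.2.[x] * y) by apply/eqP; rewrite -addr_eq0 eu.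
      by ring.
    by move=> _ [->|->]; rewrite /ev /= !hornerE; ring.
  by move: ev0; rewrite eg /ev /= hornerC horner0 mul0r addr0 => /eqP; rewrite (negPf k0).
have e2 : (l * (X - C x)).2 = k%:P.
  have -> : l * (X - C x) = wpoly wpol k%:P * (Y - C y) by rewrite eh el -eh'; ring.
  by rewrite /=; ring.
case/negP: k0; have := hornerC k x; rewrite -e2 => <-.
by rewrite /= !(hornerD, hornerM, hornerN, hornerX, hornerC); apply/eqP; ring.
Qed.

Lemma waddC P Q : on_wcurve P -> on_wcurve Q -> wadd P Q = wadd Q P.
Proof.
case: P Q => [[x1 y1]|] [[x2 y2]|] // /eqP on1 /eqP on2.
rewrite /wadd; have [e12|n12] := eqVneq x1 x2.
  subst x2; rewrite /= (eq_sym y2) eqr_oppLR.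
  have [//|ny] := eqVneq y1 (- y2).
  have /eqP : (y1 - y2) * (y1 + y2) = 0 by rewrite -subr_sqr on1 on2 subrr.
  by rewrite mulf_eq0 subr_eq0 addr_eq0 (negPf ny) orbF => /eqP->.
have n12' : x1 - x2 != 0 by rewrite subr_eq0.
have n21 : x2 - x1 != 0 by rewrite subr_eq0 eq_sym.
by congr (Some (_, _)); field; apply/andP.
Qed.

Lemma waddA P Q S : on_wcurve P -> on_wcurve Q -> on_wcurve S ->
  wadd P (wadd Q S) = wadd (wadd P Q) S.
Proof.
move=> onP onQ onS.
have onPQ := on_wadd onP onQ; have onQS := on_wadd onQ onS.
have on1 := on_wadd onP onQS; have on2 := on_wadd onPQ onS.
apply: wadd_eq0 => //; set U := wadd P _; set V := wadd (wadd P Q) S.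
have onV : on_wcurve (wopp V) by rewrite on_wopp.
apply: wideal_principal; first exact: on_wadd.
have clU : idcls (wideal U) (setmul (wideal P) (setmul (wideal Q) (wideal S))).
  apply: idcls_sym; apply: (idcls_trans intR _ (wideal_add onP onQS)).
  by apply: (idcls_mul2 intR); [apply: idcls_refl | apply: wideal_add].
have clV : idcls (setmul (wideal P) (setmul (wideal Q) (wideal S))) (wideal V).
  rewrite setmulA; apply: (idcls_trans intR _ (wideal_add onPQ onS)).
  by apply: idcls_mul; apply: wideal_add.
apply: (idcls_trans intR (idcls_sym (wideal_add on1 onV))).
apply: (idcls_trans intR (idcls_mul _ (idcls_trans intR clU clV))).
apply: (idcls_trans intR (wideal_add on2 onV)).
have -> : wadd V (wopp V) = None by case: (V) => [[x y]|] //; exact: wadd_opp_Some.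
exact: idcls_refl.
Qed.

End WeierstrassAddition.

Record wcurve (F : fieldType) := WCurve {
  wca : F; wcb : F; wcc : F;
  wc_nz2 : 2 != 0 :> F;
  wc_ns : wnonsing wca wcb wcc }.

Section WeierstrassGroup.
Variables (F : fieldType) (E : wcurve F).

Record wpoint := WPoint {
  wpt :> option (F * F);
  wpt_on : on_wcurve (wca E) (wcb E) (wcc E) wpt }.
HB.instance Definition _ := [isSub for wpt].
HB.instance Definition _ := [Choice of wpoint by <:].

Definition wpoint_zero : wpoint := @WPoint None isT.
Definition wpoint_opp (P : wpoint) : wpoint :=
  @WPoint (wopp P) (etrans (on_wopp _ _ _ P) (wpt_on P)).
Definition wpoint_add (P Q : wpoint) : wpoint :=
  WPoint (on_wadd (wc_nz2 E) (wpt_on P) (wpt_on Q)).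

Fact wpoint_addA : associative wpoint_add.
Proof.
by move=> P Q S; apply: val_inj; apply: waddA (wpt_on P) (wpt_on Q) (wpt_on S);
   [apply: wc_nz2 | apply: wc_ns].
Qed.
Fact wpoint_addC : commutative wpoint_add.
Proof. by move=> P Q; apply: val_inj; apply: waddC (wpt_on P) (wpt_on Q). Qed.
Fact wpoint_add0 : left_id wpoint_zero wpoint_add.
Proof. by move=> P; apply: val_inj. Qed.
Fact wpoint_addN : left_inverse wpoint_zero wpoint_opp wpoint_add.
Proof.
move=> P; apply: val_inj; rewrite /= (waddC (c := wcc E)) ?on_wopp ?wpt_on //.
by case: (wpt P) => [[x y]|] //=; rewrite opprK !eqxx.
Qed.
HB.instance Definition _ := GRing.isZmodule.Build wpoint
  wpoint_addA wpoint_addC wpoint_add0 wpoint_addN.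

Lemma wptD (P Q : wpoint) :
  wpt (P + Q) = wadd (wca E) (wcb E) P Q.
Proof. by []. Qed.

Lemma wptN (P : wpoint) : wpt (- P) = wopp P.
Proof. by []. Qed.

Lemma wpt0 : wpt 0 = None.
Proof. by []. Qed.

End WeierstrassGroup.

(** * The formal group of a Weierstrass curve *)

Section LocalRing.
Implicit Types (l : nat) (x y : algC).

(* The algebraic numbers integral at l, localised so that 1 + l V consists of
   units. *)
Definition locint l : {pred algC} :=
  [pred x | `[< exists2 b, b \in Aint & x * (1 + l%:R * b) \in Aint >]].

Lemma locintP l x :
  reflect (exists2 b, b \in Aint & x * (1 + l%:R * b) \in Aint) (x \in locint l).
Proof. exact: asboolP. Qed.

Lemma Aint_locint l x : x \in Aint -> x \in locint l.
Proof. by move=> Ax; apply/locintP; exists 0; rewrite ?rpred0 // mulr0 addr0 mulr1. Qed.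

Fact locint_subring l : subring_closed (locint l).
Proof.
have Al : l%:R \in Aint by rewrite rpred_nat.
split=> [|x y /locintP[b Ab xb] /locintP[d Ad yd]|x y /locintP[b Ab xb] /locintP[d Ad yd]].
- exact/Aint_locint/rpred1.
- apply/locintP; exists (b + d + l%:R * b * d); first by rewrite !rpredD ?rpredM.
  have -> : (x - y) * (1 + l%:R * (b + d + l%:R * b * d)) =
     x * (1 + l%:R * b) * (1 + l%:R * d) - y * (1 + l%:R * d) * (1 + l%:R * b) by ring.
  by rewrite rpredB // rpredM // rpredD ?rpredM ?rpred1.
apply/locintP; exists (b + d + l%:R * b * d); first by rewrite !rpredD ?rpredM.
have -> : x * y * (1 + l%:R * (b + d + l%:R * b * d)) =
   x * (1 + l%:R * b) * (y * (1 + l%:R * d)) by ring.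
by rewrite rpredM.
Qed.
HB.instance Definition _ l := GRing.isSubringClosed.Build algC (locint l) (locint_subring l).

Lemma Aint_ninv l : (1 < l)%N -> (l%:R : algC)^-1 \notin Aint.
Proof.
move=> l1; apply/negP => /(Cint_rat_Aint _) il.
have /il : (l%:R : algC)^-1 \in Crat by rewrite rpredV rpred_nat.
move=> /intrP[m em]; have lz : (l%:R : algC) != 0 by rewrite pnatr_eq0 -lt0n ltnW.
have : (m * l%:Z)%:~R = 1 :> algC by rewrite intrM -em mulVf.
move/eqP; rewrite -[1]/(1%:~R) eqr_int => /eqP/(congr1 absz); rewrite abszM /= => e.
by have /eqP := e; rewrite muln_eq1 => /andP[_ /eqP el]; rewrite el in l1.
Qed.

Lemma Aint_nunit l b : (1 < l)%N -> b \in Aint -> 1 + l%:R * b != 0.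
Proof.
move=> l1 Ab; apply/eqP => e; case/negP: (Aint_ninv l1).
have lz : (l%:R : algC) != 0 by rewrite pnatr_eq0 -lt0n ltnW.
have -> : (l%:R : algC)^-1 = - b; last by rewrite rpredN.
apply: (mulfI lz); rewrite mulfV //; apply/eqP; rewrite -subr_eq0.
by rewrite -[X in _ == X]e; apply/eqP; ring.
Qed.

Lemma locint_ninv l : (1 < l)%N -> (l%:R : algC)^-1 \notin locint l.
Proof.
move=> l1; apply/locintP => -[b Ab]; rewrite mulrDr mulr1 mulrA mulVf ?mul1r; last first.
  by rewrite pnatr_eq0 -lt0n ltnW.
by rewrite rpredDr // (negPf (Aint_ninv l1)).
Qed.

(** The purpose of the localisation: if v = a / (1 + l b), then (1 + l v) (1 + l b) = 1 + l (b + a)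
    is again an admissible denominator. *)
Lemma locint_inv l v : (1 < l)%N -> v \in locint l ->
  1 + l%:R * v != 0 /\ (1 + l%:R * v)^-1 \in locint l.
Proof.
move=> l1 /locintP[b Ab]; set a := v * _ => Aa.
have e : (1 + l%:R * v) * (1 + l%:R * b) = 1 + l%:R * (b + a) by rewrite /a; ring.
have nz := Aint_nunit l1 (rpredD Ab Aa); have [nv nb] : 1 + l%:R * v != 0 /\ 1 + l%:R * b != 0.
  by apply/andP; rewrite -negb_or -mulf_eq0 e.
split=> //; apply/locintP; exists (b + a); first exact: rpredD.
by rewrite -e mulKf // rpredD ?rpred1 // rpredM // rpred_nat.
Qed.

Lemma Aint_sqr x : x ^+ 2 \in Aint -> x \in Aint.
Proof.
move=> Ax; pose p := minCpoly (x ^+ 2).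
have rt : root (p \Po 'X^2) x by rewrite /root horner_comp hornerXn; apply: root_minCpoly.
apply: (root_monic_Aint rt); last by apply: polyOver_comp => //; rewrite rpredX ?polyOverX.
rewrite monicE lead_coef_comp ?size_polyXn // lead_coefXn expr1n mulr1.
exact: minCpoly_monic.
Qed.

Lemma locint_sqr l x : x ^+ 2 \in locint l -> x \in locint l.
Proof.
move=> /locintP[b Ab xb]; apply/locintP; exists b => //; apply: Aint_sqr.
by rewrite exprMn expr2 (expr2 (1 + _)) -expr2 mulrA rpredM // rpredD ?rpred1 ?rpredM ?rpred_nat.
Qed.

Lemma locint_intV l (n : int) : prime l -> ~~ (l%:Z %| n)%Z -> (n%:~R)^-1 \in locint l.
Proof.
move=> pl ndv; have [[u v] /= e] : {uv | uv.1 * n + uv.2 * l%:Z = 1}.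
  have /eqP g1 : coprimez n l%:Z.
    by rewrite coprimez_sym coprimezE prime_coprime // -[l]/(absz l) -dvdzE.
  by have [u [v e]] := Bezoutz n l%:Z; exists (u, v); rewrite /= e g1.
have nz : (n%:~R : algC) != 0.
  by rewrite intr_eq0; apply: contraNneq ndv => ->; rewrite dvdz0.
apply/locintP; exists (- v%:~R); first by rewrite rpredN rpred_int.
have -> : 1 + l%:R * - v%:~R = u%:~R * n%:~R :> algC.
  apply: (addIr (v%:~R * (l%:Z)%:~R)); have := congr1 (fun z : int => z%:~R : algC) e.
  by rewrite rmorphD !rmorphM /= => ->; rewrite -pmulrn; ring.
by rewrite mulrCA mulVf // mulr1 rpred_int.
Qed.

(** Several places may lie above l, so [locint l] is not a valuation ring; its trace on the rational
    numbers is one. *)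
Lemma locint_rat l (r : rat) : prime l ->
  ratr r \in locint l \/
  r != 0 /\ exists2 t : rat, ratr t \in locint l & r^-1 = l%:R * t.
Proof.
move=> pl; have l1 := prime_gt1 pl; have rE := divq_num_den r.
have [dv|ndv] := boolP (l%:Z %| denq r)%Z; last first.
  left; rewrite -rE rmorphM fmorphV /= !ratr_int rpredM ?rpred_int //.
  exact: locint_intV.
right; have ndv : ~~ (l%:Z %| numq r)%Z.
  apply/negP => dv'; have := coprime_num_den r; rewrite /coprime => /eqP g1.
  have : (l %| gcdn `|numq r| `|denq r|)%N.
    by rewrite dvdn_gcd -[l]/(absz l) -!dvdzE dv' dv.
  by rewrite g1 dvdn1 => /eqP el; rewrite el in l1.
have r0 : r != 0 by rewrite -numq_eq0; apply: contraNneq ndv => ->; rewrite dvdz0.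
split=> //; have /dvdzP[d ed] := dv; exists (d%:~R / (numq r)%:~R).
  by rewrite rmorphM fmorphV /= !ratr_int rpredM ?rpred_int ?locint_intV.
by rewrite -[in LHS]rE invf_div ed rmorphM /=; ring.
Qed.

Lemma locint_denq l (r : rat) : prime l -> ratr r \in locint l -> ~~ (l%:Z %| denq r)%Z.
Proof.
move=> pl Vr; have l1 := prime_gt1 pl; apply/negP => dv.
have lz : (l%:R : algC) != 0 by rewrite pnatr_eq0 -lt0n ltnW.
have ndv : ~~ (l%:Z %| numq r)%Z.
  apply/negP => dv'; have := coprime_num_den r; rewrite /coprime => /eqP g1.
  have : (l %| gcdn `|numq r| `|denq r|)%N.
    by rewrite dvdn_gcd -[l]/(absz l) -!dvdzE dv' dv.
  by rewrite g1 dvdn1 => /eqP el; rewrite el in l1.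
have n0 : numq r != 0 by apply: contraNneq ndv => ->; rewrite dvdz0.
have /dvdzP[d ed] := dv; have d0 : denq r != 0 := denq_neq0 r.
have dz : d != 0 by apply: contraNneq d0 => dz; rewrite ed dz mul0r.
case/negP: (locint_ninv l1).
have -> : (l%:R : algC)^-1 = d%:~R * ((numq r)%:~R^-1 * ratr r).
  rewrite -[r in ratr r]divq_num_den rmorphM fmorphV /= !ratr_int.
  rewrite mulKf ?intr_eq0 // ed rmorphM /= -pmulrn; field.
  by rewrite lz intr_eq0.
by rewrite rpredM ?rpred_int // rpredM // locint_intV.
Qed.

Lemma locint_residue l (r : rat) : prime l -> ratr r \in locint l ->
  exists i : 'I_l, exists2 t : rat, ratr t \in locint l & r = (i : nat)%:R + l%:R * t.
Proof.
move=> pl Vr; have ndv := locint_denq pl Vr; have l1 := prime_gt1 pl.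
have lz : l%:Z != 0 by rewrite -lt0n ltnW.
have /eqP g1 : coprimez (denq r) l%:Z.
  by rewrite coprimez_sym coprimezE prime_coprime // -[l]/(absz l) -dvdzE.
have [u [v e]] := Bezoutz (denq r) l%:Z; rewrite g1 in e.
pose n := u * numq r; have lti : (`|(n %% l%:Z)%Z| < l)%N.
  by rewrite -ltz_nat gez0_abs ?modz_ge0 // ltz_pmod // ltz_nat ltnW.
exists (Ordinal lti), ((n %/ l%:Z)%Z%:~R + v%:~R * r).
  rewrite rmorphD rmorphM /= !ratr_int; apply: rpredD; first exact: rpred_int.
  by apply: rpredM => //; apply: rpred_int.
have -> : (Ordinal lti : nat)%:R = (n %% l%:Z)%Z%:~R :> rat.
  by rewrite /= pmulrn gez0_abs ?modz_ge0.
have {1}-> : r = (u * denq r + v * l%:Z)%:~R * r by rewrite e mul1r.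
have rE : (denq r)%:~R * r = (numq r)%:~R by rewrite -[r in _ * r]divq_num_den mulrCA divff ?mulr1 // intr_eq0 denq_neq0.
rewrite rmorphD !rmorphM /= mulrDl -mulrA rE -rmorphM /= -/n {1}(divz_eq n l%:Z).
by rewrite rmorphD rmorphM /= -!pmulrn; ring.
Qed.

Definition locunit l : {pred algC} :=
  [pred x | [&& x != 0, x \in locint l & x^-1 \in locint l]].

Lemma locunitP l x :
  reflect [/\ x != 0, x \in locint l & x^-1 \in locint l] (x \in locunit l).
Proof. exact: and3P. Qed.

Lemma locunit1D l v : (1 < l)%N -> v \in locint l -> 1 + l%:R * v \in locunit l.
Proof.
move=> l1 Vv; have [nz Vi] := locint_inv l1 Vv; apply/locunitP; split=> //.
by rewrite rpredD ?rpred1 ?rpredM ?rpred_nat.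
Qed.

Lemma locunitV l x : x \in locunit l -> x^-1 \in locunit l.
Proof. by case/locunitP=> x0 Vx Vx'; apply/locunitP; rewrite invr_eq0 invrK. Qed.

Lemma locunitM l x y : x \in locunit l -> y \in locunit l -> x * y \in locunit l.
Proof.
case/locunitP=> x0 Vx Vx' /locunitP[y0 Vy Vy']; apply/locunitP.
by rewrite mulf_neq0 // invfM !rpredM.
Qed.

Lemma locunit_int l (n : int) : prime l -> ~~ (l%:Z %| n)%Z -> n%:~R \in locunit l.
Proof.
move=> pl ndv; apply/locunitP; split; [|exact: rpred_int|exact: locint_intV].
by rewrite intr_eq0; apply: contraNneq ndv => ->; rewrite dvdz0.
Qed.

Lemma locunit_ndiv l x : (1 < l)%N -> x \in locunit l -> x / l%:R \notin locint l.
Proof.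
move=> l1 /locunitP[x0 Vx Vx']; apply/negP => Vxl; case/negP: (locint_ninv l1).
by rewrite -[_^-1](mulKf x0) rpredM.
Qed.

(** Rationality is essential, as the square root of l shows: a rational number has an integral
    valuation, so that its square cannot have valuation 1. *)
Lemma locint_rat_sqr l (r : rat) : prime l ->
  (exists2 v, v \in locint l & ratr r ^+ 2 = l%:R * v) ->
  exists2 w, w \in locint l & ratr r = l%:R * w.
Proof.
move=> pl [v Vv er]; have l1 := prime_gt1 pl.
have lz : (l%:R : algC) != 0 by rewrite pnatr_eq0 -lt0n ltnW.
have lz' : (l%:R : rat) != 0 by rewrite pnatr_eq0 -lt0n ltnW.
have [Vr|[r0 [t Vt et]]] := locint_rat (r / l%:R) pl.
  exists (ratr (r / l%:R)) => //.
  by rewrite rmorphM fmorphV /= rmorph_nat mulrCA divff // mulr1.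
have rz : r != 0 by apply: contraNneq r0 => ->; rewrite mul0r.
have tr : t = r^-1 by apply: (mulfI lz'); rewrite -et invf_div.
case/negP: (locint_ninv l1).
suff -> : (l%:R : algC)^-1 = v * ratr t ^+ 2 by rewrite rpredM ?rpredX.
apply: (mulfI lz); rewrite divff // mulrA -er -exprMn -rmorphM tr divff //.
by rewrite rmorph1 expr1n.
Qed.

Lemma rat_val l (r : rat) : prime l -> r != 0 -> ratr r \in locint l ->
  exists k (e : rat), r = l%:R ^+ k * e /\ ratr e \in locunit l.
Proof.
move=> pl r0 Vr; have ndv := locint_denq pl Vr.
have n0 : (0 < `|numq r|)%N by rewrite absz_gt0 numq_eq0.
have [m cm em] := pfactor_coprime pl n0; exists (logn l `|numq r|).
set k := logn l _ in em *.
have en : numq r = sgz (numq r) * m%:Z * l%:Z ^+ k.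
  by rewrite {1}[numq r]intEsg em -!natz natrM natrX mulrA.
exists ((sgz (numq r) * m%:Z)%:~R / (denq r)%:~R); split.
  by rewrite -[LHS]divq_num_den {1}en rmorphM rmorphXn /= -pmulrn; ring.
rewrite rmorphM fmorphV /= !ratr_int; apply: locunitM; last exact/locunitV/locunit_int.
apply: locunit_int => //; rewrite dvdzE abszM -sgrz absz_sg numq_eq0 r0 mul1n /=.
by rewrite -prime_coprime.
Qed.

(** Some nonzero integer multiple a x is an algebraic integer, and a is a unit at every prime l
    greater than its absolute value. *)
Lemma locint_large x : exists N : nat, forall l, prime l -> (N < l)%N -> x \in locint l.
Proof.
have [p [px pm _]] := minCpolyP x; have [q [a a0 ep]] := rat_poly_scale p.
exists `|a|%N => l pl al.
have ndv : ~~ (l%:Z %| a)%Z.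
  apply/negP; rewrite dvdzE /= => /dvdn_leq; rewrite absz_gt0 => /(_ a0).
  by rewrite leqNgt al.
suff Aax : a%:~R * x \in Aint.
  have -> : x = (a%:~R)^-1 * (a%:~R * x) by rewrite mulKf // intr_eq0.
  by rewrite rpredM ?locint_intV // Aint_locint.
pose d := (size p).-1; have szp : (0 < size p)%N by rewrite lt0n size_poly_eq0 monic_neq0.
(* The monic polynomial of a x, with coefficients p_i a^(d - i). They are integers because a p_i is
   one and i < d leaves a factor a. *)
pose s := \poly_(i < size p) (if i == d then 1 else (q`_i * a ^+ (d - i).-1)%:~R : algC).
have sE i : (i <= d)%N -> s`_i = (minCpoly x)`_i * a%:~R ^+ (d - i).
  move=> id; have ip : (i < size p)%N by rewrite -(prednK szp) ltnS.
  rewrite coef_poly ip px coef_map /=.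
  case: eqP => [->|/eqP ne]; first by rewrite [p`_d](monicP pm) rmorph1 subnn mul1r.
  rewrite ep coefZ coef_map /= [ratr _]rmorphM fmorphV /= !ratr_int [in LHS]rmorphM /=.
  have -> : (d - i)%N = (d - i).-1.+1 by rewrite prednK // subn_gt0 ltn_neqAle ne.
  by rewrite rmorphXn exprS /=; field; rewrite intr_eq0.
have szs : size s = size p.
  by rewrite size_poly_eq // eqxx oner_eq0.
apply: (@root_monic_Aint s); last 1 first.
- apply/polyOverP => i; rewrite coef_poly; case: ifP => _; last exact: rpred0.
  by case: ifP => _; [apply: rpred1 | apply: rpred_int].
- have := root_minCpoly x; rewrite /root !horner_coef szs.
  have -> : size (minCpoly x) = size p by rewrite px size_map_poly.
  move=> /eqP r0; suff -> : \sum_(i < size p) s`_i * (a%:~R * x) ^+ i =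
      a%:~R ^+ d * \sum_(i < size p) (minCpoly x)`_i * x ^+ i by rewrite r0 mulr0.
  rewrite mulr_sumr; apply: eq_bigr => i _; have id : (i <= d)%N by rewrite -ltnS (prednK szp).
  by rewrite sE // exprMn -[in RHS](subnK id) exprD; ring.
by rewrite monicE /lead_coef szs coef_poly prednK // leqnn eqxx.
Qed.

Lemma locint_large_seq (s : seq algC) :
  exists N : nat, forall l, prime l -> (N < l)%N -> {subset s <= locint l}.
Proof.
elim: s => [|x s [N hN]]; first by exists 0%N.
have [M hM] := locint_large x; exists (maxn M N) => l pl; rewrite gtn_max => /andP[lM lN] y.
by rewrite inE => /predU1P[->|/hN->//]; apply: hM.
Qed.

End LocalRing.

Ltac locint := repeat first
  [ assumption | exact: rpred0 | exact: rpred1 | exact: rpred_nat | exact: rpred_int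
  | apply: rpredD | apply: rpredB | rewrite rpredN | apply: rpredM | apply: rpredX ].

(** * Addition near the origin in the coordinates z = x / y and w = 1 / y *)

Section FormalGroup.
Variables (l : nat) (a b c : algC).
Hypothesis l1 : (1 < l)%N.
Hypotheses (Va : a \in locint l) (Vb : b \in locint l) (Vc : c \in locint l).
Local Notation V := (locint l).
Let nz2 : 2 != 0 :> algC. Proof. by rewrite pnatr_eq0. Qed.

Definition wz (P : option (algC * algC)) := if P is Some (x, y) then x / y else 0.
Definition ww (P : option (algC * algC)) := if P is Some (x, y) then y^-1 else 0.

(* The points of the formal group with parameter z = x / y in pi V; the
   condition on w = 1 / y excludes the finite points with small z. *)
Definition near_oo (pi : algC) (P : option (algC * algC)) : Prop :=
  [/\ on_wcurve a b c P, if P is Some (_, y) then y != 0 : Prop else True,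
      exists2 v, v \in V & wz P = pi * v & exists2 t, t \in V & ww P = pi ^+ 3 * t].

(** The curve is w = z^3 + a z^2 w + b z w^2 + c w^3 and the line y = m x + k is w = mu z + nu with
    mu = - m / k and nu = 1 / k. The sum of the roots of the resulting cubic in z gives the
    parameter of P + Q; all denominators are 1 modulo pi^2, hence units. *)
Lemma near_oo_add pi s P Q : pi \in V -> s \in V -> pi ^+ 2 = l%:R * s ->
  near_oo pi P -> near_oo pi Q ->
  near_oo pi (wadd a b P Q) /\
  exists2 e, e \in V & wz (wadd a b P Q) = wz P + wz Q + pi ^+ 3 * e.
Proof.
move=> Vpi Vs es nP nQ; have nO : near_oo pi None.
  by split=> //; exists 0; rewrite ?rpred0 ?mulr0.
case: P nP => [[x1 y1]|] nP; last first.
  by split=> //; exists 0; rewrite ?rpred0 // mulr0 addr0 add0r.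
case: Q nQ => [[x2 y2]|] nQ; last first.
  by split=> //; exists 0; rewrite ?rpred0 // mulr0 !addr0.
have [/eqP on1 y10 [v1 Vv1 z1] [t1 Vt1 w1]] := nP.
have [/eqP on2 y20 [v2 Vv2 z2] [t2 Vt2 w2]] := nQ.
have [/andP[/eqP ex /eqP ey]|nv] := boolP ((x1 == x2) && (y1 == - y2)).
  have -> : wadd a b (Some (x1, y1)) (Some (x2, y2)) = None by rewrite /wadd ex ey !eqxx.
  split=> //; exists 0; rewrite ?rpred0 // mulr0 addr0 /= ex ey invrN.
  by rewrite mulrN addNr.
have [m [k [x3 [-> ey1 ey2 wl]]]] := wadd_line nz2 on1 on2 nv.
rewrite /wz in z1 z2; rewrite /ww in w1 w2.
(* Subtracting the equations of the two points gives (w1 - w2) U = (z1 - z2) T with U = 1 - pi^2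
   [U'] and T = pi^2 [T']. The form mu = T / U of the slope also holds for tangents. *)
pose U' := a * v2 ^+ 2 + b * pi ^+ 2 * v2 * (t1 + t2)
   + c * pi ^+ 4 * (t1 ^+ 2 + t1 * t2 + t2 ^+ 2).
pose T' := v1 ^+ 2 + v1 * v2 + v2 ^+ 2 + a * pi ^+ 2 * t1 * (v1 + v2) + b * pi ^+ 4 * t1 ^+ 2.
have VU' : U' \in V by rewrite /U'; locint.
have VT' : T' \in V by rewrite /T'; locint.
have [U0 VU] : 1 + l%:R * (- (s * U')) != 0 /\ (1 + l%:R * (- (s * U')))^-1 \in V.
  by apply: locint_inv => //; locint.
pose U := 1 + l%:R * (- (s * U')).
have UE : U = 1 - a * (x2 / y2) ^+ 2 - b * (x2 / y2) * (y1^-1 + y2^-1)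
   - c * (y1^-1 ^+ 2 + y1^-1 * y2^-1 + y2^-1 ^+ 2).
  have -> : U = 1 - pi ^+ 2 * U' by rewrite es /U; ring.
  by rewrite z2 w1 w2 /U'; ring.
have TE : pi ^+ 2 * T' = (x1 / y1) ^+ 2 + (x1 / y1) * (x2 / y2) + (x2 / y2) ^+ 2
   + a * y1^-1 * (x1 / y1 + x2 / y2) + b * y1^-1 ^+ 2.
  by rewrite z1 z2 w1 /T'; ring.
have mUkT : m * U + k * (pi ^+ 2 * T') = 0.
  rewrite UE TE; case: wl => e1 e2 e3.
  have -> : a = m ^+ 2 - (x1 + x2 + x3) by rewrite e1; ring.
  have -> : b = x1 * x2 + x1 * x3 + x2 * x3 + 2 * m * k by rewrite e2; ring.
  have -> : c = k ^+ 2 - x1 * x2 * x3 by rewrite e3; ring.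
  by rewrite ey1 ey2 in y10 y20 *; field; apply/andP.
pose mu := pi ^+ 2 * (T' / U); have Vmu' : T' / U \in V by locint.
have em : m = - (k * mu).
  apply: (mulIf U0); rewrite -/U; apply/eqP; rewrite -subr_eq0; apply/eqP.
  by rewrite -[RHS]mUkT /mu; field.
have k0 : k != 0 by apply: contraNneq y10 => k0; rewrite ey1 em k0; apply/eqP; ring.
pose nu' := t1 - T' / U * v1; have Vnu' : nu' \in V by rewrite /nu'; locint.
have enu : k^-1 = pi ^+ 3 * nu'.
  have -> : pi ^+ 3 * nu' = y1^-1 - mu * (x1 / y1) by rewrite z1 w1 /nu' /mu; ring.
  have -> : mu = - m / k by rewrite em; field.
  by rewrite ey1 in y10 *; field; apply/andP.
(* D is the coefficient of z^3 after substituting w = mu z + nu in the curve; the coefficient of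
   z^2, divided by D, gives the error term. *)
pose D := 1 + l%:R * (s * (T' / U * (a + b * mu + c * mu ^+ 2))).
have Vmu : mu \in V by rewrite /mu; locint.
have [D0 VD] : D != 0 /\ D^-1 \in V by apply: locint_inv => //; locint.
have DE : D = 1 + a * mu + b * mu ^+ 2 + c * mu ^+ 3.
  have -> : D = 1 + pi ^+ 2 * (T' / U * (a + b * mu + c * mu ^+ 2)) by rewrite es /D; ring.
  by rewrite /mu; ring.
(* The product of the three ordinates on the line; it is nonzero, which keeps the sum away from the
   points with y = 0. *)
have eprod : (m * x1 + k) * (m * x2 + k) * (m * x3 + k) = k ^+ 3 * D.
  have -> : k ^+ 3 * D = k ^+ 3 - a * m * k ^+ 2 + b * m ^+ 2 * k - c * m ^+ 3.
    by rewrite DE em; ring.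
  case: wl => e1 e2 e3.
  have -> : a = m ^+ 2 - (x1 + x2 + x3) by rewrite e1; ring.
  have -> : b = x1 * x2 + x1 * x3 + x2 * x3 + 2 * m * k by rewrite e2; ring.
  have -> : c = k ^+ 2 - x1 * x2 * x3 by rewrite e3; ring.
  ring.
have y30 : m * x3 + k != 0.
  have : k ^+ 3 * D != 0 by rewrite mulf_neq0 ?expf_neq0.
  by rewrite -eprod mulf_eq0 => /norP[].
pose e' := nu' * (a + 2 * b * mu + 3 * c * mu ^+ 2) / D.
have Ve' : e' \in V by rewrite /e'; locint.
have ez : x3 / - (m * x3 + k) = x1 / y1 + x2 / y2 + pi ^+ 3 * e'.
  have -> : pi ^+ 3 * e' = k^-1 * (a + 2 * b * mu + 3 * c * mu ^+ 2) / D.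
    by rewrite enu /e'; field.
  have -> : D = (m * x1 + k) * (m * x2 + k) * (m * x3 + k) / k ^+ 3.
    by rewrite eprod; field.
  have -> : mu = - m / k by rewrite em; field.
  case: wl => e1 e2 e3.
  have -> : a = m ^+ 2 - (x1 + x2 + x3) by rewrite e1; ring.
  have -> : b = x1 * x2 + x1 * x3 + x2 * x3 + 2 * m * k by rewrite e2; ring.
  have -> : c = k ^+ 2 - x1 * x2 * x3 by rewrite e3; ring.
  by rewrite ey1 ey2 in y10 y20 *; field; rewrite k0 y30 y10 y20.
have ezv : x3 / - (m * x3 + k) = pi * (v1 + v2 + pi ^+ 2 * e') by rewrite ez z1 z2; ring.
split; last by exists e'.
split=> /=; rewrite ?oppr_eq0 //.
- by rewrite sqrrN (wline_on (wline_perm wl)).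
- by exists (v1 + v2 + pi ^+ 2 * e') => //; locint.
exists (T' / U * (v1 + v2 + pi ^+ 2 * e') - nu'); first by locint.
have -> : pi ^+ 3 * (T' / U * (v1 + v2 + pi ^+ 2 * e') - nu')
   = mu * (x3 / - (m * x3 + k)) - k^-1 by rewrite ezv enu /mu; ring.
have -> : mu = - m / k by rewrite em; field.
by field; rewrite k0 y30.
Qed.

(** The equation reads w (1 - a z^2 - b z w - c w^2) = z^3 with a unit in the parentheses, so z
    itself can serve as pi. *)
Lemma near_oo_wz pi s P : pi \in V -> s \in V -> pi ^+ 2 = l%:R * s ->
  near_oo pi P -> wz P \in V /\ near_oo (wz P) P.
Proof.
move=> Vpi Vs es nP; have [on y0 [v Vv ez] [t Vt ew]] := nP.
split; first by rewrite ez rpredM.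
split=> //; first by exists 1; rewrite ?rpred1 ?mulr1.
case: P nP on y0 ez ew => [[x y]|] nP; last by exists 0; rewrite ?rpred0 ?mulr0.
move=> /eqP on y0; rewrite /wz /ww => ez ew.
pose h := a * v ^+ 2 + b * pi ^+ 2 * v * t + c * pi ^+ 4 * t ^+ 2; pose g := s * h.
have [D0 VD] : 1 + l%:R * - g != 0 /\ (1 + l%:R * - g)^-1 \in V.
  by apply: locint_inv => //; rewrite /g /h; locint.
exists (1 + l%:R * - g)^-1 => //; apply: (mulIf D0); rewrite mulfVK //.
have -> : 1 + l%:R * - g = 1 - a * (x / y) ^+ 2 - b * (x / y) * y^-1 - c * y^-1 ^+ 2.
  have -> : 1 + l%:R * - g = 1 - pi ^+ 2 * h by rewrite es /g; ring.
  by rewrite ez ew /h; ring.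
have ec : c = y ^+ 2 - x ^+ 3 - a * x ^+ 2 - b * x by rewrite on /wcubic; ring.
by rewrite ec; field.
Qed.

Lemma near_oo_iter pi s P n : pi \in V -> s \in V -> pi ^+ 2 = l%:R * s ->
  near_oo pi P -> let Q := iter n (wadd a b P) None in
  near_oo pi Q /\ exists2 e, e \in V & wz Q = n%:R * wz P + pi ^+ 3 * e.
Proof.
move=> Vpi Vs es nP /=; elim: n => [|n [nQ [e Ve eQ]]].
  by split; [split=> //|]; exists 0; rewrite ?rpred0 // mulr0 ?mul0r ?addr0.
have [nS [f Vf ef]] := near_oo_add Vpi Vs es nP nQ.
split=> //; exists (e + f); first exact: rpredD.
by rewrite /= ef eQ -[n.+1%:R]natr1; ring.
Qed.

(** The error z^3 e is z l^2 s e, that is l z times a multiple of l. With z^2 divisible by l only,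
    the last factor need not be a unit. *)
Lemma near_oo_iter_l s P : s \in V -> wz P ^+ 2 = l%:R ^+ 2 * s -> wz P \in V ->
  near_oo (wz P) P -> let Q := iter l (wadd a b P) None in
  near_oo (wz Q) Q /\ exists2 e, e \in V & wz Q = l%:R * wz P * (1 + l%:R * e).
Proof.
move=> Vs es Vz nP Q; have Vls : l%:R * s \in V by locint.
have es' : wz P ^+ 2 = l%:R * (l%:R * s) by rewrite es; ring.
have [nQ [e Ve eQ]] := near_oo_iter l Vz Vls es' nP.
split; first by have [] := near_oo_wz Vz Vls es' nQ.
exists (s * e); first exact: rpredM.
rewrite eQ exprS es; ring.
Qed.

End FormalGroup.

Section FormalTorsion.
Variables (l : nat) (E : wcurve algC).
Hypothesis pl : prime l.
Hypotheses (Va : wca E \in locint l) (Vb : wcb E \in locint l) (Vc : wcc E \in locint l).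

Lemma wpt_mulrn (R : wpoint E) n :
  wpt (R *+ n) = iter n (wadd (wca E) (wcb E) R) None.
Proof. by elim: n => [|n IH] //; rewrite mulrS wptD IH. Qed.

(** Factors l of n are absorbed by replacing R with l R, which preserves the hypotheses. For n prime
    to l, the parameter of n R is z (n + l v) with v integral, and n is a unit. *)
Lemma near_oo_nontorsion s (R : wpoint E) n :
  wz R != 0 -> wz R \in locint l -> s \in locint l -> wz R ^+ 2 = l%:R ^+ 2 * s ->
  near_oo l (wca E) (wcb E) (wcc E) (wz R) R -> (0 < n)%N -> R *+ n != 0.
Proof.
have l1 := prime_gt1 pl; have lz : l%:R != 0 :> algC by rewrite pnatr_eq0 -lt0n ltnW.
elim/ltn_ind: n R s => n IH R s z0 Vz Vs es nR n0.
have Vls : l%:R * s \in locint l by locint.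
have es' : wz R ^+ 2 = l%:R * (l%:R * s) by rewrite es; ring.
have [/dvdnP[m em]|ndv] := boolP (l %| n)%N.
  have [nQ [e Ve eQ]] := near_oo_iter_l l1 Va Vb Vc Vs es Vz nR.
  rewrite -wpt_mulrn in nQ eQ; have [u0 _] := locint_inv l1 Ve.
  rewrite em mulnC mulrnA; apply: (IH m _ _ (wz R ^+ 2 * (1 + l%:R * e) ^+ 2)).
  - by rewrite em ltn_Pmulr //; case: (m) em n0 => //; rewrite mul0n => ->.
  - by rewrite eQ !mulf_neq0.
  - by rewrite eQ; locint.
  - by locint.
  - by rewrite eQ; ring.
  - by [].
  by case: (m) em n0 => //; rewrite mul0n => ->.
have [_ [e Ve]] := near_oo_iter l1 Va Vb Vc n Vz Vls es' nR.
rewrite -wpt_mulrn => eQ; apply/eqP => Rn0; move: eQ; rewrite Rn0 wpt0 /wz.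
rewrite -/(wz R) => eQ; have : n%:R + l%:R * (l%:R * s * e) = 0 :> algC.
  apply: (mulfI z0); rewrite mulr0 [RHS]eQ exprS es; ring.
move/eqP; rewrite addr_eq0 => /eqP en.
have : (n%:Z)%:~R \in locunit l by apply: locunit_int.
move/(locunit_ndiv l1)/negP; case; rewrite -pmulrn en -mulrN mulrAC divff // mul1r.
by locint.
Qed.

End FormalTorsion.

Lemma wadd_chord (F : fieldType) (a b x1 y1 x2 y2 : F) : x1 != x2 ->
  let m := (y2 - y1) / (x2 - x1) in let x3 := m ^+ 2 - a - x1 - x2 in
  wadd a b (Some (x1, y1)) (Some (x2, y2)) = Some (x3, m * (x1 - x3) - y1).
Proof. by move=> /negPf ne; rewrite /wadd ne. Qed.

Lemma wadd_tangent (F : fieldType) (a b x y : F) : 2 != 0 :> F -> y != 0 ->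
  let m := wderiv a b x / (2 * y) in let x3 := m ^+ 2 - a - x - x in
  wadd a b (Some (x, y)) (Some (x, y)) = Some (x3, m * (x - x3) - y).
Proof.
move=> nz2 y0; rewrite /wadd eqxx; suff -> : (y == - y) = false by [].
by apply/negbTE; rewrite -addr_eq0 -mulr2n -mulr_natl mulf_neq0.
Qed.

(** * The quartic as a Weierstrass curve *)

Section QuarticJacobian.
Variables (F : fieldType) (p q r s : F).
Hypothesis nz2 : 2 != 0 :> F.

Definition qpol (u : F) : F := u ^+ 4 + p * u ^+ 3 + q * u ^+ 2 + r * u + s.

(* Completing the square, P(u) = (u^2 + p u / 2 + qg)^2 + qh u + qk. *)
Definition qg : F := (q - p ^+ 2 / 4) / 2.
Definition qh : F := r - p * qg.
Definition qk : F := s - qg ^+ 2.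
Definition qM (u : F) : F := u ^+ 2 + p * u / 2 + qg.

Definition ja : F := p ^+ 2 / 4 - 4 * qg.
Definition jb : F := p * qh - 4 * qk.
Definition jc : F := qh ^+ 2.

(** With x = 2 (v + M), the equation (v - M) (v + M) = h u + k becomes x^2 / 4 - x M = h u + k. It
    is quadratic in u; multiplying by 4 x and completing the square gives the cubic model with y = 2
    x u + p x / 2 + h. At oo- the function x vanishes and x u tends to - h, whence (0, - h). *)
Definition qphi (A : bool + F * F) : option (F * F) :=
  match A with
  | inl true => None
  | inl false => Some (0, - qh)
  | inr (u, v) => let x := 2 * v + 2 * qM u in Some (x, x * (2 * u + p / 2) + qh)
  end.

Let nz4 : 4 != 0 :> F.
Proof. have -> : 4 = 2 * 2 :> F by ring. by rewrite mulf_neq0. Qed.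

Lemma qpolE u : qpol u = qM u ^+ 2 + qh * u + qk.
Proof. by rewrite /qM /qpol /qk /qh /qg; field; rewrite ?oppr_eq0 ?nz2 ?nz4. Qed.

Lemma qphi_on A : on_quartic p q r s A -> on_wcurve ja jb jc (qphi A).
Proof.
case: A => [[]|[u v]] //=; first by move=> _; rewrite /wcubic /jc sqrrN; apply/eqP; ring.
rewrite -/(qpol u) qpolE => /eqP on.
have ek : qk = v ^+ 2 - qM u ^+ 2 - qh * u by rewrite on; ring.
apply/eqP; rewrite /wcubic /ja /jb /jc ek; move: qh => h.
have -> : qg = qM u - u ^+ 2 - p * u / 2 by rewrite /qM; ring.
by field; rewrite ?oppr_eq0 ?nz2 ?nz4.
Qed.

Hypothesis noroot : forall u, qpol u != 0.
Hypothesis nonsq : qh != 0 \/ qk != 0.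

Lemma qphi_inj A B : on_quartic p q r s A -> on_quartic p q r s B ->
  qphi A = qphi B -> A = B.
Proof.
have x0 u v : v ^+ 2 = qpol u -> 2 * v + 2 * qM u = 0 -> qh * u + qk = 0.
  rewrite qpolE -mulrDr => on /eqP; rewrite mulf_eq0 (negPf nz2) addr_eq0 => /eqP ev.
  by apply: (addrI (qM u ^+ 2)); rewrite addrA -on ev addr0 sqrrN.
have spec u v : v ^+ 2 = qpol u -> 2 * v + 2 * qM u = 0 -> qh = - qh -> False.
  move=> on /x0-/(_ on) e /eqP; rewrite -addr_eq0 -mulr2n -mulr_natl mulf_eq0 (negPf nz2).
  move=> /eqP h0; move: e; rewrite h0 mul0r add0r => k0.
  by case: nonsq; rewrite ?h0 ?k0 eqxx.
case: A B => [[]|[u1 v1]] [[]|[u2 v2]] //=; rewrite -?/(qpol _).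
- move=> _ /eqP on [] ex; rewrite -ex mul0r add0r => eh.
  by case: (spec _ _ on (esym ex)).
- move=> /eqP on _ [] ex; rewrite ex mul0r add0r => eh.
  by case: (spec _ _ on ex).
move=> /eqP on1 /eqP on2 [] ex; rewrite -ex => /addIr ey.
have [x10|x1n0] := eqVneq (2 * v1 + 2 * qM u1) 0; last first.
  have /(mulfI nz2) eu : 2 * u1 = 2 * u2 by apply: (addIr (p / 2)); apply: (mulfI x1n0).
  subst u2; congr (inr (_, _)); apply: (mulfI nz2); exact: addIr ex.
have /(x0 _ _ on1) e1 := x10; have /(x0 _ _ on2) e2 := etrans (esym ex) x10.
have h0 : qh != 0.
  apply/eqP => h0; case: nonsq; first by rewrite h0 eqxx.
  by move: e1; rewrite h0 mul0r add0r => ->; rewrite eqxx.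
have eu : u1 = u2 by apply: (mulfI h0); apply: (addIr qk); rewrite e1 e2.
subst u2; congr (inr (_, _)); apply: (mulfI nz2); exact: addIr ex.
Qed.

Lemma qphi_surj P : on_wcurve ja jb jc P ->
  exists2 A, on_quartic p q r s A & qphi A = P.
Proof.
case: P => [[x y]|] /=; last by exists (inl true).
move=> /eqP; rewrite /wcubic /jc => on.
have [x0|x0] := eqVneq x 0.
  move: on; rewrite x0 => on.
  have /eqP : (y - qh) * (y + qh) = 0 by rewrite -subr_sqr on; ring.
  rewrite mulf_eq0 subr_eq0 addr_eq0 => /orP[]/eqP ey; last by exists (inl false); rewrite ?ey.
  have [h0|h0] := eqVneq qh 0; first by exists (inl false) => //=; rewrite ey h0 oppr0.
  (* The other point above x = 0 comes from v = - M, that is from h u + k = 0. *)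
  exists (inr (- qk / qh, - qM (- qk / qh))) => /=.
    by rewrite -/(qpol _) qpolE sqrrN; apply/eqP; field.
  by rewrite mulrN addNr mul0r add0r ey.
pose u := (y - qh - p * x / 2) / (2 * x); pose v := x / 2 - qM u.
have ey : y = x * (2 * u + p / 2) + qh by rewrite /u; field; rewrite nz2 x0.
have ex : 2 * v + 2 * qM u = x by rewrite /v; field.
exists (inr (u, v)) => /=; last by rewrite ex -ey.
rewrite -/(qpol u) qpolE; apply/eqP.
have -> : v ^+ 2 = qM u ^+ 2 + x * (x / 4 - qM u) by rewrite /v; field; rewrite ?oppr_eq0 ?nz2 ?nz4.
rewrite -addrA; congr (_ + _); apply: (mulfI (mulf_neq0 nz4 x0)).
have eg : qg = qM u - u ^+ 2 - p * u / 2 by rewrite /qM; ring.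
move: on; rewrite ey /ja /jb eg => on.
have -> : 4 * x * (qh * u + qk) = x ^+ 3
   + (p ^+ 2 / 4 - 4 * (qM u - u ^+ 2 - p * u / 2)) * x ^+ 2
   + p * qh * x + 4 * x * (qh * u) + qh ^+ 2 - (x * (2 * u + p / 2) + qh) ^+ 2.
  by rewrite on; ring.
by field; rewrite ?oppr_eq0 ?nz2 ?nz4.
Qed.

(** Both laws are compared explicitly. In each case q, r and s are eliminated in favour of data of
    the points, which leaves an identity of rational functions. *)
Lemma qphi_add A B : on_quartic p q r s A -> on_quartic p q r s B ->
  qphi (quartic_add p q r s A B) = wadd ja jb (qphi A) (qphi B).
Proof.
have eq : q = 2 * qg + p ^+ 2 / 4 by rewrite /qg; field; rewrite ?oppr_eq0 ?nz2 ?nz4.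
have er : r = qh + p * qg by rewrite /qh; ring.
have es : s = qk + qg ^+ 2 by rewrite /qk; ring.
have b0E : - p / 2 = - (p / 2) by rewrite mulNr.
have c0E : ((- p / 2) ^+ 2 - q) / 2 = - qg by rewrite eq; field; rewrite ?oppr_eq0 ?nz2 ?nz4.
have d0E : r - 2 * (- p / 2) * - qg = qh by rewrite er; field.
have aff u v : on_quartic p q r s (inr (u, v)) -> exists x,
    [/\ v = x / 2 - qM u, 2 * v + 2 * qM u = x & qk = x ^+ 2 / 4 - x * qM u - qh * u].
  rewrite /= -/(qpol u) qpolE => /eqP on; exists (2 * v + 2 * qM u); split=> //; first by field.
  have -> : qk = v ^+ 2 - qM u ^+ 2 - qh * u by rewrite on; ring.
  by field; rewrite ?oppr_eq0 ?nz2 ?nz4.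
have half u v : on_quartic p q r s (inr (u, v)) ->
   qphi (quartic_add p q r s (inl false) (inr (u, v)))
   = wadd ja jb (Some (0, - qh)) (qphi (inr (u, v))).
  move=> /aff[x [ev ex ek]]; rewrite [qphi (inr _)]/= ex /quartic_add.
  have cE : v + u ^+ 2 - - p / 2 * u = x / 2 - qg by rewrite ev /qM; field.
  have dE : (- p / 2) ^+ 2 - 2 * (x / 2 - qg) - q = - x.
    by rewrite eq; field; rewrite ?oppr_eq0 ?nz2 ?nz4.
  rewrite cE dE oppr_eq0; have [x0|x0] := eqVneq x 0.
    by rewrite x0 mul0r add0r /wadd opprK !eqxx.
  rewrite wadd_chord ?(eq_sym 0) // er /ja /qphi; congr (Some (_, _)).
    by rewrite /qM; field; rewrite ?oppr_eq0 ?nz2 ?nz4 ?x0.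
  by rewrite /qM; field; rewrite ?oppr_eq0 ?nz2 ?nz4 ?x0.
have onO : on_wcurve ja jb jc (Some (0, - qh)) by apply: (@qphi_on (inl false)).
case: A B => [[]|[u1 v1]] [[]|[u2 v2]] onA onB //.
- rewrite /quartic_add c0E d0E; have [h0|h0] := eqVneq qh 0.
    by rewrite /qphi /wadd h0 !oppr0 !eqxx.
  rewrite [qphi (inl _)]/= wadd_tangent ?oppr_eq0 //; congr (Some (_, _)).
    by rewrite /qM /wderiv /ja /jb es; field; rewrite ?oppr_eq0 ?nz2 ?nz4 ?h0.
  by rewrite /qM /wderiv /ja /jb es; field; rewrite ?oppr_eq0 ?nz2 ?nz4 ?h0.
- exact: half.
- rewrite (waddC (c := jc)) ?qphi_on //; exact: (half _ _ onA).
have [x1 [ev1 ex1 ek1]] := aff _ _ onA; have [x2 [ev2 ex2 ek2]] := aff _ _ onB.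
have v0 u v : on_quartic p q r s (inr (u, v)) -> v != 0.
  by move=> /eqP on; have := noroot u; rewrite /qpol -on expf_eq0.
have v10 := v0 _ _ onA; have v20 := v0 _ _ onB.
case: (eqVneq u1 u2) => [eu|nu].
  subst u2; have /eqP : (v1 - v2) * (v1 + v2) = 0.
    by move/eqP: onA => onA; move/eqP: onB => onB; rewrite -subr_sqr onA onB subrr.
  rewrite mulf_eq0 subr_eq0 addr_eq0 => /orP[]/eqP ev; last first.
    have -> : quartic_add p q r s (inr (u1, v1)) (inr (u1, v2)) = inl false.
      by rewrite /quartic_add ev !eqxx.
    have -> : qphi (inr (u1, v1)) = Some (x1, x1 * (2 * u1 + p / 2) + qh) by rewrite /= ex1.
    have -> : qphi (inr (u1, v2)) = Some (x2, x2 * (2 * u1 + p / 2) + qh) by rewrite /= ex2.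
    have ex : x2 = 4 * qM u1 - x1.
      rewrite -ex1 -ex2 ev; ring.
    have nx : 4 * qM u1 - x1 - x1 != 0.
      have -> : 4 * qM u1 - x1 - x1 = - (4 * v1) by rewrite -ex1; ring.
      by rewrite oppr_eq0 mulf_neq0.
    rewrite wadd_chord; last first.
      by rewrite ex eq_sym -subr_eq0.
    rewrite ex /ja; have -> : qg = qM u1 - u1 ^+ 2 - p * u1 / 2 by rewrite /qM; ring.
    by congr (Some (_, _)); field; rewrite ?oppr_eq0 ?nz2 ?nz4 ?nx.
  rewrite -ev {v2 ev onB ev2 ex2 ek2 v20}.
  have -> : qphi (inr (u1, v1)) = Some (x1, x1 * (2 * u1 + p / 2) + qh) by rewrite /= ex1.
  rewrite /quartic_add eqxx.
  have nv : (v1 == - v1) = false.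
    by apply/negbTE; rewrite -addr_eq0 -mulr2n -mulr_natl mulf_neq0.
  rewrite nv [_ && false]/=; set b := _ / _ + _; set y := x1 * _ + qh.
  have dE : 2 * b + p = y / v1.
    by rewrite /b /y -ex1 eq er /qM; field; rewrite ?oppr_eq0 ?nz2 ?nz4 ?v10.
  have bE : b = (y / v1 - p) / 2 by rewrite -dE; field.
  rewrite dE mulf_eq0 invr_eq0 (negPf v10) orbF; have [y0|y0] := eqVneq y 0.
    by rewrite y0 /wadd oppr0 !eqxx.
  have nx : x1 + - qM u1 * 2 != 0.
    have -> : x1 + - qM u1 * 2 = 2 * v1 by rewrite -ex1; ring.
    exact: mulf_neq0.
  have eh : qh = y - x1 * (2 * u1 + p / 2) by rewrite /y; ring.
  have eg : qg = qM u1 - u1 ^+ 2 - p * u1 / 2 by rewrite /qM; ring.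
  rewrite wadd_tangent // /qphi bE eq ev1 /ja /jb /wderiv ek1 eh.
  clearbody y b; clear - y0 nx eg nz2 nz4; move: (qM u1) eg nx => M eg nx.
  by rewrite /qM eg; congr (Some (_, _)); field; rewrite ?oppr_eq0 ?nz2 ?nz4 ?y0 ?nx.
pose M1 := qM u1; pose M2 := qM u2.
have eh : qh = (x1 ^+ 2 / 4 - x1 * M1 - x2 ^+ 2 / 4 + x2 * M2) / (u1 - u2).
  have nu' : u1 - u2 != 0 by rewrite subr_eq0.
  apply: (mulIf nu'); rewrite mulfVK //.
  transitivity (qk + qh * u1 - (qk + qh * u2)); first by ring.
  by rewrite {1}ek1 ek2 /M1 /M2; ring.
have -> : qphi (inr (u1, v1)) = Some (x1, x1 * (2 * u1 + p / 2) + qh) by rewrite /= ex1.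
have -> : qphi (inr (u2, v2)) = Some (x2, x2 * (2 * u2 + p / 2) + qh) by rewrite /= ex2.
have nu1 : u2 - u1 != 0 by rewrite subr_eq0 eq_sym.
rewrite /quartic_add (negPf nu) [false && _]/=; set b := _ / _ + _ + _.
(* On the parabola x is an affine function of u with slope 2 b + p. The degenerate case of the
   quartic law is therefore x1 = x2, where the images are opposite points. *)
have dE : 2 * b + p = (x2 - x1) / (u2 - u1).
  by rewrite /b ev1 ev2 /qM; field; rewrite ?nz2 ?nu1.
rewrite dE mulf_eq0 invr_eq0 (negPf nu1) orbF subr_eq0 (eq_sym x2).
have [ex|nx] := eqVneq x1 x2.
  rewrite -ex in ex2 ek2 *; have [x0|x0] := eqVneq x1 0.
    move: ek1 ek2; rewrite x0 expr0n !mul0r subr0 !sub0r => ek1; rewrite ek1 => e.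
    have h0 : qh = 0.
      by apply/eqP; apply/negPn/negP => h0; have /eqP := mulfI h0 (oppr_inj e); rewrite (negPf nu).
    by case: nonsq; rewrite ?ek1 h0 ?mul0r ?oppr0 eqxx.
  suff ey : x1 * (2 * u1 + p / 2) + qh = - (x1 * (2 * u2 + p / 2) + qh).
    by rewrite /wadd eqxx ey eqxx.
  have := qphi_on onA; have := qphi_on onB; rewrite /= ex1 ex2 => /eqP on2 /eqP on1.
  have /eqP : (x1 * (2 * u1 + p / 2) + qh - (x1 * (2 * u2 + p / 2) + qh)) *
     (x1 * (2 * u1 + p / 2) + qh + (x1 * (2 * u2 + p / 2) + qh)) = 0.
    by rewrite -subr_sqr on1 on2 subrr.
  have -> : x1 * (2 * u1 + p / 2) + qh - (x1 * (2 * u2 + p / 2) + qh) = 2 * x1 * (u1 - u2) by ring.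
  by rewrite !mulf_eq0 (negPf nz2) (negPf x0) subr_eq0 (negPf nu) /= addr_eq0 => /eqP.
have bE : b = ((x2 - x1) / (u2 - u1) - p) / 2 by rewrite -dE; field.
have nx' : x2 - x1 != 0 by rewrite subr_eq0 eq_sym.
have nu2 : u1 - u2 != 0 by rewrite subr_eq0.
rewrite wadd_chord // /qphi bE eq ev1 /ja /qM eh /M1 /M2 /qM.
by congr (Some (_, _)); field; rewrite ?nz2 ?nz4 ?nx' ?nu1 ?nu2.
Qed.

End QuarticJacobian.

(** * Upper and lower bounds for the rank of a group law given by its graph *)

Section RankCriteria.
Variables (A : choiceType) (law : A -> A -> A -> Prop).
Implicit Types (x y : {malg rat[A]}).

Let gen (a : A) : {malg rat[A]} := mkmalgU a 1.

Lemma tensorQ_rel0 : tensorQ_rel law 0.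
Proof.
have no (T : Type) (i : 'I_0) : T by case: i.
by exists 0%N, (no _), (no _), (no _), (no _); split=> [[]|] //; rewrite big_ord0.
Qed.

Lemma tensorQ_relD x y : tensorQ_rel law x -> tensorQ_rel law y -> tensorQ_rel law (x + y).
Proof.
case=> m [c [P [Q [R [h ->]]]]] [n [c' [P' [Q' [R' [h' ->]]]]]].
pose glue T (u : 'I_m -> T) (v : 'I_n -> T) (i : 'I_(m + n)) :=
  match split i with inl j => u j | inr j => v j end.
exists (m + n)%N, (glue _ c c'), (glue _ P P'), (glue _ Q Q'), (glue _ R R').
split; first by move=> i; rewrite /glue; case: (split i).
rewrite big_split_ord /glue; congr (_ + _); apply: eq_bigr => i _.
  by have := unsplitK (inl i : 'I_m + 'I_n) => /= ->.
by have := unsplitK (inr i : 'I_m + 'I_n) => /= ->.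
Qed.

Lemma tensorQ_relZ a x : tensorQ_rel law x -> tensorQ_rel law (a *: x).
Proof.
case=> n [c [P [Q [R [h ->]]]]]; exists n, (fun i => a * c i), P, Q, R; split=> //.
by rewrite scaler_sumr; apply: eq_bigr => i _; rewrite scalerA.
Qed.

Lemma tensorQ_rel_gen P Q R : law P Q R -> tensorQ_rel law ((gen R) - (gen P) - (gen Q)).
Proof.
move=> h; exists 1%N, (fun=> 1), (fun=> P), (fun=> Q), (fun=> R); split=> //.
by rewrite big_ord1 scale1r.
Qed.

(** Modulo the relations, the i-th iterate of [a] is 2^i times [a]. A repetition in the orbit kills
    a nonzero multiple of [a]; if this happens for all [a], the tensor product is zero. *)
Lemma positive_rank_orbit (D : A -> A) :
  (forall a, law a a (D a)) -> positive_rank law ->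
  exists a, injective (fun i => iter i D a).
Proof.
move=> hD [x indep]; apply: contrapT => noinj.
have relall a : tensorQ_rel law (gen a).
  apply: contrapT => na; apply: noinj; exists a.
  have pow i : tensorQ_rel law (gen (iter i D a) - 2 ^+ i *: (gen a)).
    elim: i => [|i IH]; first by rewrite expr0 scale1r subrr; apply: tensorQ_rel0.
    have := tensorQ_relD (tensorQ_rel_gen (hD (iter i D a))) (tensorQ_relZ 2 IH).
    congr tensorQ_rel; rewrite scalerBr scalerA -exprS iterS scaler_nat mulr2n.
    by rewrite -[_ - _ - _]addrA -opprD addrA subrK.
  suff lt_inj i j : (i < j)%N -> iter i D a = iter j D a -> False.
    by move=> i j e; case: (ltngtP i j) => // /lt_inj; [case/(_ e) | case/(_ (esym e))].
  move=> ij e; apply: na.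
  have := tensorQ_relD (pow i) (tensorQ_relZ (-1) (pow j)); rewrite -e scaleN1r opprB.
  rewrite addrC addrA subrK -scalerBl.
  have nz : 2 ^+ j - 2 ^+ i != 0 :> rat.
    by rewrite subr_eq0 eq_sym -!natrX eqr_nat eqn_exp2l // ltn_eqF.
  by move/(tensorQ_relZ (2 ^+ j - 2 ^+ i)^-1); rewrite scalerA mulVf // scale1r.
have relx y : tensorQ_rel law y.
  rewrite [y]monalgE; elim/big_ind: _ => [||k _]; [exact: tensorQ_rel0|exact: tensorQ_relD|].
  have -> : << y@_k *g k >> = y@_k *: (gen k) by apply/malgP => z; rewrite mcoeffZ !mcoeffU mulr_natr.
  exact: tensorQ_relZ.
by have /eqP := indep (fun=> 1) (relx _) ord0; rewrite oner_eq0.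
Qed.

(** With denominators cleared, a relation in the free vector space is an identity of integer
    combinations of points, coefficient by coefficient. The linear extension of [f] maps it to G,
    where the defining relations vanish. *)
Lemma rank_ge_zmod (G : zmodType) (f : A -> G) n (R : 'I_n -> A) :
  (forall P Q S, law P Q S -> f P + f Q = f S) ->
  (forall m : 'I_n -> int, \sum_(i < n) f (R i) *~ m i = 0 -> forall i, m i = 0) ->
  rank_ge law n.
Proof.
move=> fD free; exists (fun i => gen (R i)) => c [n' [c' [P' [Q' [R' [h e]]]]]].
pose N : int := \prod_(i < n) denq (c i) * \prod_(j < n') denq (c' j).
have N0 : N != 0 by rewrite mulf_neq0 //; apply/prodf_neq0 => i _; apply: denq_neq0.
have intN k (d : 'I_k -> rat) i : exists m : int, (\prod_(j < k) denq (d j))%:~R * d i = m%:~R.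
  exists (numq (d i) * \prod_(j < k | j != i) denq (d j)).
  rewrite (bigD1 i) //= !rmorphM /= -{2}[d i]divq_num_den; field.
  by rewrite intr_eq0 denq_neq0.
have /choice[m em] : forall i, exists m : int, N%:~R * c i = m%:~R.
  move=> i; have [m em] := intN _ c i; exists (m * \prod_(j < n') denq (c' j)).
  by rewrite rmorphM /= mulrAC em -rmorphM.
have /choice[t et] : forall j, exists t : int, N%:~R * c' j = t%:~R.
  move=> j; have [t et] := intN _ c' j; exists (\prod_(i < n) denq (c i) * t).
  by rewrite rmorphM /= -mulrA et -rmorphM.
suff m0 : forall i, m i = 0.
  move=> i; have /eqP := em i; rewrite m0 mulf_eq0 intr_eq0 (negPf N0) /=.
  by move/eqP.
apply: free.
(* A finite list of all points involved, over which the linear extension of [f] is an ordinary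
   sum. *)
pose S := undup ([seq R i | i <- enum 'I_n] ++ [seq R' i | i <- enum 'I_n']
   ++ [seq P' i | i <- enum 'I_n'] ++ [seq Q' i | i <- enum 'I_n']).
have inS a : a \in S -> f a = \sum_(k <- S) f k *~ (a == k)%:Z.
  move=> aS; rewrite (bigD1_seq a) ?undup_uniq //= eqxx mulr1z big1 ?addr0 // => k.
  by rewrite eq_sym => /negPf->.
have coef k : \sum_(i < n) (R i == k)%:Z * m i
   = \sum_(j < n') ((R' j == k)%:Z - (P' j == k)%:Z - (Q' j == k)%:Z) * t j.
  apply: (@intr_inj rat); rewrite !rmorph_sum /=.
  transitivity (N%:~R * mcoeff k (\sum_(i < n) c i *: gen (R i))).
    rewrite raddf_sum mulr_sumr; apply: eq_bigr => i _.
    by rewrite /= mcoeffZ /gen mcoeffU mulrA em rmorphM mulrC.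
  rewrite e raddf_sum mulr_sumr; apply: eq_bigr => j _.
  by rewrite /= mcoeffZ !mcoeffB !mcoeffU mulrA et rmorphM !rmorphB mulrC.
have RS i : R i \in S.
  by rewrite mem_undup !mem_cat (map_f R) ?mem_enum.
have R'S j : R' j \in S.
  by rewrite mem_undup !mem_cat (map_f R') ?mem_enum ?orbT.
have P'S j : P' j \in S.
  by rewrite mem_undup !mem_cat (map_f P') ?mem_enum ?orbT.
have Q'S j : Q' j \in S.
  by rewrite mem_undup !mem_cat (map_f Q') ?mem_enum ?orbT.
transitivity (\sum_(k <- S) f k *~ (\sum_(i < n) (R i == k)%:Z * m i)).
  under eq_bigr => i _ do rewrite (inS _ (RS i)) mulrz_suml.
  rewrite exchange_big; apply: eq_bigr => k _.
  by rewrite mulrz_sumr; apply: eq_bigr => i _; rewrite mulrzA.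
under eq_bigr => k _ do rewrite coef mulrz_sumr.
rewrite exchange_big big1 // => j _.
under eq_bigr => k _ do rewrite mulrzA !mulrzBr.
rewrite -mulrz_suml !sumrB -!inS //.
by rewrite -addrA -opprD (fD _ _ _ (h j)) subrr mul0rz.
Qed.

End RankCriteria.

(** Checked directly, because [qphi_inj] can identify two sums only once both are known to lie on
    the quartic. *)
Lemma on_quartic_add (F : fieldType) (p q r s : F) (A B : bool + F * F) :
  2 != 0 :> F -> (forall u, qpol p q r s u != 0) ->
  on_quartic p q r s A -> on_quartic p q r s B ->
  on_quartic p q r s (quartic_add p q r s A B).
Proof.
move=> nz2 noroot onA onB; have aff u v : on_quartic p q r s (inr (u, v)) ->
    s = v ^+ 2 - u ^+ 4 - p * u ^+ 3 - q * u ^+ 2 - r * u.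
  by move=> /eqP ->; ring.
have v0 u v : on_quartic p q r s (inr (u, v)) -> v != 0.
  by move=> /eqP on; have := noroot u; rewrite /qpol -on expf_eq0.
have half u v : on_quartic p q r s (inr (u, v)) ->
    on_quartic p q r s (quartic_add p q r s (inl false) (inr (u, v))).
  move=> /aff es; rewrite /quartic_add es; set b := - p / 2; set c := _ - b * u.
  have [d ed] : exists d, d = b ^+ 2 - 2 * c - q by eexists.
  rewrite -ed; have [//|d0] := eqVneq d 0; have eq : q = b ^+ 2 - 2 * c - d by rewrite ed; ring.
  rewrite /= eq /c /b; apply/eqP; field; by rewrite ?nz2 ?d0.
case: A B onA onB => [[]|[u1 v1]] [[]|[u2 v2]] onA onB //.
- rewrite /quartic_add; set b := - p / 2; set c := _ / 2.
  have [d ed] : exists d, d = r - 2 * b * c by eexists.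
  rewrite -ed; have [//|d0] := eqVneq d 0; have er : r = d + 2 * b * c by rewrite ed; ring.
  by rewrite /= er /c /b; apply/eqP; field; rewrite ?nz2 ?d0.
- exact: half.
- exact: (half _ _ onA).
have es := aff _ _ onA; have v10 := v0 _ _ onA; rewrite /quartic_add.
case: ifP => // nv; set b : F := if _ then _ else _.
have [d ed] : exists d, d = 2 * b + p by eexists.
rewrite -ed; have [//|d0] := eqVneq d 0; have ep : p = d - 2 * b by rewrite ed; ring.
rewrite /=; apply/eqP; rewrite es; have [eu|nu] := eqVneq u1 u2.
  have er : r = 2 * v1 * (b - 2 * u1) - 4 * u1 ^+ 3 - 3 * p * u1 ^+ 2 - 2 * q * u1.
    by rewrite /b eu eqxx -eu; field; rewrite ?nz2 ?v10.
  by rewrite -eu er ep; field.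
have nu' : u1 - u2 != 0 by rewrite subr_eq0.
have ev2 : v2 = v1 + (b - u1 - u2) * (u2 - u1).
  by rewrite /b (negPf nu); field; rewrite -oppr_eq0 opprB.
have er : r = (v1 ^+ 2 - v2 ^+ 2 - (u1 ^+ 4 - u2 ^+ 4) - p * (u1 ^+ 3 - u2 ^+ 3)
    - q * (u1 ^+ 2 - u2 ^+ 2)) / (u1 - u2).
  apply: (mulIf nu'); rewrite mulfVK //.
  by have e2 := aff _ _ onB; rewrite es in e2; apply: (addIr (v2 ^+ 2 - u2 ^+ 4 - p * u2 ^+ 3
    - q * u2 ^+ 2 - r * u2)); rewrite -{1}e2; ring.
by rewrite er ev2 ep; field; rewrite ?d0 ?nu'.
Qed.

Section JacobianNonsingular.
Variables (F : fieldType) (p q r s : F).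
Hypothesis nz2 : 2 != 0 :> F.

Definition qderiv (u : F) : F := 4 * u ^+ 3 + 3 * p * u ^+ 2 + 2 * q * u + r.

Let nz4 : 4 != 0 :> F.
Proof. have -> : 4 = 2 * 2 :> F by ring. by rewrite mulf_neq0. Qed.

Lemma qderivE u : qderiv u = 2 * qM p q u * (2 * u + p / 2) + qh p q r.
Proof. by rewrite /qderiv /qM /qh /qg; field; rewrite ?nz2 ?nz4. Qed.

Hypothesis sep : forall u, qpol p q r s u = 0 -> qderiv u != 0.
Hypothesis nonsq : qh p q r != 0 \/ qk p q s != 0.

(** A singular point with x = 0 forces h = k = 0. Otherwise it comes from an affine point (u, v) of
    the quartic; there the derivative of the cubic is 4 x v, so v = 0, and y = 0 then says that u is
    a double root of the quartic polynomial. *)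
Lemma jacobian_nonsing : wnonsing (ja p q) (jb p q r s) (jc p q r).
Proof.
move=> x fx; apply/eqP => dfx.
have [x0|x0] := eqVneq x 0.
  move: fx dfx; rewrite x0 /wcubic /wderiv /jc /jb !expr0n !mulr0 !add0r => /eqP.
  rewrite expf_eq0 /= => /eqP h0; rewrite h0 mulr0 sub0r => /eqP.
  rewrite oppr_eq0 mulf_eq0 (negPf nz4) => /eqP k0.
  by case: nonsq; rewrite ?h0 ?k0 eqxx.
have onx : on_wcurve (ja p q) (jb p q r s) (jc p q r) (Some (x, 0)).
  by rewrite /= fx expr0n.
have [[[]|[u v]] //] := qphi_surj nz2 onx; first by move=> _ [] e; rewrite -e eqxx in x0.
rewrite /= -/(qpol p q r s u) => /eqP on [ex]; rewrite ex => ey.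
have v0 : v = 0.
  have ek : qk p q s = x ^+ 2 / 4 - x * qM p q u - qh p q r * u.
    have -> : qk p q s = v ^+ 2 - qM p q u ^+ 2 - qh p q r * u by rewrite on qpolE //; ring.
    by rewrite -ex; field; rewrite ?nz2 ?nz4.
  have eg : qg p q = qM p q u - u ^+ 2 - p * u / 2 by rewrite /qM; ring.
  have eh : qh p q r = - (x * (2 * u + p / 2)) by apply/eqP; rewrite -addr_eq0 addrC ey.
  have ev : v = x / 2 - qM p q u by rewrite -ex; field.
  have /eqP : 4 * x * v = 0.
    rewrite -dfx /wderiv /ja /jb ek eh eg ev; field; by rewrite ?nz2 ?nz4.
  by rewrite !mulf_eq0 (negPf nz4) (negPf x0) => /eqP.
have Pu0 : qpol p q r s u = 0 by rewrite -on v0 expr0n.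
have /eqP := sep Pu0; apply; rewrite qderivE -ey -ex v0 mulr0 add0r; ring.
Qed.

End JacobianNonsingular.

Section QuarticPolynomial.
Variables p q r s : rat.

Definition quartic_poly : {poly rat} := 'X^4 + p *: 'X^3 + q *: 'X^2 + r *: 'X + s%:P.

Hypothesis irr : irreducible_poly quartic_poly.

Local Notation QtoC := (ratr : rat -> algC).
Let nz2Q : 2 != 0 :> rat. Proof. by []. Qed.
Let nz2C : 2 != 0 :> algC. Proof. by rewrite pnatr_eq0. Qed.

Lemma size_quartic_poly : size quartic_poly = 5%N.
Proof.
rewrite /quartic_poly -!addrA size_polyDl size_polyXn //.
rewrite (leq_ltn_trans (size_polyD _ _)) // gtn_max.
rewrite (leq_ltn_trans (size_scale_leq _ _)) ?size_polyXn //=.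
rewrite (leq_ltn_trans (size_polyD _ _)) // gtn_max.
rewrite (leq_ltn_trans (size_scale_leq _ _)) ?size_polyXn //=.
rewrite (leq_ltn_trans (size_polyD _ _)) // gtn_max.
rewrite (leq_ltn_trans (size_scale_leq _ _)) ?size_polyX //=.
by rewrite (leq_ltn_trans (size_polyC_leq1 _)).
Qed.

Lemma horner_quartic_poly u : quartic_poly.[u] = qpol p q r s u.
Proof. by rewrite /quartic_poly /qpol !(hornerD, hornerZ, hornerXn, hornerX, hornerC). Qed.

Lemma horner_map_quartic_poly (u : algC) :
  (map_poly QtoC quartic_poly).[u] = qpol (QtoC p) (QtoC q) (QtoC r) (QtoC s) u.
Proof.
rewrite /quartic_poly !rmorphD /= !map_polyZ !map_polyXn map_polyX map_polyC.
by rewrite /qpol !(hornerD, hornerZ, hornerXn, hornerX, hornerC).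
Qed.

Lemma horner_map_deriv_quartic_poly (u : algC) :
  (map_poly QtoC quartic_poly^`()).[u] = qderiv (QtoC p) (QtoC q) (QtoC r) u.
Proof.
rewrite -deriv_map /quartic_poly !rmorphD /= !map_polyZ !map_polyXn map_polyX map_polyC.
rewrite !derivE !(hornerD, hornerM, hornerZ, hornerX, hornerC) /qderiv; ring.
Qed.

Lemma qpol_neq0 u : qpol p q r s u != 0.
Proof.
rewrite -horner_quartic_poly; apply/negP; rewrite -/(root _ _) root_factor_theorem => dv.
have [_ /(_ ('X - u%:P))] := irr; rewrite size_XsubC => /(_ isT dv)/eqp_size.
by rewrite size_XsubC size_quartic_poly.
Qed.

Lemma qpol_sep (u : algC) : qpol (QtoC p) (QtoC q) (QtoC r) (QtoC s) u = 0 ->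
  qderiv (QtoC p) (QtoC q) (QtoC r) u != 0.
Proof.
rewrite -horner_map_quartic_poly -horner_map_deriv_quartic_poly => /eqP rt; apply/negP => rt'.
have [m [em mm hm]] := minCpolyP u.
have dm : m %| quartic_poly by rewrite -hm.
have dm' : m %| quartic_poly^`() by rewrite -hm.
have szm : size m != 1%N.
  have := size_minCpoly u; rewrite em size_map_poly; by case: (size m) => [|[]].
have := irr.2 m szm dm => /eqp_dvdl e; move: dm'; rewrite e => /dvdp_leq.
have szq := size_quartic_poly; have q0 : quartic_poly != 0 by rewrite -size_poly_eq0 szq.
have lt := lt_size_deriv q0.
have d0 : quartic_poly^`() != 0.
  apply/eqP => d0; have := congr1 (fun t : {poly rat} => t`_3) d0.
  by rewrite coef_deriv coef0 /quartic_poly !(coefD, coefZ, coefXn, coefX, coefC) /= !mulr0 !addr0.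
by move/(_ d0); rewrite leqNgt lt.
Qed.

(** If h = k = 0, the quartic polynomial is the square of M, and a complex root of M is a double
    root. *)
Lemma qpol_nonsqC : qh (QtoC p) (QtoC q) (QtoC r) != 0 \/ qk (QtoC p) (QtoC q) (QtoC s) != 0.
Proof.
apply: contrapT => /not_orP[/negP/negbNE/eqP h0 /negP/negbNE/eqP k0].
pose t := sqrtC ((QtoC p / 4) ^+ 2 - qg (QtoC p) (QtoC q)); pose u := t - QtoC p / 4.
have M0 : qM (QtoC p) (QtoC q) u = 0.
  have t2 : t ^+ 2 = (QtoC p / 4) ^+ 2 - qg (QtoC p) (QtoC q) by rewrite sqrtCK.
  have -> : qM (QtoC p) (QtoC q) u = t ^+ 2 - (QtoC p / 4) ^+ 2 + qg (QtoC p) (QtoC q).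
    by rewrite /qM /u; field; rewrite ?nz2C ?pnatr_eq0.
  by rewrite t2; ring.
have : qpol (QtoC p) (QtoC q) (QtoC r) (QtoC s) u = 0.
  by rewrite qpolE // M0 h0 k0; ring.
by move/qpol_sep/eqP; apply; rewrite qderivE // M0 h0; ring.
Qed.

Lemma qg_ratr : QtoC (qg p q) = qg (QtoC p) (QtoC q).
Proof. by rewrite /qg !(rmorphB, rmorphM, fmorphV, rmorphXn, rmorph_nat). Qed.
Lemma qh_ratr : QtoC (qh p q r) = qh (QtoC p) (QtoC q) (QtoC r).
Proof. by rewrite /qh rmorphB rmorphM /= qg_ratr. Qed.
Lemma qk_ratr : QtoC (qk p q s) = qk (QtoC p) (QtoC q) (QtoC s).
Proof. by rewrite /qk rmorphB rmorphXn /= qg_ratr. Qed.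
Lemma ja_ratr : QtoC (ja p q) = ja (QtoC p) (QtoC q).
Proof. by rewrite /ja rmorphB /= [ratr (4 * _)]rmorphM rmorphM fmorphV rmorphXn /= !rmorph_nat qg_ratr. Qed.
Lemma jb_ratr : QtoC (jb p q r s) = jb (QtoC p) (QtoC q) (QtoC r) (QtoC s).
Proof. by rewrite /jb rmorphB /= !rmorphM /= qh_ratr qk_ratr rmorph_nat. Qed.
Lemma jc_ratr : QtoC (jc p q r) = jc (QtoC p) (QtoC q) (QtoC r).
Proof. by rewrite /jc rmorphXn /= qh_ratr. Qed.

Lemma qpol_nonsq : qh p q r != 0 \/ qk p q s != 0.
Proof.
have [] := qpol_nonsqC; rewrite -?qh_ratr -?qk_ratr fmorph_eq0 => h; by [left|right].
Qed.

Lemma jacobian_nonsingC :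
  wnonsing (QtoC (ja p q)) (QtoC (jb p q r s)) (QtoC (jc p q r)).
Proof.
rewrite ja_ratr jb_ratr jc_ratr; apply: jacobian_nonsing => //.
  exact: qpol_sep.
exact: qpol_nonsqC.
Qed.

Lemma jacobian_nonsingQ : wnonsing (ja p q) (jb p q r s) (jc p q r).
Proof.
apply: jacobian_nonsing => // [u /eqP|]; first by rewrite (negPf (qpol_neq0 u)).
exact: qpol_nonsq.
Qed.

Definition jacQ : wcurve rat := WCurve nz2Q jacobian_nonsingQ.

Lemma quartic_law_double (O A : quartic p q r s) : exists B, quartic_law O A A B.
Proof.
have on (B : quartic p q r s) : on_quartic p q r s B by case: B.
pose w (B : quartic p q r s) : wpoint jacQ := @WPoint _ jacQ _ (qphi_on nz2Q (on B)).
have [B onB eB] := qphi_surj nz2Q (wpt_on (w A + w A - w O)).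
exists (Quartic onB); rewrite /quartic_law [quartic_pt (Quartic _)]/=.
apply: (qphi_inj nz2Q qpol_nonsq); rewrite ?(on_quartic_add nz2Q qpol_neq0) //.
rewrite !(qphi_add nz2Q qpol_neq0 qpol_nonsq) // eB.
by rewrite -[RHS]/(wpt (w A + w A - w O + w O)) subrK.
Qed.

End QuarticPolynomial.

(** * Rational points in the formal group *)

Section WeierstrassMap.
Variables (F F' : fieldType) (f : {rmorphism F -> F'}).

Definition wmap (P : option (F * F)) : option (F' * F') :=
  if P is Some (x, y) then Some (f x, f y) else None.

Lemma wmap_on a b c P :
  on_wcurve (f a) (f b) (f c) (wmap P) = on_wcurve a b c P.
Proof.
case: P => [[x y]|] //=.
by rewrite -(inj_eq (fmorph_inj f)) /wcubic !(rmorphD, rmorphM, rmorphXn).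
Qed.

Lemma wmap_add a b P Q :
  wmap (wadd a b P Q) = wadd (f a) (f b) (wmap P) (wmap Q).
Proof.
case: P Q => [[x1 y1]|] [[x2 y2]|] //=.
rewrite -rmorphN !(inj_eq (fmorph_inj f)) /wderiv; case: ifP => // _; case: ifP => _ /=.
  by rewrite !(rmorph_nat, rmorphXn, rmorphB, rmorphM, rmorphD, fmorphV).
by rewrite !(rmorph_nat, rmorphXn, rmorphB, rmorphM, rmorphD, fmorphV).
Qed.

End WeierstrassMap.

(** * Good reduction at almost all primes and the kernel of reduction *)

Section GoodReduction.
Variables a b c : algC.
Hypothesis ns : wnonsing a b c.

Lemma wnonsing_bezout : exists u v : {poly algC},
  forall x, u.[x] * wcubic a b c x + v.[x] * wderiv a b x = 1.
Proof.
have dE x : (wpol a b c)^`().[x] = wderiv a b x.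
  by rewrite /wpol !derivE !(hornerD, hornerM, hornerZ, hornerX, hornerC) /wderiv; ring.
have fE x : (wpol a b c).[x] = wcubic a b c x.
  by rewrite /wpol !(hornerD, hornerZ, hornerXn, hornerX, hornerC).
have cop : coprimep (wpol a b c) (wpol a b c)^`().
  apply/negPn/negP => ncop; have : size (gcdp (wpol a b c) (wpol a b c)^`()) != 1%N by [].
  move/closed_rootP => [x]; rewrite root_gcd /root fE dE => /andP[/eqP fx /eqP dx].
  by have /eqP := ns fx.
have [[u v] /= e] := Bezout_coprimepP _ _ cop; rewrite -size_poly_eq1 in e.
have /size_poly1P[k k0 ek] := e.
exists (k^-1 *: u), (k^-1 *: v) => x; rewrite -fE -dE !hornerZ -!mulrA -mulrDr.
by rewrite -!hornerM -hornerD ek hornerC mulVf.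
Qed.

Lemma horner_locint l (g : {poly algC}) x :
  {subset (g : seq algC) <= locint l} -> x \in locint l -> g.[x] \in locint l.
Proof.
move=> Vg Vx; rewrite horner_coef; apply: rpred_sum => i _.
by apply: rpredM; [apply/Vg/mem_nth | apply: rpredX].
Qed.

(** Good reduction expressed without a residue field: the cubic and its derivative cannot both be
    multiples of l at an integral x. The Bezout coefficients are fixed polynomials, integral at all
    large l. *)
Lemma wnonsing_mod : exists N, forall l, prime l -> (N < l)%N ->
  forall x, x \in locint l -> exists A B, [/\ A \in locint l, B \in locint l &
    A * wcubic a b c x + B * wderiv a b x = 1].
Proof.
have [u [v e]] := wnonsing_bezout.
have [N hN] := locint_large_seq (polyseq u ++ polyseq v).
exists N => l pl lN x Vx; exists u.[x], v.[x]; split=> //; apply: horner_locint => // z zu;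
  by apply: (hN l pl lN); rewrite mem_cat zu ?orbT.
Qed.

End GoodReduction.

Lemma wcubic_diff (F : fieldType) (a b c x1 x2 : F) :
  wcubic a b c x1 - wcubic a b c x2 =
  (x1 - x2) * (x1 ^+ 2 + x1 * x2 + x2 ^+ 2 + a * (x1 + x2) + b).
Proof. by rewrite /wcubic; ring. Qed.

Section ReductionKernel.
Variables (l : nat) (a b c : algC).
Hypothesis pl : prime l.
Hypotheses (Va : a \in locint l) (Vb : b \in locint l) (Vc : c \in locint l).
Hypothesis V2 : 2^-1 \in locint l.
Hypothesis good : forall x, x \in locint l -> exists A B,
  [/\ A \in locint l, B \in locint l & A * wcubic a b c x + B * wderiv a b x = 1].
Local Notation V := (locint l).
Let l1 := prime_gt1 pl.
Let lz : l%:R != 0 :> algC. Proof. by rewrite pnatr_eq0 -lt0n ltnW. Qed.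

Lemma locint_l_neq1 v : v \in V -> l%:R * v <> 1.
Proof.
move=> Vv e; case/negP: (locint_ninv l1).
by have -> : (l%:R)^-1 = v by apply: (mulfI lz); rewrite divff.
Qed.

(* Congruent points have the same reduction, so that their difference reduces
   to the origin. *)
Lemma wadd_congruent x1 y1 x2 y2 t t' x3 y3 :
  on_wcurve a b c (Some (x1, y1)) -> on_wcurve a b c (Some (x2, y2)) ->
  x1 \in V -> y1 \in V -> x2 \in V -> y2 \in V -> t \in V -> t' \in V ->
  x1 - x2 = l%:R * t -> y1 - y2 = l%:R * t' ->
  wadd a b (Some (x1, y1)) (Some (x2, - y2)) = Some (x3, y3) -> x3 \notin V.
Proof.
move=> /eqP on1 /eqP on2 Vx1 Vy1 Vx2 Vy2 Vt Vt' ex ey eR; apply/negP => Vx3.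
have nz2 : 2 != 0 :> algC by rewrite pnatr_eq0.
have [A [B [VA VB eAB]]] := good Vx1.
have contra v v' : v \in V -> v' \in V -> wcubic a b c x1 = l%:R * v ->
    wderiv a b x1 = l%:R * v' -> False.
  move=> Vv Vv' ef ed; apply: (@locint_l_neq1 (A * v + B * v')); first by locint.
  by rewrite -[RHS]eAB ef ed; ring.
(* If x3 is integral, so is the slope m, because m^2 = x3 + a + x1 + x2. Then y1 + y2 = m (x1 - x2)
   and y1 - y2 are multiples of l, hence so are y1 and the cubic at x1. Its derivative there is
   congruent to the divided difference m (y1 - y2), against [good]. *)
have [m [Vm em1]] : exists m, m \in V /\ (x1 - x2) * m = y1 + y2 /\
    (x1 = x2 -> y1 = - y2 /\ wderiv a b x1 = m * (y1 - y2)).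
  move: eR; rewrite /wadd opprK; case: ifP => // nv [].
  set m := if _ then _ else _ => em _; exists m; split.
    apply: locint_sqr; have -> : m ^+ 2 = x3 + a + x1 + x2 by rewrite -em; ring.
    by locint.
  rewrite /m; have [e12|n12] := eqVneq x1 x2; last first.
    split; last by move=> e; rewrite e eqxx in n12.
    have n21 : x2 - x1 != 0 by rewrite subr_eq0 eq_sym.
    by field.
  move: nv; rewrite e12 eqxx /= => /negbT nv.
  have /eqP : (y1 - y2) * (y1 + y2) = 0 by rewrite -subr_sqr on1 on2 e12 subrr.
  rewrite mulf_eq0 subr_eq0 (negPf nv) /= => /eqP y0; rewrite subrr mul0r y0; split=> // _.
  have ey2 : y2 = - y1 by apply/eqP; rewrite -addr_eq0 addrC y0.
  split; first by rewrite ey2 opprK.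
  have y10 : y1 != 0.
    by apply: contraNneq nv => y10; rewrite ey2 y10 oppr0.
  by rewrite ey2; field.
case: em1 => em1 em2.
have y1E : y1 = l%:R * (2^-1 * (t' + t * m)).
  have -> : l%:R * (2^-1 * (t' + t * m)) = ((y1 - y2) + (x1 - x2) * m) / 2.
    by rewrite ex ey; field.
  by rewrite em1; field.
apply: (@contra (y1 * (2^-1 * (t' + t * m))) (m * t' + t * (3 * x1 - l%:R * t + a)));
  [by locint|by locint|by rewrite -on1 {1}expr2 {1}y1E; ring|].
have [e12|n12] := eqVneq x1 x2.
  have [_ ->] := em2 e12; have t0 : t = 0.
    by apply: (mulfI lz); rewrite mulr0 -ex e12 subrr.
  by rewrite ey t0; ring.
have Q : x1 ^+ 2 + x1 * x2 + x2 ^+ 2 + a * (x1 + x2) + b = m * (l%:R * t').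
  have n12' : x1 - x2 != 0 by rewrite subr_eq0.
  apply: (mulfI n12'); rewrite -(wcubic_diff a b c) -on1 -on2 subr_sqr ey -em1; ring.
have ex2 : x2 = x1 - l%:R * t by rewrite -ex; ring.
have -> : l%:R * (m * t' + t * (3 * x1 - l%:R * t + a)) =
   m * (l%:R * t') + l%:R * t * (3 * x1 - l%:R * t + a) by ring.
by rewrite -Q ex2 /wderiv; ring.
Qed.

End ReductionKernel.

Section RationalPoints.
Variables (l : nat) (a b c : rat).
Hypothesis pl : prime l.
Local Notation V := (locint l).
Local Notation QtoC := (ratr : rat -> algC).
Hypotheses (Va : QtoC a \in V) (Vb : QtoC b \in V) (Vc : QtoC c \in V).
Hypothesis V2 : 2^-1 \in V.
Hypothesis good : forall x, x \in V -> exists A B, [/\ A \in V, B \in V &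
  A * wcubic (QtoC a) (QtoC b) (QtoC c) x + B * wderiv (QtoC a) (QtoC b) x = 1].
Let l1 := prime_gt1 pl.
Let lz : l%:R != 0 :> algC. Proof. by rewrite pnatr_eq0 -lt0n ltnW. Qed.
Local Notation near := (near_oo l (QtoC a) (QtoC b) (QtoC c)).
Let nz2 : 2 != 0 :> rat. Proof. by []. Qed.

(** Since 1 / x is a multiple of l and y^2 is x^3 times a unit, z^2 is a multiple of l; as z is
    rational, so is z. *)
Lemma nonintegral_near_oo x y : on_wcurve a b c (Some (x, y)) -> QtoC x \notin V ->
  let P := wmap QtoC (Some (x, y)) in
  near (wz P) P /\ wz P != 0 /\ exists2 w, w \in V & wz P = l%:R * w.
Proof.
move=> /eqP on Vx; have [Vx'|[x0 [t Vt et]]] := locint_rat x pl; first by rewrite Vx' in Vx.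
have x0' : QtoC x != 0 by rewrite fmorph_eq0.
have et' : (QtoC x)^-1 = l%:R * QtoC t by rewrite -fmorphV et rmorphM rmorph_nat.
pose U := 1 + l%:R * (QtoC t * (QtoC a + QtoC b / QtoC x + QtoC c / QtoC x ^+ 2)).
have VU : QtoC t * (QtoC a + QtoC b / QtoC x + QtoC c / QtoC x ^+ 2) \in V.
  by rewrite -exprVn et'; locint.
have [U0 VUi] := locint_inv l1 VU; rewrite -/U in U0 VUi.
have UE : QtoC y ^+ 2 = QtoC x ^+ 3 * U.
  have -> : U = 1 + (l%:R * QtoC t) * (QtoC a + QtoC b / QtoC x + QtoC c / QtoC x ^+ 2).
    by rewrite /U; ring.
  rewrite -et' -rmorphXn on /wcubic !(rmorphD, rmorphM, rmorphXn) /=.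
  by field.
have y0 : QtoC y != 0.
  have : QtoC y ^+ 2 != 0 by rewrite UE mulf_neq0 ?expf_neq0.
  by rewrite expf_eq0.
move=> P; have zE : wz P ^+ 2 = l%:R * (QtoC t * U^-1).
  by rewrite /= mulrA -et' expr_div_n UE; field; rewrite x0' U0.
split; last first.
  split; first by rewrite mulf_neq0 ?invr_eq0.
  have -> : wz P = QtoC (x / y) by rewrite /= fmorph_div.
  apply: locint_rat_sqr => //; exists (QtoC t * U^-1); first by locint.
  by rewrite -zE /= fmorph_div.
split=> //.
- by rewrite wmap_on; apply/eqP.
- by exists 1; rewrite ?rpred1 ?mulr1.
exists U; first by rewrite /U; locint.
have -> : U = QtoC y ^+ 2 / QtoC x ^+ 3 by rewrite UE; field; rewrite x0'.
by rewrite /=; field; rewrite x0' y0.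
Qed.

Lemma infinite_near_oo (P : nat -> option (rat * rat)) :
  (forall i, on_wcurve a b c (P i)) -> injective P ->
  exists T, [/\ on_wcurve a b c T, near (wz (wmap QtoC T)) (wmap QtoC T),
    wz (wmap QtoC T) != 0 & exists2 w, w \in V & wz (wmap QtoC T) = l%:R * w].
Proof.
move=> onP injP; apply: contrapT => no.
have Vx i x y : P i = Some (x, y) -> QtoC x \in V.
  move=> Pi; apply/negPn/negP => nVx; have on : on_wcurve a b c (Some (x, y)) by rewrite -Pi.
  have [nP [z0 zl]] := nonintegral_near_oo on nVx.
  by apply: no; exists (Some (x, y)).
have Vy i x y : P i = Some (x, y) -> QtoC y \in V.
  move=> Pi; have := onP i; rewrite Pi => /eqP on; apply: locint_sqr.
  have Vxi := Vx _ _ _ Pi; rewrite -rmorphXn on /wcubic !(rmorphD, rmorphM, rmorphXn) /=.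
  by locint.
pose res (k : option ('I_l * 'I_l)) (Q : option (rat * rat)) : Prop := match k, Q with
  | None, None => True
  | Some (i, j), Some (x, y) => exists t t' : rat, [/\ QtoC t \in V, QtoC t' \in V,
      x = (i : nat)%:R + l%:R * t & y = (j : nat)%:R + l%:R * t']
  | _, _ => False end.
have /choice[k hk] : forall n, exists k, res k (P n).
  move=> n; case Pn: (P n) => [[x y]|]; last by exists None.
  have [i [t Vt et]] := locint_residue pl (Vx _ _ _ Pn).
  have [j [t' Vt' et']] := locint_residue pl (Vy _ _ _ Pn).
  by exists (Some (i, j)), t, t'.
pose M := #|{: option ('I_l * 'I_l)}|.
have /injectivePn[i [j nij ekij]] : ~~ injectiveb (fun n : 'I_M.+1 => k n).
  by apply/injectiveP => /leq_card; rewrite card_ord ltnn.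
have nP : P i != P j by apply: contraNneq nij => /injP/val_inj->.
have := hk i; have := hk j; rewrite -ekij; case: (k i) => [[m n]|]; last first.
  by case: (P i) (P j) nP => [?|] [?|].
case Pj: (P j) => [[x2 y2]|] //; case Pi: (P i) => [[x1 y1]|] //=.
move=> [t2 [t2' [Vt2 Vt2' ex2 ey2]]] [t1 [t1' [Vt1 Vt1' ex1 ey1]]].
have on1 : on_wcurve a b c (Some (x1, y1)) by rewrite -Pi.
have on2 : on_wcurve a b c (Some (x2, y2)) by rewrite -Pj.
have onN2 : on_wcurve a b c (wopp (Some (x2, y2))) by rewrite on_wopp.
have onT := on_wadd nz2 on1 onN2.
case eT: (wadd a b (Some (x1, y1)) (wopp (Some (x2, y2)))) onT => [[x3 y3]|] onT; last first.
  by move: nP; rewrite Pi Pj (wadd_eq0 on1 on2 eT) eqxx.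
have nVx : QtoC x3 \notin V.
  apply: (wadd_congruent pl Va V2 good (x1 := QtoC x1) (y1 := QtoC y1)
    (x2 := QtoC x2) (y2 := QtoC y2) (y3 := QtoC y3) (t := QtoC (t1 - t2)) (t' := QtoC (t1' - t2'))).
  - by rewrite -[Some _]/(wmap QtoC (Some (x1, y1))) wmap_on.
  - by rewrite -[Some _]/(wmap QtoC (Some (x2, y2))) wmap_on.
  - exact: Vx Pi.
  - exact: Vy Pi.
  - exact: Vx Pj.
  - exact: Vy Pj.
  - by rewrite rmorphB rpredB.
  - by rewrite rmorphB rpredB.
  - by rewrite ex1 ex2 !rmorphB !rmorphD !rmorphM !rmorph_nat /=; ring.
  - by rewrite ey1 ey2 !rmorphB !rmorphD !rmorphM !rmorph_nat /=; ring.
  by rewrite -rmorphN -[RHS]/(wmap QtoC (Some (x3, y3))) -eT wmap_add.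
have [nT [z0 zl]] := nonintegral_near_oo onT nVx.
by apply: no; exists (Some (x3, y3)).
Qed.

End RationalPoints.

Section RationalValuation.
Variable E : wcurve rat.
Local Notation QtoC := (ratr : rat -> algC).
Local Notation a := (QtoC (wca E)).
Local Notation b := (QtoC (wcb E)).
Local Notation c := (QtoC (wcc E)).
Hypothesis ns : wnonsing a b c.

Lemma wmap_mulrn (T : wpoint E) n :
  wmap QtoC (T *+ n : wpoint E) = iter n (wadd a b (wmap QtoC T)) None.
Proof. by elim: n => [|n IH] //; rewrite mulrS wptD wmap_add IH. Qed.

Lemma near_oo_valuation : exists N, forall l, prime l -> (N < l)%N ->
  forall P : nat -> wpoint E, injective P ->
  exists (T : wpoint E) k e, [/\ odd k, (2 < k)%N, e \in locunit l,
    wz (wmap QtoC T) = l%:R ^+ k * e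
    & near_oo l a b c (wz (wmap QtoC T)) (wmap QtoC T)].
Proof.
have [N1 good] := wnonsing_mod ns.
have [N2 hN2] := locint_large_seq [:: a; b; c; 2^-1].
exists (maxn N1 N2) => l pl; rewrite gtn_max => /andP[lN1 lN2] P injP.
have [Va Vb Vc V2] : [/\ a \in locint l, b \in locint l, c \in locint l & 2^-1 \in locint l].
  by split; apply: hN2 => //; rewrite !inE eqxx ?orbT.
have l1 := prime_gt1 pl; have lz : l%:R != 0 :> algC by rewrite pnatr_eq0 -lt0n ltnW.
have [T0 [onT0 nT0 z0 [w Vw ew]]] :=
  infinite_near_oo pl Va Vb Vc V2 (good l pl lN1) (fun i => wpt_on (P i))
    (fun i j eP => injP i j (val_inj eP)).
have [T [k [e [k0 Ue eT nT]]]] : exists (T : wpoint E) k e, [/\ (0 < k)%N, e \in locunit l,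
    wz (wmap QtoC T) = l%:R ^+ k * e
    & near_oo l a b c (wz (wmap QtoC T)) (wmap QtoC T)].
  have [z ez] : exists z, wz (wmap QtoC T0) = QtoC z.
    by case: (T0) => [[x y]|]; [exists (x / y); rewrite /= fmorph_div | exists 0; rewrite rmorph0].
  have zn : z != 0 by move: z0; rewrite ez fmorph_eq0.
  have Vz : QtoC z \in locint l by rewrite -ez ew; locint.
  have [k [e [eke Ue]]] := rat_val pl zn Vz.
  have ezC : wz (wmap QtoC T0) = l%:R ^+ k * QtoC e.
    by rewrite ez eke rmorphM rmorphXn /= rmorph_nat.
  exists (WPoint onT0), k, (QtoC e); split=> //.
  case: (k) ezC => // ez0; case/negP: (locunit_ndiv l1 Ue).
  have -> : QtoC e = l%:R * w by rewrite -ew ez0 expr0 mul1r.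
  by rewrite mulrC mulKf.
have scale n : exists (T : wpoint E) e, [/\ e \in locunit l,
    wz (wmap QtoC T) = l%:R ^+ (k + n) * e
    & near_oo l a b c (wz (wmap QtoC T)) (wmap QtoC T)].
  elim: n => [|n [T' [e' [Ue' eT' nT']]]]; first by exists T, e; rewrite addn0.
  have [e'0 Ve' _] := locunitP _ _ Ue'.
  have kn : (k + n)%N = (k + n).-1.+1 by rewrite prednK // addn_gt0 k0.
  have es : wz (wmap QtoC T') ^+ 2 = l%:R ^+ 2 * (l%:R ^+ (k + n).-1 * e') ^+ 2.
    by rewrite eT' -exprMn; congr (_ ^+ 2); rewrite [in LHS]kn exprS mulrA.
  have Vs : (l%:R ^+ (k + n).-1 * e') ^+ 2 \in locint l by locint.
  have Vz : wz (wmap QtoC T') \in locint l by rewrite eT'; locint.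
  have [nlT [f Vf ef]] := near_oo_iter_l l1 Va Vb Vc Vs es Vz nT'.
  rewrite -wmap_mulrn in nlT ef; exists (T' *+ l), (e' * (1 + l%:R * f)); split=> //.
    by apply: locunitM => //; apply: locunit1D.
  by rewrite ef eT' addnS exprS; ring.
(* The exponent 2 k + 3 is odd and greater than 2 whatever the parity of k; it is reached by
   multiplying the point by l^(k + 3). *)
have [k' [n [ek' ok']]] : exists k' n, (k' = k + n /\ (odd k' /\ 2 < k'))%N.
  by exists (k + (k + 3))%N, (k + 3)%N; split=> //; rewrite addnA oddD addnn odd_double addn3.
have [T' [e' [Ue' eT' nT']]] := scale n.
by exists T', k', e'; rewrite ek'; case: ok'; rewrite ek' => ? ?; split.
Qed.

End RationalValuation.

(** * Valuations of the quartic coordinates at a point close to the origin *)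

Section QuarticNearInfinity.
Variables (l : nat) (p q r s : algC).
Hypothesis pl : prime l.
Local Notation V := (locint l).
Hypotheses (Vp : p \in V) (Vq : q \in V) (Vr : r \in V) (Vs : s \in V) (V2 : 2^-1 \in V).
Let l1 := prime_gt1 pl.
Let lz : l%:R != 0 :> algC. Proof. by rewrite pnatr_eq0 -lt0n ltnW. Qed.
Let nz2 : 2 != 0 :> algC. Proof. by rewrite pnatr_eq0. Qed.
Let nz4 : 4 != 0 :> algC. Proof. by rewrite pnatr_eq0. Qed.
Let U2 : 2^-1 \in locunit l.
Proof. by apply/locunitP; rewrite invr_eq0 invrK; split=> //; locint. Qed.
Let V4 : 4^-1 \in V.
Proof. have -> : 4^-1 = 2^-1 * 2^-1 :> algC by field. by locint. Qed.
Let U4 : 4^-1 \in locunit l.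
Proof. have -> : 4^-1 = 2^-1 * 2^-1 :> algC by field. exact: locunitM. Qed.
Let Vg : qg p q \in V. Proof. by rewrite /qg; locint. Qed.
Let Vh : qh p q r \in V. Proof. by rewrite /qh; locint. Qed.
Let Vk : qk p q s \in V. Proof. by rewrite /qk; locint. Qed.
Let Va : ja p q \in V. Proof. by rewrite /ja; locint. Qed.
Let Vb : jb p q r s \in V. Proof. by rewrite /jb; locint. Qed.
Let Vc : jc p q r \in V. Proof. by rewrite /jc; locint. Qed.

Let unit1D (x v : algC) : v \in V -> x = 1 + l%:R * v -> x \in locunit l.
Proof. by move=> Vv ->; apply: locunit1D. Qed.

(* Near infinity x ~ z^-2 and y ~ z^-3, whence u ~ z^-1 / 2 and v ~ z^-2 / 4. *)
Lemma qphi_near_oo u v z w : z != 0 -> w \in V -> z = l%:R * w ->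
  let P := qphi p q r (inr (u, v)) in
  z = wz P -> near_oo l (ja p q) (jb p q r s) (jc p q r) z P ->
  [/\ u * z \in locunit l, v * z ^+ 2 \in locunit l
    & (qderiv p q r u / v + 4 * u + p) * z \in locunit l].
Proof.
move=> z0 Vw ez; rewrite /qphi; set x := 2 * v + _; set y := x * _ + _.
move=> zP [on y0 _ [t Vt ew]].
rewrite /= in zP on y0 ew; move/eqP: on => on.
have x0 : x != 0 by apply: contraNneq z0 => x0; rewrite zP x0 mul0r.
have Vz : z \in V by rewrite ez; locint.
(* With t = 1 / (y z^3) the cubic equation is t = 1 + a z^2 t + b z^4 t^2 + c z^6 t^3, so that t is
   1 modulo l. *)
have tE : t = 1 + l%:R * (w * (ja p q * z * t + jb p q r s * z ^+ 3 * t ^+ 2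
                               + jc p q r * z ^+ 5 * t ^+ 3)).
  have -> : 1 + l%:R * (w * (ja p q * z * t + jb p q r s * z ^+ 3 * t ^+ 2
                               + jc p q r * z ^+ 5 * t ^+ 3))
     = 1 + (l%:R * w) * (ja p q * z * t + jb p q r s * z ^+ 3 * t ^+ 2
                               + jc p q r * z ^+ 5 * t ^+ 3) by ring.
  rewrite -ez; have -> : t = y^-1 / z ^+ 3 by rewrite ew; field.
  rewrite zP; apply: (mulIf (expf_neq0 3 x0)).
  transitivity (y ^+ 2); first by field; rewrite x0 y0.
  by rewrite on /wcubic; field; rewrite x0 y0.
set t' := w * _ in tE; have Vt' : t' \in V by rewrite /t'; locint.
have Ut := unit1D Vt' tE; have [t0 _ Vti] := locunitP _ _ Ut.
have ey : y = (z ^+ 3 * t)^-1 by rewrite -ew invrK.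
have ex : x = (z ^+ 2 * t)^-1.
  by apply: (mulIf (invr_neq0 y0)); rewrite -zP ey; field; rewrite z0 t0.
have u2 : 2 * u * z = 1 + l%:R * (- w * (p / 2 + qh p q r * z ^+ 2 * t)).
  have -> : 1 + l%:R * (- w * (p / 2 + qh p q r * z ^+ 2 * t))
     = 1 - (l%:R * w) * (p / 2 + qh p q r * z ^+ 2 * t) by ring.
  rewrite -ez; have -> : 2 * u = (y - qh p q r) / x - p / 2 by rewrite /y; field.
  by rewrite ex ey; field; rewrite t0 z0.
set u' := - w * _ in u2; have Vu' : u' \in V.
  by rewrite /u'; locint.
have uE : u * z = 2^-1 * (1 + l%:R * u') by rewrite -u2; field.
have Uu : u * z \in locunit l by rewrite uE; apply: locunitM => //; apply: locunit1D.
have Vtiv : t^-1 = 1 + l%:R * (- t' / t).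
  have e1 : (1 + l%:R * (- t' / t)) * t = t - l%:R * t' by field.
  by apply: (mulIf t0); rewrite mulVf // e1 {1}tE; ring.
have Vuz : u * z \in V by rewrite uE; locint.
(* From v = x / 2 - M and x z^2 = 1 / t, the number v z^2 is 1 / 2 - (u z)^2 = 1 / 4 modulo l; [v']
   is the quotient of 4 v z^2 - 1 by l. *)
pose v' := 2 * (- t' / t) - (2 * u' + l%:R * u' ^+ 2) - 2 * p * w * (u * z) - 4 * qg p q * w * z.
have Vv' : v' \in V by rewrite /v'; locint.
have vE : v * z ^+ 2 = 4^-1 * (1 + l%:R * v').
  have -> : v = x / 2 - qM p q u by rewrite /x; field.
  transitivity (t^-1 / 2 - ((u * z) ^+ 2 + p / 2 * (u * z) * z + qg p q * z ^+ 2)).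
    by rewrite ex /qM; field; rewrite z0 t0.
  rewrite Vtiv {1}uE {2}ez [z ^+ 2]expr2 {2}ez /v'; field; exact: t0.
have Uv : v * z ^+ 2 \in locunit l by rewrite vE; apply: locunitM => //; apply: locunit1D.
have v0 : v != 0.
  have [v0 _ _] := locunitP _ _ Uv; by apply: contraNneq v0 => ->; rewrite mul0r.
(* This is the coefficient d = 2 b + p of the tangent parabola, and it has the simple form y / v. *)
split=> //; have -> : qderiv p q r u / v + 4 * u + p = y / v.
  by rewrite /y /x qderivE //; field; rewrite v0.
have -> : y / v * z = t^-1 * (v * z ^+ 2)^-1.
  by rewrite ey; field; rewrite v0 z0 t0.
by apply: locunitM; apply: locunitV.
Qed.

End QuarticNearInfinity.

(** * The tangent parabola at a rational point close to the origin *)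

Section TangentParabola.
Variables p q r s : rat.
Local Notation QtoC := (ratr : rat -> algC).

Lemma qphi_map u v : qphi (QtoC p) (QtoC q) (QtoC r) (inr (QtoC u, QtoC v)) =
  wmap QtoC (qphi p q r (inr (u, v))).
Proof.
have eM : QtoC (qM p q u) = qM (QtoC p) (QtoC q) (QtoC u).
  by rewrite /qM !rmorphD rmorphXn /= qg_ratr !rmorphM fmorphV !rmorph_nat.
rewrite /= -eM -qh_ratr; move: (qM p q u) (qh p q r) => M h.
by rewrite !(rmorph_nat, rmorphM, rmorphD, fmorphV).
Qed.

Definition tangent_slope (u v : rat) := qderiv p q r u / (2 * v) + 2 * u.
Definition tangent_const (u v : rat) := v + u ^+ 2 - tangent_slope u v * u.

(* The parabola through oo- which is tangent to the quartic at (u, v) also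
   meets it above the abscissa of the double of (u, v). *)
Lemma tangent_parabola u v x : v != 0 -> v ^+ 2 = qpol p q r s u ->
  let b := tangent_slope u v in let c := tangent_const u v in let d := 2 * b + p in
  d != 0 -> qpol (QtoC p) (QtoC q) (QtoC r) (QtoC s) x = 0 ->
  (x ^+ 2 - QtoC b * x - QtoC c) ^+ 2 =
  - QtoC d * (x - QtoC u) ^+ 2 * (x - QtoC ((b ^+ 2 - 2 * c - q) / d - u - u)).
Proof.
move=> v0 on b c d d0 x0.
pose X : {poly rat} := 'X^2 - b *: 'X - c%:P.
have es : s = v ^+ 2 - u ^+ 4 - p * u ^+ 3 - q * u ^+ 2 - r * u by rewrite on /qpol; ring.
have er : r = 2 * v * (b - 2 * u) - 4 * u ^+ 3 - 3 * p * u ^+ 2 - 2 * q * u.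
  by rewrite /b /tangent_slope /qderiv; field.
have ep : p = d - 2 * b by rewrite /d; ring.
have ec : c = v + u ^+ 2 - b * u by [].
have nd : QtoC d != 0 by rewrite fmorph_eq0.
rewrite -[LHS]subr0 -[in LHS]x0 /qpol es er ep ec.
clearbody b d; rewrite !(rmorph_nat, rmorphXn, rmorphB, rmorphD, rmorphM, fmorphV).
by field.
Qed.

Hypothesis irr : irreducible_poly (quartic_poly p q r s).
Variable O : quartic p q r s.
Hypothesis posrank : positive_rank (quartic_law O).

Lemma infinite_jacQ : exists P : nat -> wpoint (jacQ irr), injective P.
Proof.
have nz2Q : 2 != 0 :> rat by [].
have [D hD] := choice (quartic_law_double irr O).
have [A injA] := positive_rank_orbit hD posrank.
have on (B : quartic p q r s) : on_quartic p q r s B by case: B.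
pose w (B : quartic p q r s) : wpoint (jacQ irr) := @WPoint _ (jacQ irr) _ (qphi_on nz2Q (on B)).
exists (fun i => w (iter i D A)) => i j /(congr1 val) /= e; apply: injA; apply: val_inj.
exact: (qphi_inj nz2Q (qpol_nonsq irr)) e.
Qed.

(** Let T be the point of E' with parameter of valuation k, and (a, v) its preimage on the quartic.
    As 2 is a unit at l, the point 2 T has a parameter of the same valuation k, which gives its
    abscissa u the valuation - k. The value y / v at T gives the same for d. *)
Lemma rational_tangent x : qpol (QtoC p) (QtoC q) (QtoC r) (QtoC s) x = 0 ->
  exists N, forall l, prime l -> (N < l)%N -> exists u a b c d k,
  [/\ odd k, (2 < k)%N, QtoC u * l%:R ^+ k \in locunit l, QtoC d * l%:R ^+ k \in locunit l
    & (x ^+ 2 - QtoC b * x - QtoC c) ^+ 2 = - QtoC d * (x - QtoC a) ^+ 2 * (x - QtoC u)].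
Proof.
move=> x0; have [P injP] := infinite_jacQ.
have nz2Q : 2 != 0 :> rat by [].
have nz2 : 2 != 0 :> algC by rewrite pnatr_eq0.
have [N1 val] := near_oo_valuation (E := jacQ irr) (jacobian_nonsingC irr).
have [N2 hN2] := locint_large_seq [:: QtoC p; QtoC q; QtoC r; QtoC s; 2^-1].
exists (maxn N1 N2) => l pl; rewrite gtn_max => /andP[lN1 lN2].
have [Vp Vq Vr Vs V2] : [/\ QtoC p \in locint l, QtoC q \in locint l, QtoC r \in locint l,
    QtoC s \in locint l & 2^-1 \in locint l].
  by split; apply: hN2 => //; rewrite !inE eqxx ?orbT.
have l1 := prime_gt1 pl; have lz : l%:R != 0 :> algC by rewrite pnatr_eq0 -lt0n ltnW.
have [T [k [e [ok k2 Ue eT nT]]]] := val l pl lN1 P injP.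
have [e0 Ve _] := locunitP _ _ Ue.
have k1 : k = k.-1.+1 by case: (k) k2.
have V4 : 4^-1 \in locint l.
  by have -> : 4^-1 = 2^-1 * 2^-1 :> algC; [field | locint].
rewrite /jacQ /= ja_ratr jb_ratr jc_ratr in nT.
have Vg : qg (QtoC p) (QtoC q) \in locint l by rewrite /qg; locint.
have Vh : qh (QtoC p) (QtoC q) (QtoC r) \in locint l by rewrite /qh; locint.
have Vk : qk (QtoC p) (QtoC q) (QtoC s) \in locint l by rewrite /qk; locint.
have Va : ja (QtoC p) (QtoC q) \in locint l by rewrite /ja; locint.
have Vb : jb (QtoC p) (QtoC q) (QtoC r) (QtoC s) \in locint l by rewrite /jb; locint.
have Vc : jc (QtoC p) (QtoC q) (QtoC r) \in locint l by rewrite /jc; locint.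
(* Both points at infinity have parameter 0, unlike T, so T comes from an affine point. *)
have [[[]|[u v]] onA eA] := qphi_surj nz2Q (wpt_on T).
- by move: eT; rewrite -eA /= => /esym/eqP; rewrite mulf_eq0 (negPf e0) expf_eq0 (negPf lz) andbF.
- by move: eT; rewrite -eA /= rmorph0 mul0r => /esym/eqP; rewrite mulf_eq0 (negPf e0) expf_eq0 (negPf lz) andbF.
have ez : wz (wmap QtoC T) = l%:R * (l%:R ^+ k.-1 * e) by rewrite eT {1}k1 exprS mulrA.
have Vw : l%:R ^+ k.-1 * e \in locint l by locint.
have Vz : wz (wmap QtoC T) \in locint l by rewrite ez; locint.
have z0 : wz (wmap QtoC T) != 0 by rewrite eT mulf_neq0 ?expf_neq0.
have [] := qphi_near_oo pl Vp Vq Vr Vs V2 (u := QtoC u) (v := QtoC v) z0 Vw ez;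
  [by rewrite qphi_map eA | by rewrite qphi_map eA |] => _ Uv UD.
have v0 : v != 0.
  have [v0 _ _] := locunitP _ _ Uv.
  by move: v0; rewrite mulf_eq0 fmorph_eq0 => /norP[].
have es2 : wz (wmap QtoC T) ^+ 2 = l%:R * (wz (wmap QtoC T) * (l%:R ^+ k.-1 * e)).
  by rewrite expr2 {1}ez; ring.
have Vs2 : wz (wmap QtoC T) * (l%:R ^+ k.-1 * e) \in locint l by locint.
have [nS0 [f Vf ef]] := near_oo_add l1 Va Vb Vc Vz Vs2 es2 nT nT.
have [VzS nS] := near_oo_wz l1 Va Vb Vc Vz Vs2 es2 nS0.
rewrite -ja_ratr -jb_ratr -wmap_add -eA -qphi_add // in ef nS; last 2 first.
- by move=> ?; apply: qpol_neq0.
- exact: qpol_nonsq.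
have zSE : wz (wmap QtoC T) + wz (wmap QtoC T) + wz (wmap QtoC T) ^+ 3 * f =
    l%:R ^+ k * (2 * e * (1 + l%:R * (2^-1 * (l%:R ^+ k.-1 * e) * wz (wmap QtoC T) * f))).
  by rewrite (exprS _ 2) es2 {1 2 3}eT; field.
rewrite eA in ef; rewrite zSE in ef.
have Ue' : 2 * e * (1 + l%:R * (2^-1 * (l%:R ^+ k.-1 * e) * wz (wmap QtoC T) * f)) \in locunit l.
  apply: locunitM; last by apply: locunit1D => //; locint.
  by apply: locunitM => //; apply/locunitP; split=> //; locint.
set e' := 2 * e * _ in ef Ue'; have [e'0 Ve' _] := locunitP _ _ Ue'.
move: ef nS; rewrite /quartic_add eqxx.
have nv : (v == - v) = false.
  by apply/negbTE; rewrite -addr_eq0 -mulr2n -mulr_natl mulf_neq0.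
rewrite nv [_ && false]/=.
rewrite -/(qderiv p q r u) -/(tangent_slope u v) -/(tangent_const u v).
(* If d were 0, then 2 T would be the origin, whose parameter is 0. *)
have absurd0 : 0 = l%:R ^+ k * e' -> False.
  by move/esym/eqP; rewrite mulf_eq0 (negPf e'0) expf_eq0 (negPf lz) andbF.
have [d0|d0] := eqVneq; first by move=> /absurd0.
rewrite -qphi_map; set uS := _ - u - u; set vS := _ - tangent_const u v => ezS nS.
exists uS, u, (tangent_slope u v), (tangent_const u v), (2 * tangent_slope u v + p), k.
split=> //.
- have ezS' : l%:R ^+ k * e' = l%:R * (l%:R ^+ k.-1 * e') by rewrite {1}k1 exprS mulrA.
  have VwS : l%:R ^+ k.-1 * e' \in locint l by locint.
  have zS0 : l%:R ^+ k * e' != 0 by rewrite mulf_neq0 ?expf_neq0.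
  rewrite ezS ja_ratr jb_ratr in nS.
  have [Uu _ _] := qphi_near_oo pl Vp Vq Vr Vs V2 zS0 VwS ezS' (esym ezS) nS.
  have -> : QtoC uS * l%:R ^+ k = (QtoC uS * (l%:R ^+ k * e')) / e' by field.
  by apply: locunitM => //; apply: locunitV.
- have -> : QtoC (2 * tangent_slope u v + p) * l%:R ^+ k =
    (qderiv (QtoC p) (QtoC q) (QtoC r) (QtoC u) / QtoC v + 4 * QtoC u + QtoC p)
      * wz (wmap QtoC T) / e.
    have v0' : QtoC v != 0 by rewrite fmorph_eq0.
    rewrite eT /tangent_slope /qderiv !(rmorph_nat, rmorphXn, rmorphB, rmorphM, rmorphD, fmorphV) /=.
    by rewrite invfM; field; rewrite e0 v0'.
  by apply: locunitM => //; apply: locunitV.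
apply: tangent_parabola => //.
by move/eqP: onA.
Qed.

End TangentParabola.

(** * Square roots of rational numbers in number fields *)

Section Unramified.
Variable theta : algC.
Local Notation pQ := (map_poly (ratr : rat -> algC)).

Lemma minCpoly_separable : separable_poly (minCpoly theta).
Proof.
have [p [pE pm pP]] := minCpolyP theta; have p0 := monic_neq0 pm.
have rp : root (pQ p) theta by rewrite -pE root_minCpoly.
have [sp irr] : irreducible_poly p.
  by apply/(subfx_irreducibleP rp p0) => g gz g0; rewrite dvdp_leq // -pP.
rewrite pE separable_map unlock; apply/negPn/negP => ncop.
have := irr _ ncop (dvdp_gcdl _ _) => /eqp_dvdl e.
have : p %| p^`() by rewrite -e dvdp_gcdr.
have d0 : p^`() != 0.
  apply/eqP => /(congr1 (fun t : {poly rat} => t`_(size p).-2)).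
  rewrite coef0 coef_deriv; have -> : (size p).-2.+1 = (size p).-1 by case: (size p) sp => [|[]].
  rewrite -/(lead_coef p) (monicP pm) => /eqP; rewrite pnatr_eq0.
  by case: (size p) sp => [|[]].
by move/(dvdp_leq d0); rewrite leqNgt lt_size_deriv.
Qed.

(* If f in Q(theta) has f^2 rational, the conjugates of f are f and - f, so that
   Lagrange interpolation at the conjugates of theta gives f = g(theta) where
   g / f has coefficients from a finite set that does not depend on f. *)
Lemma rational_square_even_val : exists N, forall l, prime l -> (N < l)%N ->
  forall (g : {poly rat}) (d : rat) k, (pQ g).[theta] ^+ 2 = ratr d -> odd k ->
  ratr d * l%:R ^+ k \notin locunit l.
Proof.
have [p [pE pm pP]] := minCpolyP theta.
have [rs rsE] := closed_field_poly_normal (minCpoly theta).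
rewrite (monicP (minCpoly_monic theta)) scale1r in rsE.
have urs : uniq rs by rewrite -separable_prod_XsubC -rsE minCpoly_separable.
have szp : size p = (size rs).+1.
  by rewrite -(size_map_poly (ratr : {rmorphism rat -> algC})) -pE rsE size_prod_XsubC.
have rsP z : (z \in rs) = root (minCpoly theta) z by rewrite rsE root_prod_XsubC.
pose lag z : {poly algC} := \prod_(w <- rs | w != z) ((z - w)^-1 *: ('X - w%:P)).
have lagE z w : z \in rs -> w \in rs -> (lag z).[w] = (w == z)%:R.
  move=> zr wr; rewrite /lag horner_prod; have [->|nwz] := eqVneq w z.
    apply: big1 => v nvz; rewrite hornerZ hornerXsubC mulVf // subr_eq0 eq_sym //.
  rewrite -big_filter (bigD1_seq w) ?mem_filter ?nwz ?filter_uniq //=.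
  by rewrite hornerZ hornerXsubC subrr mulr0 mul0r.
have szlag z : z \in rs -> (size (lag z) <= size rs)%N.
  move=> zr; have -> : lag z = (\prod_(w <- rs | w != z) (z - w)^-1) *:
     \prod_(w <- rs | w != z) ('X - w%:P) by rewrite -scaler_prod.
  apply: (leq_trans (size_scale_leq _ _)).
  rewrite -big_filter size_prod_XsubC size_filter.
  rewrite -[X in (_ <= X)%N](count_predC (pred1 z)) -add1n leq_add //.
  by rewrite -has_count has_pred1.
(* The bound involves only [theta] and the Lagrange polynomials at its conjugates, and so is uniform
   in g and d. *)
have [N hN] := locint_large_seq (theta :: flatten [seq (lag z : seq algC) | z <- rs]).
exists N => l pl lN g d k gd ok; apply/negP => Ud.
have l1 := prime_gt1 pl; have lz : l%:R != 0 :> algC by rewrite pnatr_eq0 -lt0n ltnW.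
have Vtheta : theta \in locint l by apply: hN; rewrite // mem_head.
have Vlag z i : z \in rs -> (lag z)`_i \in locint l.
  move=> zr; have [lti|gei] := ltnP i (size (lag z)); last by rewrite nth_default ?rpred0.
  apply: hN => //; rewrite inE; apply/orP; right; apply/flattenP.
  by exists (lag z : seq algC); [apply: map_f | apply: mem_nth].
set f := (pQ g).[theta] in gd.
have [d0 _ _] := locunitP _ _ Ud; have f0 : f != 0.
  by apply: contraNneq d0 => f0; rewrite -gd f0 expr0n mul0r.
(* As g^2 - d vanishes at theta, it vanishes at every conjugate, where g therefore takes the value f
   or - f. *)
have fz z : z \in rs -> exists2 eps, eps \in locint l & (pQ g).[z] = f * eps.
  rewrite rsP => rz; have : root (pQ (g ^+ 2 - d%:P)) z.
    have : p %| g ^+ 2 - d%:P.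
      by rewrite -pP /root rmorphB rmorphXn /= map_polyC hornerD hornerN hornerC horner_exp -/f gd subrr.
    by case/dvdpP => c ->; rewrite rmorphM /= rootM -pE rz orbT.
  rewrite /root rmorphB rmorphXn /= map_polyC hornerD hornerN hornerC horner_exp.
  rewrite /= -gd subr_sqr mulf_eq0 subr_eq0 addr_eq0 => /orP[]/eqP->.
    by exists 1; rewrite ?rpred1 ?mulr1.
  by exists (-1); rewrite ?rpredN ?rpred1 ?mulrN1.
have /choice[eps heps] : forall z, exists e, z \in rs -> e \in locint l /\ (pQ g).[z] = f * e.
  move=> z; have [zr|nz] := boolP (z \in rs); last by exists 0.
  by have [e Ve ee] := fz z zr; exists e.
pose H := \sum_(z <- rs) eps z *: lag z.
have VH i : H`_i \in locint l.
  rewrite /H coef_sum big_seq; apply: rpred_sum => z zr; rewrite coefZ rpredM ?Vlag //.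
  by have [] := heps z zr.
have eH : pQ (g %% p) = f *: H.
  apply/eqP; rewrite -subr_eq0; apply/eqP; apply: (@roots_geq_poly_eq0 _ _ rs) => //.
    apply/allP => z zr; rewrite /root hornerD hornerN hornerZ /H horner_sum.
    have pz : (pQ p).[z] = 0 by apply/eqP; rewrite -[_ == _]/(root _ _) -pE -rsP.
    rewrite (bigD1_seq z) //= hornerZ lagE // eqxx mulr1 big_seq_cond big1.
      have [_ e] := heps z zr; rewrite addr0 -e {2}(divp_eq g p) rmorphD rmorphM /=.
      by rewrite hornerD hornerM pz mulr0 add0r subrr.
    by move=> w /andP[wr nwz]; rewrite hornerZ lagE // eq_sym (negPf nwz) mulr0.
  apply: (leq_trans (size_polyD _ _)); rewrite geq_max size_polyN; apply/andP; split.
    by rewrite size_map_poly -ltnS -szp ltn_modp monic_neq0.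
  apply: (leq_trans (size_scale_leq _ _)); apply: (leq_trans (size_sum _ _ _)).
  apply/bigmax_leqP_seq => z zr _; apply: (leq_trans (size_scale_leq _ _)); exact: szlag.
have fE : f = (pQ (g %% p)).[theta].
  have pz : (pQ p).[theta] = 0 by apply/eqP; rewrite -[_ == _]/(root _ _) -pE root_minCpoly.
  by rewrite /f {1}(divp_eq g p) rmorphD rmorphM /= hornerD hornerM pz mulr0 add0r.
(* With k = 2 j + 1, the square of f l^(j + 1) is l times the unit U. Each rational coefficient of g
   l^(j + 1) then has a square divisible by l, so is divisible by l itself. Hence f l^(j + 1) = l W
   and U = l W^2, a contradiction. *)
pose j := k./2; have kE : k = j.*2.+1 by rewrite -[LHS]odd_double_half ok.
set U := ratr d * _ in Ud; have [U0 VU _] := locunitP _ _ Ud.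
have F2 : (f * l%:R ^+ j.+1) ^+ 2 = l%:R * U.
  by rewrite exprMn gd /U kE -exprM muln2 doubleS exprS mulrCA.
have coefG i : exists2 w, w \in locint l & ratr ((g %% p)`_i * l%:R ^+ j.+1) = l%:R * w.
  apply: locint_rat_sqr => //; exists (U * H`_i ^+ 2); first by rewrite rpredM ?rpredX.
  have -> : ratr ((g %% p)`_i * l%:R ^+ j.+1) = f * l%:R ^+ j.+1 * H`_i.
    rewrite rmorphM rmorphXn /= rmorph_nat -coef_map eH coefZ; ring.
  by rewrite exprMn F2 [RHS]mulrA.
have /choice[w hw] : forall i, exists w, w \in locint l /\
    ratr ((g %% p)`_i * l%:R ^+ j.+1) = l%:R * w.
  by move=> i; have [w] := coefG i; exists w.
pose W := \sum_(i < size (pQ (g %% p))) w i * theta ^+ i.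
have VW : W \in locint l.
  by apply: rpred_sum => i _; rewrite rpredM ?rpredX //; have [] := hw i.
have FE : f * l%:R ^+ j.+1 = l%:R * W.
  rewrite fE horner_coef mulr_suml mulr_sumr; apply: eq_bigr => i _.
  have [_ e] := hw i; rewrite mulrA -e coef_map rmorphM rmorphXn /= rmorph_nat; ring.
case/negP: (locunit_ndiv l1 Ud); suff -> : U / l%:R = W ^+ 2 by rewrite rpredX.
apply: (mulfI (mulf_neq0 lz lz)); rewrite -[RHS]mulrA -expr2.
transitivity (l%:R * U); first by field.
by rewrite -F2 FE; ring.
Qed.

End Unramified.

(** The field Q(e) is the splitting field of X^2 - d, and its automorphisms commute because each
    sends e to e or - e. *)
Lemma sqrt_rat_in_Qab (e : algC) (d : rat) : e ^+ 2 = ratr d -> e \in Qab.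
Proof.
move=> ed; have [->|e0] := eqVneq e 0; first exact: rpred0.
apply: mem_subfield_gen.
have [Q [QC [[|e1 []] //= [e1E] gen]]] := num_field_exists [:: e].
have e10 : e1 != 0 by apply: contraNneq e0 => e10; rewrite -e1E e10 rmorph0.
have e1d : e1 ^+ 2 = d%:A.
  by apply: (fmorph_inj QC); rewrite rmorphXn /= e1E ed alg_num_field fmorph_rat.
pose pol : {poly Q} := \prod_(z <- [:: e1; - e1]) ('X - z%:P).
have polO : pol \is a polyOver 1%VS.
  have -> : pol = 'X^2 - (d%:A)%:P.
    by rewrite /pol !big_cons big_nil -e1d polyCN rmorphXn /=; ring.
  by rewrite rpredB ?rpredX ?polyOverX // polyOverC rpredZ ?mem1v.
have split_pol : splittingFieldFor 1 pol {:Q}.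
  exists [:: e1; - e1]; first exact: eqpxx.
  apply/eqP; rewrite eqEsubv subvf -gen; apply/Fadjoin_seqP; split; first exact: subv_adjoin_seq.
  by move=> z; rewrite inE => /eqP->; rewrite seqv_sub_adjoin ?mem_head.
have ax : splitting_field_axiom Q by exists pol.
pose mx := FieldExt_isSplittingField.Build _ Q ax.
pose L : splittingFieldType rat := HB.pack Q mx.
have galL : galois 1%AS {:L}%AS.
  apply/splitting_galoisField; exists pol; split=> //.
  rewrite separable_prod_XsubC /= inE andbT -addr_eq0 -mulr2n -mulr_natl mulf_neq0 //.
  by have := ratr_nat Q 2; rewrite -alg_num_field => <-; rewrite scaler_eq0 oner_eq0.
exists L, QC, e1; split=> //.
have sgn (x : gal_of {:L}) : x (e1 : L) = e1 \/ x (e1 : L) = - (e1 : L).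
  have : x (e1 : L) ^+ 2 = (e1 : L) ^+ 2.
    have fix_d : x ((d%:A) : L) = d%:A by rewrite linearZ rmorph1.
    by rewrite -rmorphXn /= -[X in x X]/(e1 ^+ 2) e1d.
  by move/eqP; rewrite eqf_sqr => /orP[]/eqP->; [left | right].
apply/centsP => x _ y _; apply/eqP/gal_eqP => a _.
rewrite !galM ?memvf //.
have : a \in <<1%AS; (e1 : L)>>%VS.
  by rewrite -[<<_; _>>%VS]adjoin_seq1 gen memvf.
case/Fadjoin_polyP => g g1 ->.
have fixg (z : gal_of {:L}) b : z (g.[b]) = g.[z b].
  rewrite -horner_map; congr _.[_]; apply/polyP => i; rewrite coef_map /=.
  have /vlineP[k ->] := polyOverP g1 i.
  by rewrite linearZ rmorph1.
rewrite !fixg; congr _.[_].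
by have [ex|ex] := sgn x; have [ey|ey] := sgn y; rewrite ?ex ?ey ?rmorphN /= ?ex ?ey.
Qed.

(** * Independent points on the Legendre curve *)

Section AdjoinPredicate.
Variable theta : algC.
Local Notation pQ := (map_poly (ratr : rat -> algC)).

(** Membership yields a rational polynomial in [theta], the form in which [rational_square_even_val]
    takes its square roots. *)
Definition Qadj : {pred algC} := [pred x | `[< exists g : {poly rat}, x = (pQ g).[theta] >]].

Lemma QadjP x : reflect (exists g : {poly rat}, x = (pQ g).[theta]) (x \in Qadj).
Proof. exact: asboolP. Qed.

Fact Qadj_divring_closed : divring_closed Qadj.
Proof.
split=> [|_ _ /QadjP[g ->] /QadjP[h ->]|_ y /QadjP[g ->] /QadjP[h eh]]; apply/QadjP.
- by exists 1; rewrite rmorph1 hornerC.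
- by exists (g - h); rewrite rmorphB hornerD hornerN.
have [y0|y0] := eqVneq y 0; first by exists 0; rewrite y0 invr0 mulr0 rmorph0 horner0.
have [p [pE pm pP]] := minCpolyP theta.
have rp : root (pQ p) theta by rewrite -pE root_minCpoly.
have irr : irreducible_poly p.
  apply/(subfx_irreducibleP rp (monic_neq0 pm)) => f fz f0.
  by rewrite dvdp_leq // -pP.
have : coprimep p h by rewrite irreducible_poly_coprime // -pP /root -eh.
case/Bezout_eq1_coprimepP => [[v w] /= e]; exists (g * w).
rewrite rmorphM hornerM; congr (_ * _); apply: (mulfI y0); rewrite divff // eh -hornerM -rmorphM.
have -> : h * w = 1 - v * p by rewrite -e; ring.
by rewrite rmorphB rmorph1 rmorphM hornerD hornerN hornerM hornerC (rootP rp) mulr0 subr0.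
Qed.
HB.instance Definition _ := GRing.isDivringClosed.Build algC Qadj Qadj_divring_closed.

Lemma Qadj_rat a : ratr a \in Qadj.
Proof. by apply/QadjP; exists a%:P; rewrite map_polyC hornerC. Qed.

End AdjoinPredicate.

Section TwistedPoints.
Variables (F : fieldType) (B : divringClosed F) (E : wcurve F).
Hypotheses (Ba : wca E \in B) (Bb : wcb E \in B).

(* The image in E(F) of the B-points of the quadratic twist of E by e^2. *)
Definition twisted (e : F) (P : wpoint E) : Prop :=
  if wpt P is Some (x, y) then x \in B /\ exists2 t, t \in B & y = e * t else True.

Variable e : F.
Hypothesis Be2 : e ^+ 2 \in B.

Lemma twistedD P Q : twisted e P -> twisted e Q -> twisted e (P + Q).
Proof.
rewrite /twisted wptD; case: (wpt P) (wpt Q) => [[x1 y1]|] [[x2 y2]|] //.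
move=> [Bx1 [t1 Bt1 ->]] [Bx2 [t2 Bt2 ->]]; rewrite /wadd; case: ifP => // _.
set m := if _ then _ else _; have [mu Bmu ->] : exists2 mu, mu \in B & m = e * mu.
  rewrite /m; case: ifP => _.
    exists (wderiv (wca E) (wcb E) x1 / (2 * e ^+ 2 * t1)).
      by apply: rpred_div; rewrite /wderiv; locint.
    (* In the cases e = 0 and t1 = 0 both sides are 0, as 0^-1 = 0. *)
    have [->|e0] := eqVneq e 0; first by rewrite !mul0r mulr0 invr0 mulr0.
    have [->|t0] := eqVneq t1 0; first by rewrite !mulr0 invr0 !mulr0.
    by field; rewrite (wc_nz2 E) ?e0 ?t0.
  exists ((t2 - t1) / (x2 - x1)); first by rewrite rpred_div ?rpredB.
  by rewrite mulrA mulrBr.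
have Bx3 : (e * mu) ^+ 2 - wca E - x1 - x2 \in B by rewrite exprMn !rpredB // rpredM // rpredX.
split=> //; exists (mu * (x1 - ((e * mu) ^+ 2 - wca E - x1 - x2)) - t1); last by ring.
by rewrite rpredB ?rpredM // rpredB.
Qed.

Lemma twistedN P : twisted e P -> twisted e (- P).
Proof.
rewrite /twisted wptN; case: (wpt P) => [[x y]|] //= [Bx [t Bt ->]].
by split=> //; exists (- t); rewrite ?rpredN ?mulrN.
Qed.

Lemma twistedMz P n : twisted e P -> twisted e (P *~ n).
Proof.
move=> tP; have tn m : twisted e (P *+ m) by elim: m => // m IH; rewrite mulrS; apply: twistedD.
by case: n => m; [apply: tn | rewrite NegzE mulrNz; apply/twistedN/tn].
Qed.

Lemma twisted_sum n (P : 'I_n -> wpoint E) : (forall i, twisted e (P i)) ->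
  twisted e (\sum_i P i).
Proof. by move=> tP; elim/big_ind: _ => // *; apply: twistedD. Qed.

Lemma twisted_meet P : e \notin B -> twisted e P -> twisted 1 P -> P *+ 2 = 0.
Proof.
move=> nBe; rewrite /twisted; have := wpt_on P; case eP: (wpt P) => [[x y]|] on; last first.
  by move=> _ _; have -> : P = 0; [apply: val_inj | rewrite mul0rn].
move=> [_ [t Bt ey]] [_ [t' Bt']]; rewrite mul1r => ey'.
have t0 : t = 0.
  apply/eqP/negPn/negP => t0; case/negP: nBe.
  by have -> : e = t' / t; [rewrite -ey' ey mulfK | rewrite rpred_div].
by apply: val_inj; rewrite -[LHS]/(wpt _) mulr2n wptD eP /wadd ey t0 mulr0 oppr0 !eqxx.
Qed.

End TwistedPoints.

Section LegendrePoints.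
Variables (K : fieldExtType rat) (iota : {rmorphism K -> algC}) (lambda : K).
Variables p q r s : rat.
Hypothesis irr : irreducible_poly (quartic_poly p q r s).
Local Notation QtoC := (ratr : rat -> algC).
Local Notation L := (iota lambda).
Hypothesis rootL : qpol (QtoC p) (QtoC q) (QtoC r) (QtoC s) L = 0.
Local Notation KQab := (KQab iota).
Local Notation lam := (KQab_inj iota lambda).

Lemma root_neq_rat a : L != QtoC a.
Proof.
apply/eqP => e; move: rootL; rewrite e -horner_map_quartic_poly horner_map horner_quartic_poly /=.
by move/eqP; rewrite fmorph_eq0 (negPf (qpol_neq0 irr a)).
Qed.

Lemma legendre_nonsing : wnonsing (- (1 + L)) L 0.
Proof.
have L0 : L != 0 by have := root_neq_rat 0; rewrite rmorph0.
have L1 : 1 - L != 0 by have := root_neq_rat 1; rewrite rmorph1 subr_eq0 eq_sym.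
move=> x; have -> : wcubic (- (1 + L)) L 0 x = x * (x - 1) * (x - L) by rewrite /wcubic; ring.
move/eqP; rewrite !mulf_eq0 !subr_eq0 => /orP[/orP[]|] /eqP->.
- by have -> : wderiv (- (1 + L)) L 0 = L by rewrite /wderiv; ring.
- by have -> : wderiv (- (1 + L)) L 1 = 1 - L by rewrite /wderiv; ring.
have -> : wderiv (- (1 + L)) L L = - (L * (1 - L)) by rewrite /wderiv; ring.
by rewrite oppr_eq0 mulf_neq0.
Qed.

Let nz2 : 2 != 0 :> algC. Proof. by rewrite pnatr_eq0. Qed.
Definition legC : wcurve algC := WCurve nz2 legendre_nonsing.

Lemma legendre_addE (F : fieldType) (l : F) P Q :
  legendre_add l P Q = wadd (- (1 + l)) l P Q.
Proof.
case: P Q => [[x1 y1]|] [[x2 y2]|] //=; rewrite /wderiv; case: ifP => // _.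
have eD : 3 * x1 ^+ 2 - 2 * (1 + l) * x1 + l = 3 * x1 ^+ 2 + 2 * - (1 + l) * x1 + l by ring.
have eX (m : F) : m ^+ 2 + 1 + l - x1 - x2 = m ^+ 2 - - (1 + l) - x1 - x2 by ring.
by rewrite eD eX.
Qed.

Lemma on_legendreE (F : fieldType) (l : F) P :
  on_legendre l P = on_wcurve (- (1 + l)) l 0 P.
Proof.
case: P => [[x y]|] //=; congr (_ == _); rewrite /wcubic; ring.
Qed.

Let vl : {rmorphism KQab -> algC} := \val.

Lemma legendre_on_legC (R : legendre lam) :
  on_wcurve (wca legC) (wcb legC) (wcc legC) (wmap vl R).
Proof.
have onR : on_legendre lam R by case: R.
by move: onR; rewrite on_legendreE -(wmap_on vl) rmorphN rmorphD rmorph1 rmorph0.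
Qed.

(** Relations between points over K Q^ab are studied in the group of complex algebraic points, which
    contains them. *)
Definition legendre_point (R : legendre lam) : wpoint legC := WPoint (legendre_on_legC R).

Lemma legendre_pointD P Q R : legendre_law lam P Q R ->
  legendre_point P + legendre_point Q = legendre_point R.
Proof.
rewrite /legendre_law legendre_addE => e; apply: val_inj; rewrite /= -e wmap_add.
by rewrite rmorphN rmorphD rmorph1.
Qed.

Variable O : quartic p q r s.
Hypothesis posrank : positive_rank (quartic_law O).

(* With delta = u (u - 1) d, the abscissa u gives the point
   (u, sqrt delta * (L^2 - b L - c) / (d (L - a))). *)
Lemma new_point (theta : algC) : L \in Qadj theta ->
  exists (R : legendre lam) (e : algC), [/\ e ^+ 2 \in Qadj theta, e \notin Qadj theta,
    twisted (Qadj theta) e (legendre_point R)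
    & forall n, (0 < n)%N -> legendre_point R *+ n != 0].
Proof.
move=> BL; have [N1 tan] := rational_tangent irr posrank rootL.
have [N2 unram] := rational_square_even_val theta.
have [N3 VL] := locint_large L.
have [l gtl pl] := prime_above (maxn N1 (maxn N2 N3)).
move: gtl; rewrite !gtn_max => /and3P[lN1 lN2 lN3].
have l1 := prime_gt1 pl; have lz : l%:R != 0 :> algC by rewrite pnatr_eq0 -lt0n ltnW.
have {}VL := VL l pl lN3.
have [u [a [b [c [d [k [ok k2 Uu Ud tanE]]]]]]] := tan l pl lN1.
pose U := QtoC u; pose w := U * l%:R ^+ k.
have Uw : w \in locunit l := Uu; have [w0 Vw Vwi] := locunitP _ _ Uw.
have [dl0 _ _] := locunitP _ _ Ud; have d0 : QtoC d != 0 by move: dl0; rewrite mulf_eq0 => /norP[].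
have U0 : U != 0 by move: w0; rewrite mulf_eq0 => /norP[].
have k1 : l%:R ^+ k = l%:R * l%:R ^+ k.-1 :> algC by rewrite -exprS; case: (k) k2.
(* As U has valuation - k < 0, subtracting an l-integral number does not change its valuation; this
   is used for 1 and L. *)
have subunit x : x \in locint l -> w - x * l%:R ^+ k \in locunit l.
  move=> Vx; have -> : w - x * l%:R ^+ k = w * (1 + l%:R * (- x * l%:R ^+ k.-1 / w)).
    by rewrite k1; field.
  by apply: locunitM => //; apply: locunit1D => //; locint.
have U1u := subunit _ (rpred1 _); rewrite mul1r in U1u.
have ULu := subunit _ VL.
have [w10 _ V1i] := locunitP _ _ U1u; have [wL0 VwL VLi] := locunitP _ _ ULu.
have lk0 : l%:R ^+ k != 0 :> algC by rewrite expf_neq0.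
have U1E : U - 1 = (w - l%:R ^+ k) / l%:R ^+ k by rewrite /w; field.
have ULE : U - L = (w - L * l%:R ^+ k) / l%:R ^+ k by rewrite /w; field.
have U10 : U - 1 != 0 by rewrite U1E mulf_neq0 ?invr_eq0.
have UL0 : U - L != 0 by rewrite ULE mulf_neq0 ?invr_eq0.
pose delta := u * (u - 1) * d; pose e := sqrtC (QtoC delta).
have eE : e ^+ 2 = QtoC delta by rewrite sqrtCK.
have deltaE : QtoC delta = U * (U - 1) * QtoC d by rewrite !rmorphM rmorphB rmorph1.
have e0 : e != 0.
  by have : e ^+ 2 != 0; [rewrite eE deltaE; exact: (mulf_neq0 (mulf_neq0 U0 U10) d0) | rewrite expf_eq0].
have nBe : e \notin Qadj theta.
  apply/QadjP => -[g eg]; rewrite eg in eE.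
  (* Each of the three factors of delta contributes - k, and 3 k is odd. *)
  have := unram l pl lN2 g delta (3 * k)%N eE; rewrite oddM ok => /(_ isT)/negP; apply.
  have -> : QtoC delta * l%:R ^+ (3 * k) = w * (w - l%:R ^+ k) * (QtoC d * l%:R ^+ k).
    by rewrite deltaE U1E mulnC exprM /w; field.
  exact: locunitM (locunitM Uw U1u) Ud.
have La : L - QtoC a != 0 by rewrite subr_eq0 root_neq_rat.
(* By [tanE] the square of [beta0] is (U - L) / d in algC, so multiplying it by the square root of
   delta gives the required ordinate. *)
pose beta0 := (lambda ^+ 2 - b%:A * lambda - c%:A) / ((lambda - a%:A) * d%:A).
have iQ (x : rat) : iota x%:A = QtoC x by rewrite alg_num_field fmorph_rat.
have betaE : iota beta0 = (L ^+ 2 - QtoC b * L - QtoC c) / ((L - QtoC a) * QtoC d).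
  by rewrite /beta0 !(rmorphB, rmorphM, fmorphV, rmorphXn) /= !iQ.
pose y := e * iota beta0.
have onC : y ^+ 2 = U * (U - 1) * (U - L).
  rewrite /y exprMn eE deltaE betaE expr_div_n tanE -/U; field.
  by rewrite d0 La.
have y0 : y != 0.
  by have : y ^+ 2 != 0; [rewrite onC; exact: (mulf_neq0 (mulf_neq0 U0 U10) UL0) | rewrite expf_eq0].
have inU : U \in subfield_gen (in_K_or_Qab iota).
  by apply: mem_subfield_gen; left; exists u%:A; rewrite iQ.
have inY : y \in subfield_gen (in_K_or_Qab iota).
  apply: rpredM; apply: mem_subfield_gen; first by right; apply: sqrt_rat_in_Qab eE.
  by left; exists beta0.
pose R0 : option (KQab * KQab) := Some (SubfieldGen inU, SubfieldGen inY).
have onR : on_legendre lam R0.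
  by rewrite /R0 /=; apply/eqP/(fmorph_inj vl); rewrite rmorphXn !rmorphM !rmorphB rmorph1.
exists (Legendre onR), e.
have Be2 : e ^+ 2 \in Qadj theta by rewrite eE Qadj_rat.
have BK : iota beta0 \in Qadj theta.
  move: (Qadj_rat theta a) (Qadj_rat theta b) (Qadj_rat theta c) (Qadj_rat theta d).
  by move=> Ba Bb Bc Bd; rewrite betaE; apply: rpred_div; locint.
split=> //.
  by split; [apply: Qadj_rat | exists (iota beta0)].
(* This is U / ((U - 1) (U - L)), of odd valuation k; the parameter z itself has valuation k / 2, so
   only its square can be written as a power of l times a unit. *)
have zE : (U / y) ^+ 2 = l%:R ^+ k * (w / ((w - l%:R ^+ k) * (w - L * l%:R ^+ k))).
  rewrite expr_div_n onC U1E ULE; have -> : U = w / l%:R ^+ k by rewrite /w mulfK.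
  by field; rewrite w0 w10 wL0 lk0.
pose s' := l%:R ^+ k.-2 * (w / ((w - l%:R ^+ k) * (w - L * l%:R ^+ k))).
have Vs' : s' \in locint l.
  by rewrite /s' invfM; locint.
have zE2 : (U / y) ^+ 2 = l%:R ^+ 2 * s'.
  by rewrite zE /s' [RHS]mulrA -exprD; case: (k) k2 => [|[]].
move=> n n0; apply: (near_oo_nontorsion (R := legendre_point (Legendre onR)) pl _ _ _ _ _ Vs' zE2) => //=.
- by rewrite rpredN rpredD ?rpred1.
- exact: rpred0.
- by rewrite mulf_neq0 ?invr_eq0.
- by apply: locint_sqr; rewrite zE2 rpredM ?rpredX ?rpred_nat.
split=> //=.
- by have := legendre_on_legC (Legendre onR).
- by exists 1; rewrite ?rpred1 ?mulr1.
exists (y ^+ 2 / U ^+ 3); last by rewrite /ww /wz; field; rewrite y0 U0.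
rewrite onC U1E ULE; have -> : U = w / l%:R ^+ k by rewrite /w mulfK.
have -> : w / l%:R ^+ k * ((w - l%:R ^+ k) / l%:R ^+ k) * ((w - L * l%:R ^+ k) / l%:R ^+ k)
  / (w / l%:R ^+ k) ^+ 3 = (w - l%:R ^+ k) * (w - L * l%:R ^+ k) * w^-1 ^+ 2.
  by field; rewrite w0 lk0.
by locint.
Qed.

Lemma independent_points n : exists R : 'I_n -> legendre lam,
  forall m : 'I_n -> int, \sum_(i < n) legendre_point (R i) *~ m i = 0 -> forall i, m i = 0.
Proof.
elim: n => [|n [R indep]]; first by exists (fun i => Legendre (legendre_pt := None) isT); move=> ? _ [].
pose coords (P : option (algC * algC)) := if P is Some (x, y) then [:: x; y] else [::].
(* A primitive element of the field B generated by L and the coordinates of all previous points. *)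
have [theta _ [ps psE]] := algC_PET (L :: flatten [seq coords (legendre_point (R i)) | i <- enum 'I_n]).
have inB x : x \in L :: flatten [seq coords (legendre_point (R i)) | i <- enum 'I_n] ->
    x \in Qadj theta.
  by rewrite psE => /mapP[g _ ->]; apply/QadjP; exists g.
have BL : L \in Qadj theta by apply: inB; rewrite mem_head.
have [R' [e [Be2 nBe tR' ntR']]] := new_point BL.
exists (fun i => if unlift ord0 i is Some j then R j else R') => m.
rewrite big_ord_recl unlift_none; under eq_bigr => i _ do rewrite liftK.
move/eqP; rewrite addr_eq0 => /eqP em.
have Ba : wca legC \in Qadj theta by rewrite /= rpredN rpredD ?rpred1.
have Bb : wcb legC \in Qadj theta by [].
have B1 : (1 : algC) ^+ 2 \in Qadj theta by rewrite expr1n rpred1.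
(* The relation makes this multiple of the new point defined over B. It also lies in the twist by e,
   so it is killed by 2, and its coefficient is 0 because the new point has infinite order. *)
have t1 : twisted (Qadj theta) 1 (legendre_point R' *~ m ord0).
  rewrite em; apply: twistedN; apply: twisted_sum => // i; apply: twistedMz => //.
  rewrite /twisted; case eP : (wpt (legendre_point (R i))) => [[x y]|] //.
  have in_s z : z \in [:: x; y] -> z \in Qadj theta.
    move=> zP; apply: inB; rewrite inE; apply/orP; right; apply/flattenP.
    exists [:: x; y] => //; apply/mapP; exists i; rewrite ?mem_enum //=.
    by move: eP => /= ->.
  split; first by apply: in_s; rewrite mem_head.
  by exists y; rewrite ?mul1r // in_s // !inE eqxx orbT.
have t0 := twisted_meet nBe (twistedMz Ba Bb Be2 (m ord0) tR') t1.
have m0 : m ord0 = 0.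
  apply/eqP/negPn/negP => m0; have /eqP[] : legendre_point R' *+ (`|m ord0| * 2)%N != 0.
    by apply: ntR'; rewrite muln_gt0 absz_gt0 m0.
  rewrite mulrnA; case: (m ord0) t0 => j; first by [].
  by rewrite NegzE mulrNz mulNrn => /eqP; rewrite oppr_eq0 => /eqP.
have ind := indep (fun i => m (lift ord0 i)).
move=> i; have [j ->|->//] := unliftP ord0 i.
apply: ind; move: em; rewrite m0 mulr0z => /esym/eqP.
by rewrite oppr_eq0 => /eqP.
Qed.

End LegendrePoints.

Theorem theorem7
  (K : fieldExtType rat) (iota : {rmorphism K -> algC})
  (dimK : \dim {:K} = 4%N)
  (lambda : K) (genK : <<1; lambda>>%VS = {:K}%VS)
  (p q r s : rat)
  (minP : map_poly (in_alg K)
            ('X^4 + p *: 'X^3 + q *: 'X^2 + r *: 'X + s%:P)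
          = minPoly 1%VS lambda)
  (O : quartic p q r s)
  (posrank : positive_rank (quartic_law O)) :
  infinite_rank (legendre_law (KQab_inj iota lambda)).
Proof.
rewrite -/(quartic_poly p q r s) in minP.
have irr : irreducible_poly (quartic_poly p q r s).
  split=> [|g szg gdv]; first by rewrite size_quartic_poly.
  have Og : map_poly (in_alg K) g \is a polyOver 1%VS.
    by apply/polyOverP => i; rewrite coef_map rpredZ ?mem1v.
  have : map_poly (in_alg K) g %| minPoly 1 lambda by rewrite -minP dvdp_map.
  case/(minPoly_irr Og)/orP; first by rewrite -minP eqp_map.
  by rewrite -size_poly_eq1 size_map_poly (negPf szg).
have rootL : qpol (ratr p) (ratr q) (ratr r) (ratr s) (iota lambda) = 0.
  rewrite -horner_map_quartic_poly; apply/eqP.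
  have := root_minPoly 1 lambda; rewrite -minP -(fmorph_root iota) -map_poly_comp.
  congr (root _ _); apply: eq_map_poly => x /=.
  by rewrite alg_num_field fmorph_rat.
move=> n; have [R indep] := independent_points irr rootL posrank n.
exact: (rank_ge_zmod (@legendre_pointD _ _ _ _ _ _ _ irr rootL) indep).
Qed.
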